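(* Let $\mathbb D,\mathbb E$ be Banach spaces with norms $\|\cdot\|_{\mathbb D},\|\cdot\|_{\mathbb E}$, let $\mathbb D_0\subseteq\mathbb D$, $\mathbb D_\phi\subseteq\mathbb D$, $\theta_0\in\mathbb D_\phi$, and let $\phi:\mathbb D_\phi\to\mathbb E$. Suppose: (1) $\phi$ is Hadamard directionally differentiable at $\theta_0$ tangentially to $\mathbb D_0$, and its derivative $\phi'_{\theta_0}:\mathbb D_0\to\mathbb E$ can be extended to a continuous map on all of $\mathbb D$ (also denoted $\phi'_{\theta_0}$). (2) There are maps $\hat\theta_n:\{X_i\}_{i=1}^n\to\mathbb D_\phi$ and scalars $r_n\uparrow\infty$ with $r_n\{\hat\theta_n-\theta_0\}\stackrel{L}{\rightarrow}\mathbb G_0$ in $\mathbb D$, where $\mathbb G_0$ is tight and its support is included in $\mathbb D_0$. (3) $\hat\theta_n^*:\{X_i,W_i\}_{i=1}^n\to\mathbb D_\phi$ with $\{W_i\}_{i=1}^n$ independent of $\{X_i\}_{i=1}^n$, and $\sup_{f\in \mathrm{BL}_1(\mathbb D)}|E[f(r_n\{\hat\theta_n^*-\hat\theta_n\})|\{X_i\}_{i=1}^n]-E[f(\mathbb G_0)]|=o_p(1)$. (4) The sequence $r_n\{\hat\theta_n^*-\hat\theta_n\}$ is asymptotically measurable (jointly in $\{X_i,W_i\}_{i=1}^n$), and for every continuous bounded $f:\mathbb D\to\mathbf R$, $f(r_n\{\hat\theta_n^*-\hat\theta_n\})$ is a measurable function of $\{W_i\}_{i=1}^n$ outer almost surely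 in $\{X_i\}_{i=1}^n$. (5) $\mathbb G_0$ is a Gaussian measure whose support is a vector subspace of $\mathbb D$. If the limiting distribution of $r_n\{\phi(\hat\theta_n)-\phi(\theta_0)\}$ (that is, the law of $\phi'_{\theta_0}(\mathbb G_0)$ on $\mathbb E$) is not Gaussian, then the standard bootstrap is inconsistent, i.e. it is not the case that $$\sup_{f\in \mathrm{BL}_1(\mathbb E)}\big|E[f(r_n\{\phi(\hat\theta_n^* )-\phi(\hat\theta_n)\})|\{X_i\}_{i=1}^n]-E[f(\phi'_{\theta_0}(\mathbb G_0))]\big|=o_p(1).$$
   Context: Banach spaces are over the reals. A map $\phi:\mathbb D_\phi\subseteq\mathbb D\to\mathbb E$ is Hadamard directionally differentiable at $\theta\in\mathbb D_\phi$ tangentially to $\mathbb D_0\subseteq\mathbb D$ if there is a continuous (not necessarily linear) map $\phi'_\theta:\mathbb D_0\to\mathbb E$ such that $\lim_{n}\|\{\phi(\theta+t_nh_n)-\phi(\theta)\}/t_n-\phi'_\theta(h)\|_{\mathbb E}=0$ for all $\{h_n\}\subset\mathbb D$, $\{t_n\}\subset\mathbf R_+$ with $t_n\downarrow0$, $h_n\to h\in\mathbb D_0$ and $\theta+t_nh_n\in\mathbb D_\phi$ for all $n$. $\{X_i\}_{i=1}^n$ is the data and $\{W_i\}_{i=1}^n$ are random weights; $\hat\theta_n:\{X_i\}_{i=1}^n\to\mathbb D_\phi$ means $\hat\theta_n$ is a (not necessarily measurable) $\mathbb D_\phi$-valued function of the data, and similarly for $\hat\theta_n^*$. The ''standard bootstrap''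 is the law of $r_n\{\phi(\hat\theta_n^* )-\phi(\hat\theta_n)\}$ conditional on the data. Convergence in distribution $\stackrel{L}{\to}$ is in the Hoffman-Jørgensen sense: $Z_n\stackrel{L}{\to}Z$ ($Z$ Borel) means $E^*[f(Z_n)]\to E[f(Z)]$ for all bounded continuous real $f$, where $E^*$ is outer expectation ($E_*$ inner expectation). Expectations and probabilities of possibly nonmeasurable objects are outer ones; $o_p(1)$ is convergence to zero in outer probability. $E[\,\cdot\,|\{X_i\}_{i=1}^n]$ denotes outer expectation with respect to the joint law of $\{W_i\}_{i=1}^n$ treating the data as constant. $Z_n$ is asymptotically measurable if $E^*[f(Z_n)]-E_*[f(Z_n)]\to0$ for all bounded continuous $f$. For a normed space $\mathbf A$, $\mathrm{BL}_1(\mathbf A)=\{f:\mathbf A\to\mathbf R:\ |f(a)|\le1,\ |f(a)-f(a')|\le\|a-a'\|_{\mathbf A}\ \forall a,a'\in\mathbf A\}$. $\mathbb G_0$ is a Borel random element of $\mathbb D$, identified with its law; a Gaussian measure need not be centered. *)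

(* Defs.v *)
From mathcomp Require Import all_boot all_order all_algebra.
From mathcomp Require Import all_classical all_reals all_analysis.
From mathcomp Require Import measurable_realfun.

Set Implicit Arguments.
Unset Strict Implicit.
Unset Printing Implicit Defensive.

Import Order.TTheory GRing.Theory Num.Theory.
Import numFieldNormedType.Exports.

Local Open Scope classical_set_scope.
Local Open Scope ring_scope.

(* A normed space with its Borel sigma-algebra. *)
Notation borel V := (g_sigma_algebraType (@open V)).

(* E^*[g] = inf E[U] over the measurable U >= g such that E[U] exists, i.e.
   such that one of E[U^+], E[U^-] is finite.  The existence condition matters:
   the library integral is -oo when both parts are infinite. *)
Definition outer_expectation d (T : measurableType d) (R : realType)
    (P : set T -> \bar R) (g : T -> \bar R) : \bar R :=
  ereal_inf [set (\int[P]_x U x)%E | U in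
    [set U : T -> \bar R |
      [/\ measurable_fun setT U,
          (\int[P]_x (U^\+)%E x < +oo \/ \int[P]_x (U^\-)%E x < +oo)%E
        & forall x, (g x <= U x)%E]]].

Definition inner_expectation d (T : measurableType d) (R : realType)
    (P : set T -> \bar R) (g : T -> \bar R) : \bar R :=
  (- outer_expectation P (fun x => - g x))%E.

Definition outer_probability d (T : measurableType d) (R : realType)
    (P : set T -> \bar R) (A : set T) : \bar R :=
  ereal_inf [set P B | B in [set B | measurable B /\ A `<=` B]].

(* Convergence to 0 in outer probability; the space may vary with n. *)
Definition is_op1 (d : nat -> measure_display)
    (T : forall n, measurableType (d n)) (R : realType)
    (P : forall n, set (T n) -> \bar R) (Z : forall n, T n -> \bar R) : Prop :=
  forall e : R, 0 < e ->
    outer_probability (P n) [set x | (e%:E < `|Z n x|)%E] @[n --> \oo]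
      --> 0%E.

Definition bounded_continuous (R : realType) (V : normedModType R) :
    set (V -> R) :=
  [set f | continuous f /\ exists M : R, forall v, `|f v| <= M].

Definition BL1 (R : realType) (V : normedModType R) : set (V -> R) :=
  [set f | (forall a, `|f a| <= 1) /\
           (forall a b, `|f a - f b| <= `|a - b|)].

(* Hoffman-Jorgensen weak convergence of Z n to the Borel law mu. *)
Definition cvg_in_law (d : nat -> measure_display)
    (T : forall n, measurableType (d n)) (R : realType) (V : normedModType R)
    (P : forall n, set (T n) -> \bar R) (Z : forall n, T n -> V)
    (mu : set (borel V) -> \bar R) : Prop :=
  forall f, bounded_continuous f ->
    outer_expectation (P n) (fun x => (f (Z n x))%:E) @[n --> \oo]
      --> (\int[mu]_z (f z)%:E)%E.

Definition asymptotically_measurable (d : nat -> measure_display)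
    (T : forall n, measurableType (d n)) (R : realType) (V : normedModType R)
    (P : forall n, set (T n) -> \bar R) (Z : forall n, T n -> V) : Prop :=
  forall f : V -> R, bounded_continuous f ->
    (outer_expectation (P n) (fun x => (f (Z n x))%:E)
       - inner_expectation (P n) (fun x => (f (Z n x))%:E))%E @[n --> \oo]
      --> 0%E.

(* sup over f in BL1(V) of | E^*[f(Z)] - E[f(g(G))] |, where Z is defined on
   (T, Q) and G has law mu. *)
Definition BL_discrepancy d (T : measurableType d) d' (T' : measurableType d')
    (R : realType) (V : normedModType R)
    (Q : set T -> \bar R) (Z : T -> V)
    (mu : set T' -> \bar R) (g : T' -> V) : \bar R :=
  ereal_sup [set `|outer_expectation Q (fun w => (f (Z w))%:E)
                   - \int[mu]_z (f (g z))%:E|%E | f in @BL1 R V].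

(* phi is a total function only for convenience: its values outside Dphi are
   never used.  Likewise only the restriction of dphi to D0 is used. *)
Definition hadamard_directional_derivative (R : realType)
    (D E : normedModType R) (Dphi : set D) (phi : D -> E) (theta : D)
    (D0 : set D) (dphi : D -> E) : Prop :=
  {within D0, continuous dphi} /\
  forall (t : nat -> R) (h : nat -> D) (h0 : D),
    (forall n, 0 < t n) -> nonincreasing_seq t -> t @ \oo --> (0 : R) ->
    h @ \oo --> h0 -> D0 h0 ->
    (forall n, Dphi (theta + t n *: h n)) ->
    `|(t n)^-1 *: (phi (theta + t n *: h n) - phi theta) - dphi h0|
      @[n --> \oo] --> (0 : R).

Definition tight_law (R : realType) (V : normedModType R)
    (mu : set (borel V) -> \bar R) : Prop :=
  forall e : R, 0 < e ->
    exists K : set V, compact K /\ ((1 - e)%:E <= mu K)%E.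

(* For a tight law this is the smallest closed set of full measure. *)
Definition law_support (R : realType) (V : normedModType R)
    (mu : set (borel V) -> \bar R) : set V :=
  [set x | forall U : set V, open U -> U x -> (0 < mu U)%E].

Definition vector_subspace (R : realType) (V : normedModType R) (S : set V) :
    Prop :=
  GRing.submod_closed (mem S).

(* Possibly degenerate normal law on the line.  The point mass is a separate
   case because normal_prob m 0 is the uniform law on [0, 1]. *)
Definition normal_law (R : realType) (nu : set R -> \bar R) : Prop :=
  exists m : R,
    (exists2 s : R, 0 < s &
       forall B : set R, measurable B -> nu B = normal_prob m s B) \/
    (forall B : set R, measurable B -> nu B = dirac m B).

(* Every continuous linear functional has a (possibly degenerate, not
   necessarily centered) normal law. *)
Definition gaussian_law (R : realType) (V : normedModType R)
    (mu : set (borel V) -> \bar R) : Prop :=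
  forall l : {linear V -> R^o}, continuous l ->
    normal_law (fun B : set R => mu (l @^-1` B)).

(* Under the joint law J, the two coordinates are independent with laws P
   and Q. *)
Definition independent_coordinates d (T : measurableType d) d'
    (T' : measurableType d') (R : realType)
    (P : set T -> \bar R) (Q : set T' -> \bar R)
    (J : set (T * T')%type -> \bar R) : Prop :=
  forall A B, measurable A -> measurable B -> J (A `*` B) = (P A * Q B)%E.

(* Main.v *)
(* Let S be the support of G.  If the bootstrap were consistent, then for every
   a in S the law of phi'(a + G) - phi'(a) would be that of phi'(G): condition on
   data for which r_n (theta_hat - theta_0) is close to a, which has outer
   probability bounded away from 0.  So, for a continuous linear form l, the map
   g = l o phi' is positively homogeneous and g(a + G) - g(a) has the law of g(G)
   for every a in S.  Equalities in law between linear combinations of independent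
   copies of the Gaussian G then show that g(G) has a second moment.  With X, Y
   independent copies of G and T = g(X + Y) - g(X) - g(Y), conditioning on X gives
   E[(g(X + Y) - g(Y))^2] = E[T^2] + E[g(X)^2], while conditioning on Y gives
   E[g(X)^2]; so T = 0, g is additive, hence linear, on S, and by Hahn-Banach it
   agrees on S with a continuous linear form.  Therefore g(G) is normal for every
   l, and phi'(G) is Gaussian. *)

(* [D] need not be separable, so continuous functions on [D * D] need not be measurable for the
   product sigma-algebra. Independent copies are therefore integrated out one at a time; such an
   iterated integral is a tight linear functional on bounded continuous functions, and by
   Stone-Weierstrass it is determined by its values at the functions [cos (l x + c)]. This yields
   both the exchange of integrals and the equality of Gaussian pairs. [G0] need not be centered, so
   rotating two copies may change the law. Take instead [x = z1 + z2 + c z3] and [y = z1 + z2], and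
   compare [y] with [2 x / (2 + c^2) + b z4]: covariances and means agree, whatever the mean, for no
   nonzero [c] but [c = 4], with [b = 4/3]. Conditioning on [x], then on [y], gives [9 g(y) - g(x)]
   the law of [12 g(z)] and that of [8 g(z1) + 8 g(z2) - 4 g(z3)]. Comparing moduli of
   characteristic functions then bounds the second moment of a symmetrized [g(G)]. Data and weights
   are seen only through outer expectations, so a deterministic sequence of good data is selected;
   along it, monotonicity of outer expectation is enough. *)
Require Import Defs.
From HB Require Import structures.
From mathcomp Require Import all_boot all_order all_algebra.
From mathcomp Require Import all_classical all_reals all_analysis.
From mathcomp Require Import measurable_realfun ring lra.

Set Implicit Arguments.
Unset Strict Implicit.
Unset Printing Implicit Defensive.

Import Order.TTheory GRing.Theory Num.Theory.
Import numFieldNormedType.Exports.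

Local Open Scope classical_set_scope.
Local Open Scope ring_scope.

(** * The Hahn-Banach theorem *)

Section hahn_banach.
Variables (R : realType) (V : lmodType R) (p : V -> R).
Hypothesis p_subadd : forall x y, p (x + y) <= p x + p y.
Hypothesis p_homog : forall t x, 0 < t -> p (t *: x) = t * p x.

(* Partial linear forms dominated by p are handled through their graphs;
   domination forces such a graph to be single-valued. *)
Let dominated_graph (G : set (V * R)) :=
  [/\ G (0, 0),
      forall a x r y s, G (x, r) -> G (y, s) -> G (a *: x + y, a * r + s)
    & forall x r, G (x, r) -> r <= p x].

(** Two values at [x] would put some [(0, c)] with [c > 0] in the graph, and a large multiple of it
    breaks the bound [p 0]. *)
Let dominated_graph_fun G x r s :
  dominated_graph G -> G (x, r) -> G (x, s) -> r = s.
Proof.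
move=> [G0 Gl Gp] Gr Gs.
suff H r1 s1 : G (x, r1) -> G (x, s1) -> r1 <= s1.
  by apply/eqP; rewrite eq_le !H.
move=> {Gr Gs r s} Gr Gs; rewrite leNgt; apply/negP => sr.
have Gd : G (0, r1 - s1).
  by have := Gl (-1) _ _ _ _ Gs Gr; rewrite scaleN1r addNr mulN1r addrC.
have p0 : 0 <= p 0 by rewrite (Gp _ _ G0).
pose t := (p 0 + 1) / (r1 - s1).
have := Gl t _ _ _ _ Gd G0; rewrite scaler0 !addr0 => /Gp.
by rewrite /t divfK ?gt_eqF ?subr_gt0//; lra.
Qed.

(** Subadditivity of [p] leaves room for [c] between all [r - p (x - x0)] and all [p (y + x0) - s];
    the supremum of the former is taken. Positive homogeneity reduces every [t] to 1, -1 or 0. *)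
Let extension G x0 : dominated_graph G ->
  exists c, dominated_graph [set z | exists x r t,
    [/\ G (x, r), z.1 = x + t *: x0 & z.2 = r + t * c]].
Proof.
move=> [G0 Gl Gp].
have Gadd x r y s : G (x, r) -> G (y, s) -> G (x + y, r + s).
  by move=> h1 h2; have := Gl 1 _ _ _ _ h1 h2; rewrite scale1r mul1r.
have Gscale a x r : G (x, r) -> G (a *: x, a * r).
  by move=> h1; have := Gl a _ _ _ _ h1 G0; rewrite !addr0.
pose L := [set r | exists x s, G (x, s) /\ r = s - p (x - x0)].
have Lub y s : G (y, s) -> ubound L (p (y + x0) - s).
  move=> Gy _ [x [r [Gx ->]]]; have := Gp _ _ (Gadd _ _ _ _ Gx Gy) => h.
  have := p_subadd (x - x0) (y + x0).
  by rewrite addrACA addNr addr0; lra.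
have L0 : L !=set0 by exists (0 - p (0 - x0)), 0, 0.
have Lsup : has_sup L by split=> //; exists (p (0 + x0) - 0); exact: Lub G0.
exists (sup L); set c := sup L.
have c_lo x r : G (x, r) -> r - p (x - x0) <= c.
  by move=> Gx; apply: (ub_le_sup Lsup.2); exists x, r.
have c_hi y s : G (y, s) -> c <= p (y + x0) - s.
  by move=> Gy; apply: (ge_sup L0); exact: Lub.
split.
- by exists 0, 0, 0; rewrite scale0r mul0r !addr0.
- move=> a x r y s [x1 [r1 [t1 [Gx /= -> ->]]]] [x2 [r2 [t2 [Gy /= -> ->]]]].
  exists (a *: x1 + x2), (a * r1 + r2), (a * t1 + t2); split=> /=.
  + exact: Gl.
  + by rewrite scalerDr scalerDl scalerA addrACA.
  + by ring.
- move=> x r [x1 [r1 [t [Gx /= -> ->]]]].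
  have [t0|t0|->] := ltgtP t 0.
  + have nt0 : 0 < - t by rewrite oppr_gt0.
    have := c_lo _ _ (Gscale (- t)^-1 _ _ Gx).
    rewrite -(ler_pM2l nt0) mulrBr -p_homog//.
    rewrite mulrA mulfV ?gt_eqF// mul1r scalerBr scalerA mulfV ?gt_eqF//.
    by rewrite scale1r scaleNr opprK; lra.
  + have := c_hi _ _ (Gscale t^-1 _ _ Gx).
    rewrite -(ler_pM2l t0) mulrBr -p_homog//.
    rewrite mulrA mulfV ?gt_eqF// mul1r scalerDr scalerA mulfV ?gt_eqF//.
    by rewrite scale1r; lra.
  + by rewrite scale0r mul0r !addr0; exact: Gp.
Qed.

Lemma hahn_banach (S : set V) (f : V -> R) :
  S 0 -> (forall a x y, S x -> S y -> S (a *: x + y)) ->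
  (forall a x y, S x -> S y -> f (a *: x + y) = a * f x + f y) ->
  (forall x, S x -> f x <= p x) ->
  exists l : {linear V -> R^o},
    (forall x, S x -> l x = f x) /\ (forall x, l x <= p x).
Proof.
move=> S0 Sl fl fp.
pose G0 := [set z : V * R | S z.1 /\ z.2 = f z.1].
have f0 : f 0 = 0.
  by have := fl (-1) _ _ S0 S0; rewrite scaler0 addr0 mulN1r addNr.
have goodG0 : dominated_graph G0.
  split; first by split.
  - by move=> a x r y s [/= Sx ->] [/= Sy ->]; split=> /=; [exact: Sl|rewrite fl].
  - by move=> x r [/= Sx ->]; exact: fp.
(* The union with [G0] makes the empty chain harmless and keeps every candidate above [G0]. *)
pose P (A : set (V * R)) := dominated_graph (A `|` G0).
have [A [goodA maxA]] : exists A, P A /\ forall B, A `<` B -> ~ P B.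
  apply: Zorn_bigcup => F FP Ftot; rewrite /P.
  have [[X0 FX0]|Fempty] := pselect (exists X, F X); last first.
    rewrite (_ : \bigcup_(X in F) X = set0) ?set0U//.
    by rewrite -subset0 => z [X FX _]; apply: Fempty; exists X.
  have inF z : (\bigcup_(X in F) X `|` G0) z -> exists2 X, F X & (X `|` G0) z.
    by move=> [[X FX Xz]|Gz]; [exists X => //; left|exists X0 => //; right].
  have Fin X z : F X -> (X `|` G0) z -> (\bigcup_(X in F) X `|` G0) z.
    by move=> FX [Xz|]; [left; exists X|right].
  split.
  - by right; case: goodG0.
  - move=> a x r y s /inF[X FX Xx] /inF[Y FY Yy].
    have [XY|YX] := Ftot _ _ FX FY.
      apply: (Fin Y) => //; have [_ + _] := FP _ FY; apply => //.
      by case: Xx => [/XY|]; [left|right].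
    apply: (Fin X) => //; have [_ + _] := FP _ FX; apply => //.
    by case: Yy => [/YX|]; [left|right].
  - by move=> x r /inF[X FX Xx]; have [_ _] := FP _ FX; apply.
set G := A `|` G0 in goodA.
have total x : exists r, G (x, r).
  apply: contrapT => nGx; have [c goodG'] := extension x goodA.
  set G' := (X in dominated_graph X) in goodG'.
  have GG' : G `<=` G'.
    by move=> [y s] Gy; exists y, s, 0; rewrite scale0r mul0r !addr0.
  have G'x : G' (x, c).
    exists 0, 0, 1; rewrite scale1r mul1r !add0r; split=> //.
    by case: goodA.
  apply: (maxA G').
    split=> [z Az|AG']; first by apply: GG'; left.
    by apply: nGx; exists c; left; exact: AG'.
  rewrite /P (_ : G' `|` G0 = G')//; apply/seteqP; split=> [z [//|Gz]|z]; last by left.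
  by apply: GG'; right.
pose l x := sval (cid (total x)).
have Gl x : G (x, l x) by rewrite /l; case: cid.
have lin : linear (l : V -> R^o).
  move=> a x y; have [_ + _] := goodA => /(_ a _ _ _ _ (Gl x) (Gl y)).
  exact: (dominated_graph_fun goodA (Gl _)).
pose lM := GRing.isLinear.Build R V R^o *:%R l lin.
pose lL : {linear V -> R^o} := HB.pack l lM.
exists lL; split=> x.
- move=> Sx; apply: (dominated_graph_fun goodA (Gl x)); right; split=> //.
- by have [_ _] := goodA => /(_ _ _ (Gl x)).
Qed.

End hahn_banach.

Lemma hahn_banach_norm (R : realType) (V : normedModType R) (S : set V)
    (f : V -> R) (C : R) :
  S 0 -> (forall a x y, S x -> S y -> S (a *: x + y)) ->
  (forall a x y, S x -> S y -> f (a *: x + y) = a * f x + f y) ->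
  (forall x, S x -> `|f x| <= C * `|x|) ->
  exists l : {linear V -> R^o},
    continuous l /\ forall x, S x -> l x = f x.
Proof.
move=> S0 Sl fl fC.
(* [C] may be negative if [S] is trivial; [|C|] keeps the dominating function subadditive. *)
have fC' x : S x -> `|f x| <= `|C| * `|x|.
  by move=> /fC/le_trans; apply; rewrite ler_wpM2r// ler_norm.
have [|||l [lS lC]] := @hahn_banach R V (fun x => `|C| * `|x|) _ _ S f S0 Sl fl.
- by move=> x y; rewrite -mulrDr ler_wpM2l// ler_normD.
- by move=> t x t0; rewrite normrZ gtr0_norm// mulrCA.
- by move=> x Sx; exact: le_trans (ler_norm _) (fC' _ Sx).
exists l; split=> //; apply: bounded_linear_continuous.
apply/linear_boundedP; exists `|C|; split=> [|r Cr x]; first exact: num_real.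
apply: (@le_trans _ _ (`|C| * `|x|)); last by rewrite ler_wpM2r// ltW.
rewrite ler_norml lC andbT lerNl; have := lC (- x).
by rewrite normrN linearN.
Qed.

Lemma linear_separation (R : realType) (V : normedModType R) (x : V) :
  x != 0 -> exists l : {linear V -> R^o}, continuous l /\ l x = 1.
Proof.
move=> x0; have nx0 : `|x| != 0 by rewrite normr_eq0.
pose S := [set y | exists t : R, y = t *: x].
have xinj t s : t *: x = s *: x -> t = s.
  move=> /eqP; rewrite -subr_eq0 -scalerBl scaler_eq0 (negbTE x0) orbF subr_eq0.
  by move/eqP.
pose f y := if pselect (S y) is left h then sval (cid h) else 0.
have fE t : f (t *: x) = t.
  rewrite /f; case: pselect => [h|[]]; last by exists t.
  by case: cid => s /= /xinj.
have [|||y|l [lc lS]] := @hahn_banach_norm R V S f (`|x|^-1).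
- by exists 0; rewrite scale0r.
- move=> a _ _ [t ->] [s ->]; exists (a * t + s).
  by rewrite scalerDl scalerA.
- by move=> a _ _ [t ->] [s ->]; rewrite scalerA -scalerDl !fE.
- by move=> [t ->]; rewrite fE normrZ mulrCA mulVf// mulr1.
exists l; split=> //; rewrite lS; last by exists 1; rewrite scale1r.
by rewrite -[in LHS](scale1r x) fE.
Qed.

(** * Trigonometric polynomials and tight functionals *)

(** If [K] failed, the sets [K] minus [B] with [P B] would generate a proper filter, and its cluster
    point in [K] would have a neighbourhood satisfying [P]. This replaces finite subcovers
    throughout. *)
Lemma compact_induction (T : topologicalType) (K : set T) (P : set T -> Prop) :
  compact K -> P set0 -> (forall A B, A `<=` B -> P B -> P A) ->
  (forall A B, P A -> P B -> P (A `|` B)) ->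
  (forall x, K x -> exists2 U, nbhs x U & P U) -> P K.
Proof.
move=> cK P0 Psub PU Ploc; apply: contrapT => nPK.
pose F := [set A | exists2 B, P B & K `\` B `<=` A].
have FF : ProperFilter F.
  apply: Build_ProperFilter_ex.
  - move=> A [B PB KBA]; apply: contrapT => A0; apply: nPK.
    apply: (Psub _ B) => // x Kx; apply: contrapT => nBx.
    by apply: A0; exists x; exact: KBA.
  - split=> [|A B [A' PA' AA'] [B' PB' BB']|A B AB [A' PA' AA']].
    + by exists set0.
    + exists (A' `|` B'); first exact: PU.
      move=> x [Kx /not_orP[nA nB]]; split; [exact: AA'|exact: BB'].
    + by exists A' => //; exact: subset_trans AB.
have FK : F K by exists set0 => // x [].
have [x [Kx clx]] := cK F FF FK.
have [U xU PU'] := Ploc _ Kx.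
have FKU : F (K `\` U) by exists U.
by have [y [[_ nUy] Uy]] := clx _ _ FKU xU.
Qed.

Section abs_approximation.
Variable R : realType.
Implicit Types (x : R) (n : nat).

(** The classical polynomial iteration for the square root of [x ^+ 2], started at 0. *)
Fixpoint abs_approx n x : R :=
  if n is n'.+1 then
    abs_approx n' x + (x ^+ 2 - abs_approx n' x ^+ 2) / 2
  else 0.

Lemma abs_approxP n x : `|x| <= 1 ->
  0 <= abs_approx n x <= `|x| /\
  (`|x| - abs_approx n x) * (1 + n%:R * (`|x| / 2)) <= `|x|.
Proof.
move=> x1; elim: n => [|n [/andP[q0 qx] IH]] /=.
  by rewrite lexx normr_ge0 subr0 mul0r addr0 mulr1.
set q := abs_approx n x in q0 qx IH *; set a := `|x| in x1 qx IH *.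
have -> : x ^+ 2 = a ^+ 2 by rewrite real_normK// num_real.
have n0 : 0 <= n%:R :> R by [].
split; first by apply/andP; split; nra.
rewrite -natr1; set m : R := n%:R in n0 IH *.
have -> : (a - (q + (a ^+ 2 - q ^+ 2) / 2)) = (a - q) * (1 - (a + q) / 2).
  by field.
apply: le_trans IH; rewrite -mulrA ler_wpM2l ?subr_ge0//.
have h : 0 <= m * (a * a) by rewrite mulr_ge0// mulr_ge0// (le_trans q0).
have h2 : 0 <= m * (a * q).
  by rewrite mulr_ge0// mulr_ge0// (le_trans q0).
have a0 : 0 <= a by exact: le_trans qx.
have aq : 0 <= a * q by exact: mulr_ge0.
have aa : 0 <= a * a by exact: mulr_ge0.
rewrite -subr_ge0 (_ : _ - _ =
  q / 2 + (m * (a * a) + m * (a * q) + a * a + a * q) / 4); last by field.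
by rewrite addr_ge0 ?divr_ge0 ?addr_ge0.
Qed.

Lemma abs_approx_le n x : `|x| <= 1 -> (0 < n)%N ->
  `| `|x| - abs_approx n x| <= 2 / n%:R.
Proof.
move=> x1 n0; have [/andP[q0 qx] h] := abs_approxP n x1.
have n0' : 0 < n%:R :> R by rewrite ltr0n.
rewrite ger0_norm ?subr_ge0// ler_pdivlMr//.
have [->|xn0] := eqVneq `|x| 0; first by move: q0; nra.
have a0 : 0 < `|x| by rewrite lt_def xn0 normr_ge0.
rewrite -(ler_pM2r a0).
set q := abs_approx n x in q0 qx h *; set a := `|x| in a0 qx h x1 *.
set m : R := n%:R in n0' h *.
by nra.
Qed.

End abs_approximation.

(** * Stone-Weierstrass for trigonometric polynomials *)

Section stone_weierstrass.
Variables (R : realType) (V : normedModType R).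
Implicit Types (f g h : V -> R) (l : {linear V -> R^o}).

(** The phase [c] stands in for sines, so the product-to-sum formula for cosines alone makes this
    span an algebra. *)
Inductive trig_poly : (V -> R) -> Prop :=
| trig_poly_cos l (c : R) : continuous l -> trig_poly (fun x => cos (l x + c))
| trig_polyD f g : trig_poly f -> trig_poly g -> trig_poly (fun x => f x + g x)
| trig_polyZ (a : R) f : trig_poly f -> trig_poly (fun x => a * f x).

Lemma trig_poly_cst (a : R) : trig_poly (fun=> a).
Proof.
have := trig_polyZ a (@trig_poly_cos (\0 : {linear V -> R^o}) 0 _).
under eq_fun do rewrite /= addr0 cos0 mulr1.
by apply; exact: cst_continuous.
Qed.

Lemma trig_polyM f g : trig_poly f -> trig_poly g ->
  trig_poly (fun x => f x * g x).
Proof.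
move=> tf; elim: tf g => [l c cl|f1 f2 _ IH1 _ IH2|a f1 _ IH1] g tg.
- elim: tg => [l' c' cl'|g1 g2 _ IH1 _ IH2|a g1 _ IH1].
  + pose lD : {linear V -> R^o} := l \+ l'; pose lB : {linear V -> R^o} := l \- l'.
    rewrite (_ : (fun _ => _) = fun x =>
        2^-1 * cos (lD x + (c + c')) + 2^-1 * cos (lB x + (c - c'))).
      apply: trig_polyD; apply: trig_polyZ; apply: trig_poly_cos.
      - by move=> x; apply: cvgD; [exact: cl|exact: cl'].
      - by move=> x; apply: cvgB; [exact: cl|exact: cl'].
    apply/funext => x; rewrite -mulrDr /=.
    have -> : l x + l' x + (c + c') = (l x + c) + (l' x + c') by rewrite addrACA.
    have -> : l x - l' x + (c - c') = (l x + c) - (l' x + c') by ring.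
    by move: (l x + c) (l' x + c') => u v; rewrite cosD cosB; field.
  + by under eq_fun do rewrite mulrDr; exact: trig_polyD.
  + by under eq_fun do rewrite mulrCA; exact: trig_polyZ.
- by under eq_fun do rewrite mulrDl; apply: trig_polyD; [exact: IH1|exact: IH2].
- by under eq_fun do rewrite -mulrA; apply: trig_polyZ; exact: IH1.
Qed.

Lemma trig_poly_bounded_continuous f : trig_poly f -> bounded_continuous f.
Proof.
elim=> [l c cl|f1 f2 _ [c1 [M1 b1]] _ [c2 [M2 b2]]|a f1 _ [c1 [M1 b1]]].
- split=> [x|].
    apply: (@continuous_comp _ _ _ (fun x => l x + c) cos); last exact: continuous_cos.
    by apply: cvgD; [exact: cl|exact: cvg_cst].
  by exists 1 => x; rewrite ler_norml cos_geN1 cos_le1.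
- split=> [x|]; first by apply: cvgD; [exact: c1|exact: c2].
  by exists (M1 + M2) => x; rewrite (le_trans (ler_normD _ _))// lerD.
- split=> [x|]; first by apply: cvgM; [exact: cvg_cst|exact: c1].
  by exists (`|a| * M1) => x; rewrite normrM ler_wpM2l.
Qed.

(** Approximation is uniform on all of [V], not on a compact set: tight functionals also need a
    bound off the compact set. *)
Definition trig_closure : set (V -> R) :=
  [set h | forall e : R, 0 < e ->
    exists2 p, trig_poly p & forall x, `|h x - p x| <= e].

Lemma trig_closure_incl p : trig_poly p -> trig_closure p.
Proof. by move=> tp e e0; exists p => // x; rewrite subrr normr0 ltW. Qed.

Lemma trig_closure_bounded h : trig_closure h ->
  exists2 M : R, 0 < M & forall x, `|h x| <= M.
Proof.
move=> /(_ 1 ltr01)[p /trig_poly_bounded_continuous[_ [M pM]] hp].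
exists (1 + `|M|); first by rewrite ltr_pwDl.
move=> x; rewrite -(subrK (p x) (h x)) (le_trans (ler_normD _ _))// lerD//.
by rewrite (le_trans (pM x))// ler_norm.
Qed.

Lemma trig_closureD f g : trig_closure f -> trig_closure g ->
  trig_closure (fun x => f x + g x).
Proof.
move=> tf tg e e0; have e20 : 0 < e / 2 by rewrite divr_gt0.
have [p tp fp] := tf _ e20; have [q tq gq] := tg _ e20.
exists (fun x => p x + q x) => [|x]; first exact: trig_polyD.
rewrite opprD addrACA (le_trans (ler_normD _ _))// [leRHS](splitr e).
by rewrite lerD.
Qed.

Lemma trig_closureM f g : trig_closure f -> trig_closure g ->
  trig_closure (fun x => f x * g x).
Proof.
move=> tf tg e e0.
have [M M0 fM] := trig_closure_bounded tf.
have eM0 : 0 < e / 2 / M by rewrite !divr_gt0.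
have [q tq gq] := tg _ eM0.
have [N N0 qN] := trig_closure_bounded (trig_closure_incl tq).
have eN0 : 0 < e / 2 / N by rewrite !divr_gt0.
have [p tp fp] := tf _ eN0.
exists (fun x => p x * q x) => [|x]; first exact: trig_polyM.
have -> : f x * g x - p x * q x = f x * (g x - q x) + (f x - p x) * q x by ring.
rewrite (le_trans (ler_normD _ _))// [leRHS](splitr e) lerD// normrM.
- by rewrite -(divfK (lt0r_neq0 M0) (e / 2)) mulrC ler_pM.
- by rewrite -(divfK (lt0r_neq0 N0) (e / 2)) ler_pM.
Qed.

Lemma trig_closure_cst (a : R) : trig_closure (fun=> a).
Proof. exact: trig_closure_incl (trig_poly_cst a). Qed.

Lemma trig_closureZ (a : R) f : trig_closure f -> trig_closure (fun x => a * f x).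
Proof. by move=> tf; apply: trig_closureM => //; exact: trig_closure_cst. Qed.

(** After division by a bound [M] the values lie in [[-1, 1]], where [abs_approx] converges
    uniformly. This makes the closure a lattice. *)
Lemma trig_closure_norm f : trig_closure f -> trig_closure (fun x => `|f x|).
Proof.
move=> tf; have [M M0 fM] := trig_closure_bounded tf.
have tq n : trig_closure (fun x => abs_approx n (M^-1 * f x)).
  elim: n => [|n IH] /=; first exact: trig_closure_cst.
  apply: trig_closureD => //.
  under eq_fun do rewrite mulrC mulrBr -mulNr.
  apply: trig_closureD; apply: trig_closureZ; last first.
    by under eq_fun do rewrite expr2; exact: trig_closureM.
  by under eq_fun do rewrite expr2; apply: trig_closureM; exact: trig_closureZ.
move=> e e0; have e20 : 0 < e / 2 by rewrite divr_gt0.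
pose n := (Num.truncn (2 * M / (e / 2))).+1.
have [p tp qp] := trig_closureZ M (tq n) e20.
exists p => // x; rewrite -(subrK (M * abs_approx n (M^-1 * f x)) `|f x|) -addrA.
rewrite (le_trans (ler_normD _ _))// [leRHS](splitr e) lerD//.
have -> : `|f x| = M * `|M^-1 * f x|.
  by rewrite normrM gtr0_norm ?invr_gt0// mulVKf// gt_eqF.
rewrite -mulrBr normrM gtr0_norm//.
have x1 : `|M^-1 * f x| <= 1.
  by rewrite normrM gtr0_norm ?invr_gt0// mulrC ler_pdivrMr// mul1r.
rewrite (le_trans (ler_wpM2l (ltW M0) (abs_approx_le x1 (ltn0Sn _))))//.
rewrite mulrA (mulrC M) ler_pdivrMr// [leRHS]mulrC -ler_pdivrMr//.
exact/ltW/Num.Theory.truncnS_gt.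
Qed.

Lemma trig_closure_max f g : trig_closure f -> trig_closure g ->
  trig_closure (fun x => Num.max (f x) (g x)).
Proof.
move=> tf tg; under eq_fun do rewrite maxr_absE mulrC.
have tfg : trig_closure (fun x => f x + -1 * g x).
  by apply: trig_closureD => //; exact: trig_closureZ.
apply: trig_closureZ; apply: trig_closureD; first exact: trig_closureD.
by under eq_fun do rewrite -mulN1r; exact: trig_closure_norm.
Qed.

Lemma trig_closure_min f g : trig_closure f -> trig_closure g ->
  trig_closure (fun x => Num.min (f x) (g x)).
Proof.
move=> tf tg; under eq_fun do rewrite minr_absE mulrC.
have tfg : trig_closure (fun x => f x + -1 * g x).
  by apply: trig_closureD => //; exact: trig_closureZ.
apply: trig_closureZ; apply: trig_closureD; first exact: trig_closureD.
under eq_fun do rewrite -mulN1r; apply: trig_closureZ.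
by under eq_fun do rewrite -mulN1r; exact: trig_closure_norm.
Qed.

Lemma trig_closure_bounded_continuous h : trig_closure h -> bounded_continuous h.
Proof.
move=> th; split; last by have [M _ hM] := trig_closure_bounded th; exists M.
move=> x; apply/cvgrPdist_le => e e0.
have e30 : 0 < e / 3 by rewrite divr_gt0.
have [p /trig_poly_bounded_continuous[cp _] hp] := th _ e30.
have /cvgrPdist_le/(_ _ e30) := cp x.
apply: filterS => y pxy.
have -> : h x - h y = (h x - p x) + (p x - p y) + (p y - h y) by ring.
have -> : e = e / 3 + e / 3 + e / 3 by field.
rewrite (le_trans (ler_normD _ _))// lerD//; last by rewrite distrC.
by rewrite (le_trans (ler_normD _ _))// lerD.
Qed.

Lemma trig_interpolation (x y : V) (a b : R) : (x = y -> a = b) ->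
  exists2 h, trig_closure h & h x = a /\ h y = b.
Proof.
have [->|xy] := eqVneq x y => ab.
  by exists (fun=> b) => //; [exact: trig_closure_cst|rewrite (ab erefl)].
have [|l [cl lxy]] := @linear_separation R V (y - x).
  by rewrite subr_eq0 eq_sym.
(* Since [l (y - x) = 1], the angle goes from 0 at [x] to [pi] at [y], so [u] takes the values 1 and
   -1 there. *)
pose l' : {linear V -> R^o} := (pi : R) \*: l.
pose u (z : V) := cos (l' z + - l' x).
have tu : trig_closure u.
  apply: trig_closure_incl; apply: trig_poly_cos => z.
  by apply: cvgZl_tmp; exact: cl.
have ux : u x = 1 by rewrite /u subrr cos0.
have uy : u y = -1.
  by rewrite /u /= -scalerBr -linearB lxy /GRing.scale/= mulr1 cospi.
exists (fun z => (a + b) / 2 + (a - b) / 2 * u z).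
  by apply: trig_closureD; [exact: trig_closure_cst|exact: trig_closureZ].
by rewrite ux uy; split; field.
Qed.

(** The lattice form of the argument: maxima, over finitely many [y], of functions interpolating [f]
    at [x] and [y] exceed [f - e] on [K]; minima of these over finitely many [x] also stay below
    [f + e]. *)
Lemma stone_weierstrass_trig (K : set V) f (e : R) :
  compact K -> continuous f -> 0 < e ->
  exists2 h, trig_closure h & forall x, K x -> `|h x - f x| < e.
Proof.
move=> cK cf e0.
have lower x : exists2 h, trig_closure h &
    h x = f x /\ forall y, K y -> f y - e < h y.
  pose P B := exists2 h, trig_closure h & h x = f x /\ forall y, B y -> f y - e < h y.
  apply: (@compact_induction _ K P cK).
  - by exists (fun=> f x) => //; exact: trig_closure_cst.
  - move=> A B AB [h th [hx hB]]; exists h => //; split=> // y Ay.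
    exact/hB/AB.
  - move=> A B [h th [hx hA]] [k tk [kx kB]].
    exists (fun y => Num.max (h y) (k y)); first exact: trig_closure_max.
    split=> [|y]; first by rewrite hx kx maxxx.
    by rewrite lt_max => -[/hA ->//|/kB ->]; rewrite orbT.
  - move=> y Ky; have [|h th [hx hy]] := @trig_interpolation x y (f x) (f y).
      by move=> ->.
    have [ch _] := trig_closure_bounded_continuous th.
    exists [set z | f z - e < h z]; last by exists h.
    have cfh : (fun z => h z - f z) @ y --> h y - f y.
      by apply: cvgB; [exact: ch|exact: cf].
    have /cvgrPdist_lt/(_ _ e0) := cfh.
    apply: filterS => z /=; rewrite hy subrr sub0r normrN ltr_norml => /andP[h1 _].
    by lra.
pose P B := exists2 h, trig_closure h &
  (forall y, K y -> f y - e < h y) /\ forall y, B y -> h y < f y + e.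
have [h th [h1 h2]] : P K; last first.
  by exists h => // x Kx; rewrite ltr_norml; have := h1 _ Kx; have := h2 _ Kx; lra.
apply: (@compact_induction _ K P cK).
- have [h th [_ hK]] := lower 0; exists h => //.
- move=> A B AB [h th [hK hB]]; exists h => //; split=> // y Ay.
  exact/hB/AB.
- move=> A B [h th [hK hA]] [k tk [kK kB]].
  exists (fun y => Num.min (h y) (k y)); first exact: trig_closure_min.
  split=> y; first by move=> Ky; rewrite lt_min hK// kK.
  by rewrite gt_min => -[/hA ->//|/kB ->]; rewrite orbT.
- move=> y Ky; have [h th [hy hK]] := lower y.
  have [ch _] := trig_closure_bounded_continuous th.
  exists [set z | h z < f z + e]; last by exists h.
  have cfh : (fun z => h z - f z) @ y --> h y - f y.
    by apply: cvgB; [exact: ch|exact: cf].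
  have /cvgrPdist_lt/(_ _ e0) := cfh.
  apply: filterS => z /=; rewrite hy subrr sub0r normrN ltr_norml => /andP[_ h2].
  by lra.
Qed.

(** What is kept of integration against a tight law: linearity, and smallness of the part off a
    compact set. Iterated integrals qualify without any measure on a product space. *)
Definition tight_functional (L : (V -> R) -> R) : Prop :=
  [/\ forall f g, bounded_continuous f -> bounded_continuous g ->
        L (fun x => f x + g x) = L f + L g,
      forall a f, bounded_continuous f -> L (fun x => a * f x) = a * L f
    & forall e : R, 0 < e -> exists2 K : set V, compact K &
        forall f (M d : R), bounded_continuous f ->
          (forall x, `|f x| <= M) -> (forall x, K x -> `|f x| <= d) -> 0 <= d ->
          `|L f| <= d + e * M].

Lemma tight_functional_eq (L1 L2 : (V -> R) -> R) :
  tight_functional L1 -> tight_functional L2 ->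
  (forall l (c : R), continuous l ->
     L1 (fun x => cos (l x + c)) = L2 (fun x => cos (l x + c))) ->
  forall f, bounded_continuous f -> L1 f = L2 f.
Proof.
move=> [D1 Z1 t1] [D2 Z2 t2] L12 f bcf; have [cf [M0 fM0]] := bcf.
have L12t p : trig_poly p -> L1 p = L2 p.
  elim=> [l c cl|p1 p2 tp1 IH1 tp2 IH2|a p1 tp1 IH1]; first exact: L12.
  - by rewrite D1 ?D2 ?IH1 ?IH2//; exact: trig_poly_bounded_continuous.
  - by rewrite Z1 ?Z2 ?IH1//; exact: trig_poly_bounded_continuous.
pose M := `|M0| + 1; have M0' : 0 < M by rewrite ltr_wpDl.
have fM x : `|f x| <= M.
  by rewrite (le_trans (fM0 x))// (le_trans (ler_norm _))// lerDl.
apply/eqP; rewrite -subr_eq0 -normr_le0; apply/ler_addgt0Pl => e e0; rewrite addr0.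
(* The final error is [2 * (2 * d + d * (2 * M + d))], at most [d * (4 + 4 * M + 2)] because
   [d <= 1]. *)
pose d := Num.min 1 (e / (4 + 4 * M + 2)).
have den : 0 < 4 + 4 * M + 2 by nra.
have d0 : 0 < d by rewrite lt_min ltr01 divr_gt0.
have d1 : d <= 1 by rewrite ge_min lexx.
have de : d * (4 + 4 * M + 2) <= e.
  by rewrite -ler_pdivlMr// ge_min lexx orbT.
have [K1 cK1 H1] := t1 _ d0; have [K2 cK2 H2] := t2 _ d0.
have [h0 th0 h0f] := stone_weierstrass_trig (compactU cK1 cK2) cf d0.
(* Truncation bounds the approximant off the compact sets by [M], which was fixed before they were
   chosen. *)
pose h x := Num.max (- M) (Num.min M (h0 x)).
have th : trig_closure h.
  apply: trig_closure_max; first exact: trig_closure_cst.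
  by apply: trig_closure_min => //; exact: trig_closure_cst.
have hM x : `|h x| <= M.
  rewrite ler_norml /h le_max lexx /= ge_max ge_min lexx /= andbT.
  by rewrite ge0_cp ?ltW.
have hf x : (K1 `|` K2) x -> `|f x - h x| <= d.
  move=> /h0f; have := fM x; rewrite /h ler_norml ltr_norml => /andP[f1 f2] /andP[h1 h2].
  rewrite ler_norml; case: (leP M (h0 x)) => ?;
    [case: (leP (- M) M) => ?|case: (leP (- M) (h0 x)) => ?];
    apply/andP; split; lra.
have [p tp hp] := th _ d0.
have bcp := trig_poly_bounded_continuous tp.
pose q x := f x + -1 * p x.
have bcNp : bounded_continuous (fun x => -1 * p x).
  exact: trig_poly_bounded_continuous (trig_polyZ _ tp).
have bcq : bounded_continuous q.
  split=> [x|]; first by apply: cvgD; [exact: cf|have [+ _] := bcNp; exact].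
  have [_ [N pN]] := bcNp.
  by exists (M + N) => x; rewrite (le_trans (ler_normD _ _))// lerD.
have qM x : `|q x| <= 2 * M + d.
  rewrite /q mulN1r (_ : f x - p x = f x - h x + (h x - p x)); last by ring.
  rewrite (le_trans (ler_normD _ _))// lerD// (le_trans (ler_normB _ _))//.
  by rewrite mulrDl mul1r lerD.
have qd x : (K1 `|` K2) x -> `|q x| <= 2 * d.
  move=> Kx; rewrite /q mulN1r (_ : f x - p x = f x - h x + (h x - p x)); last by ring.
  by rewrite (le_trans (ler_normD _ _))// mulrDl mul1r lerD// hf.
have q1 : `|L1 q| <= 2 * d + d * (2 * M + d).
  by apply: H1 => //; [move=> x Kx; apply: qd; left|rewrite mulr_ge0// ltW].
have q2 : `|L2 q| <= 2 * d + d * (2 * M + d).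
  by apply: H2 => //; [move=> x Kx; apply: qd; right|rewrite mulr_ge0// ltW].
have -> : L1 f - L2 f = L1 q - L2 q.
  by rewrite /q D1// D2// Z1// Z2// (L12t _ tp); ring.
rewrite (le_trans (ler_normB _ _))// (le_trans (lerD q1 q2))//.
by apply: le_trans de; nra.
Qed.

End stone_weierstrass.

(** * Integration against tight Borel laws *)

Section bounded_integrals.
Context d (T : measurableType d) (R : realType) (mu : probability T R).
Implicit Types (f g : T -> R).

Lemma bounded_integrable f (M : R) : measurable_fun setT f ->
  (forall x, `|f x| <= M) -> mu.-integrable setT (EFin \o f).
Proof.
move=> mf fM; apply: measurable_bounded_integrable => //=.
- by rewrite probability_setT ltry.
- by exists M; split; rewrite ?num_real// => t Mt x _ /=; rewrite (le_trans (fM x))// ltW.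
Qed.

Lemma Rintegral_prob_cst (a : R) : \int[mu]_x a = a.
Proof.
rewrite Rintegral_cst//; have mu1 := congr1 fine (probability_setT mu).
by transitivity (a * 1); [congr (_ * _); exact: mu1|rewrite mulr1].
Qed.

Lemma Rintegral_norm_le f (M : R) : measurable_fun setT f ->
  (forall x, `|f x| <= M) -> `|\int[mu]_x f x| <= M.
Proof.
move=> mf fM; have fi := bounded_integrable mf fM.
rewrite (le_trans (le_normr_Rintegral _ fi))//.
rewrite -[leRHS]Rintegral_prob_cst; apply: le_Rintegral => //.
- apply: (@bounded_integrable _ M) => [|x]; last by rewrite normr_id.
  exact: measurableT_comp (@normr_measurable _ _) mf.
- exact: bounded_integrable (measurable_cst _) (fun=> lexx `|M|).
Qed.

Lemma Rintegral_bounded_cvg (f_ : nat -> T -> R) f (M : R) :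
  (forall n, measurable_fun setT (f_ n)) -> measurable_fun setT f ->
  (forall n x, `|f_ n x| <= M) -> (forall x, f_ ^~ x @ \oo --> f x) ->
  \int[mu]_x f_ n x @[n --> \oo] --> \int[mu]_x f x.
Proof.
move=> mf_ mf fM ff; apply: fine_cvg.
have fM' x : `|f x| <= M.
  by apply: (cvgr_to_le (cvg_norm (ff x))); exact: nearW.
rewrite fineK; last exact: integrable_fin_num (bounded_integrable mf fM').
apply: (@dominated_cvg _ _ _ mu _ measurableT (fun n x => (f_ n x)%:E) _ (cst M%:E)) => //.
- by move=> n; apply/measurable_EFinP.
- by move=> x _; apply: cvg_EFin; [exact: nearW|exact: ff].
- exact: (@bounded_integrable (cst M) `|M|).
- by move=> n x _; rewrite lee_fin.
Qed.

End bounded_integrals.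

Section borel_normed.
Variables (R : realType) (V : normedModType R).

Lemma open_borel (U : set V) : open U -> measurable (U : set (borel V)).
Proof. by move=> oU; exact: sub_sigma_algebra. Qed.

Lemma closed_borel (C : set V) : closed C -> measurable (C : set (borel V)).
Proof.
by move=> cC; rewrite -(setCK C); apply: measurableC; apply: open_borel; exact: closed_openC.
Qed.

Lemma compact_borel (K : set V) : compact K -> measurable (K : set (borel V)).
Proof.
by move=> cK; apply: closed_borel; apply: compact_closed => //; exact: norm_hausdorff.
Qed.

Lemma continuous_borel_realfun (f : V -> R) : continuous f ->
  measurable_fun [set: borel V] (f : borel V -> R).
Proof.
move=> cf; apply: (@measurability _ _ (borel V) _ setT f (@RGenOpens.G R)).
  exact: RGenOpens.measurableE.
move=> _ [U [x [y ->]] <-]; rewrite setTI; apply: open_borel.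
by apply: open_comp => // z _; exact: cf.
Qed.

Lemma bounded_continuous_integrable (mu : probability (borel V) R) f :
  bounded_continuous f -> mu.-integrable setT (EFin \o f).
Proof.
move=> [cf [M fM]]; apply: (@bounded_integrable _ (borel V) _ mu f M) => //.
exact: continuous_borel_realfun.
Qed.

(** Dominated convergence speaks of sequences; this turns it into continuity of partial
    integrals. *)
Lemma sequential_continuous (W : normedModType R) (f : V -> W) v :
  (forall u : nat -> V, u @ \oo --> v -> f (u n) @[n --> \oo] --> f v) ->
  {for v, continuous f}.
Proof.
move=> H; apply/cvgrPdist_lt => e e0; apply: contrapT => nf.
have ex n : exists x, `|v - x| < n.+1%:R^-1 /\ e <= `|f v - f x|.
  apply: contrapT => nx; apply: nf.
  have : \forall x \near v, `|v - x| < n.+1%:R^-1.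
    by have /cvgrPdist_lt := @cvg_id _ (nbhs v); apply; rewrite invr_gt0.
  apply: filterS => x vx; rewrite ltNge; apply/negP => ex.
  by apply: nx; exists x.
have [u uP] := choice ex.
have : u @ \oo --> v.
  apply/cvgrPdist_lt => r r0.
  have := near_infty_natSinv_lt (PosNum r0).
  by apply: filterS => n; apply: lt_trans; have [] := uP n.
move=> /H/cvgrPdist_lt/(_ _ e0)[N _ /(_ N (leqnn N))].
by rewrite ltNge => /negP; apply; have [] := uP N.
Qed.

End borel_normed.

Section tight_functionals.
Variable R : realType.

Lemma tight_law_compl (D : normedModType R) (mu : probability (borel D) R) (e : R) :
  tight_law mu -> 0 < e ->
  exists2 K : set D, compact K & (mu (~` K) <= e%:E)%E.
Proof.
move=> tmu e0; have [K [cK muK]] := tmu _ e0; exists K => //.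
rewrite (_ : mu (~` K) = 1 - mu K)%E; last first.
  by rewrite -probability_setC//; exact: compact_borel.
have fK : mu K \is a fin_num by rewrite fin_num_measure//; exact: compact_borel.
by rewrite -(fineK fK) -EFinD lee_fin; move: muK; rewrite -(fineK fK) lee_fin; lra.
Qed.

Lemma Rintegral_tight_le (D : normedModType R) (mu : probability (borel D) R)
    (K : set D) (e d M : R) (f : D -> R) :
  compact K -> (mu (~` K) <= e%:E)%E -> bounded_continuous f ->
  (forall x, `|f x| <= M) -> (forall x, K x -> `|f x| <= d) -> 0 <= d ->
  `|\int[mu]_x f x| <= d + e * M.
Proof.
move=> cK muK bf fM fd d0.
have M0 : 0 <= M by exact: le_trans (fM 0).
have mK : measurable (K : set (borel D)) by exact: compact_borel.
have mf := continuous_borel_realfun bf.1.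
have fi := bounded_continuous_integrable mu bf.
rewrite (le_trans (le_normr_Rintegral _ fi))//.
have ind0 x : 0 <= \1_(~` K) x :> R by rewrite indicE ler0n.
have ind1 x : \1_(~` K) x <= 1 :> R by rewrite indicE lern1 leq_b1.
pose g x := d + M * \1_(~` K) x.
have mg : measurable_fun [set: borel D] (g : borel D -> R).
  apply: measurable_funD => //; apply: measurable_funM => //.
  by apply: measurable_indic; exact: measurableC.
have gM x : `|g x| <= d + M.
  by rewrite /g ger0_norm ?addr_ge0 ?mulr_ge0// lerD2l ler_piMr.
apply: (@le_trans _ _ (\int[mu]_x g x)).
  apply: le_Rintegral => //.
  - apply: (@bounded_integrable _ _ _ mu _ M).
      exact: measurableT_comp (@normr_measurable _ _) mf.
    by move=> x; rewrite normr_id.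
  - exact: (@bounded_integrable _ _ _ mu g (d + M)).
  - move=> x _; rewrite /g indicE; have [Kx|nKx] := pselect (K x).
      by rewrite (le_trans (fd _ Kx))// lerDl mulr_ge0.
    by rewrite mem_set// mulr1 (le_trans (fM x))// lerDr.
rewrite /g RintegralD//; last 2 first.
- exact: (@bounded_integrable _ _ _ mu (cst d) `|d|).
- apply: (@bounded_integrable _ _ _ mu _ M).
    apply: measurable_funM => //.
    by apply: measurable_indic; exact: measurableC.
  by move=> x; rewrite ger0_norm ?mulr_ge0// ler_piMr.
rewrite Rintegral_prob_cst lerD2l RintegralZl//; last first.
  apply: (@bounded_integrable _ _ _ mu _ 1).
    by apply: measurable_indic; exact: measurableC.
  by move=> x; rewrite ger0_norm.
rewrite mulrC ler_wpM2r// /Rintegral integral_indic//; last exact: measurableC.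
rewrite setIT -lee_fin fineK// fin_num_measure//.
exact: measurableC.
Qed.

Lemma tight_functional_Rintegral (D : normedModType R) (mu : probability (borel D) R) :
  tight_law mu -> tight_functional (fun f : D -> R => \int[mu]_x f x).
Proof.
move=> tmu; split=> [f g bf bg|a f bf|e e0].
- by rewrite RintegralD//; exact: bounded_continuous_integrable.
- by rewrite RintegralZl//; exact: bounded_continuous_integrable.
- have [K cK muK] := tight_law_compl tmu e0.
  by exists K => // f M d; exact: Rintegral_tight_le.
Qed.

Lemma bounded_continuous_partial (V W D : normedModType R)
    (mu : probability (borel D) R) (b : V * D -> W) (f : W -> R) :
  continuous b -> bounded_continuous f ->
  bounded_continuous (fun v => \int[mu]_z f (b (v, z))).
Proof.
move=> cb [cf [M fM]].
have cz v : continuous (fun z => f (b (v, z))).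
  move=> z; apply: (@continuous_comp _ _ _ (fun z => b (v, z)) f); last exact: cf.
  apply: (@continuous_comp _ _ _ (fun z => (v, z)) b); last exact: cb.
  by apply: cvg_pair; [exact: cvg_cst|exact: cvg_id].
split=> [v|]; last first.
  exists M => v; apply: Rintegral_norm_le => //.
  exact: continuous_borel_realfun.
apply: sequential_continuous => u uv.
apply: (@Rintegral_bounded_cvg _ _ _ mu _ _ M) => //.
- by move=> n; exact: continuous_borel_realfun.
- exact: continuous_borel_realfun.
- move=> z.
  have uz : (u n, z) @[n --> \oo] --> (v, z).
    by apply: cvg_pair => //; exact: cvg_cst.
  have bz := cvg_comp _ b uz (cb _).
  have fbz := cvg_comp _ f bz (cf _).
  exact: fbz.
Qed.

(** Adds one independent copy of [mu]. Each of the two functionals gets half of [e], and the compact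
    set is the image under [b] of a product of compact sets. Iteration gives any number of
    copies. *)
Lemma tight_functional_partial (V W D : normedModType R)
    (mu : probability (borel D) R) (b : V * D -> W) (L : (V -> R) -> R) :
  continuous b -> tight_law mu -> tight_functional L ->
  tight_functional (fun f : W -> R => L (fun v => \int[mu]_z f (b (v, z)))).
Proof.
move=> cb tmu [LD LZ Lt].
have bcp := bounded_continuous_partial mu cb.
have bcz v f : bounded_continuous f -> bounded_continuous (fun z => f (b (v, z))).
  move=> [cf [M fM]]; split; last by exists M.
  move=> z; apply: (@continuous_comp _ _ _ (fun z => b (v, z)) f); last exact: cf.
  apply: (@continuous_comp _ _ _ (fun z => (v, z)) b); last exact: cb.
  by apply: cvg_pair; [exact: cvg_cst|exact: cvg_id].
split=> [f g bf bg|a f bf|e e0].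
- rewrite -LD; [congr L|exact: bcp|exact: bcp].
  apply/funext => v; rewrite RintegralD//; apply: bounded_continuous_integrable;
    exact: bcz.
- rewrite -LZ; [congr L|exact: bcp].
  by apply/funext => v; rewrite RintegralZl//; apply: bounded_continuous_integrable;
    exact: bcz.
- have e20 : 0 < e / 2 by rewrite divr_gt0.
  have [K1 cK1 LK1] := Lt _ e20.
  have [K2 cK2 muK2] := tight_law_compl tmu e20.
  exists (b @` (K1 `*` K2)).
    apply: continuous_compact; last exact: compact_setX.
    exact: continuous_subspaceT.
  move=> f M d bf fM fd d0.
  have M0 : 0 <= M by exact: le_trans (fM (b (0, 0))).
  rewrite (_ : d + e * M = (d + e / 2 * M) + e / 2 * M); last by field.
  apply: LK1; [exact: bcp| | |].
  + move=> v; apply: Rintegral_norm_le => //.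
    by apply: continuous_borel_realfun; have [] := bcz v _ bf.
  + move=> v K1v; apply: (Rintegral_tight_le cK2 muK2) => //; first exact: bcz.
    by move=> z K2z; apply: fd; exists (v, z).
  + by rewrite addr_ge0// mulr_ge0// ltW.
Qed.

End tight_functionals.

(** * Moments and characteristic function of normal laws *)

Section integral_derivative.
Variable R : realType.
Notation leb := (@lebesgue_measure R).

(** The fundamental theorem of calculus on [[m - n - 1, m + n + 1]], followed by dominated
    convergence. *)
Lemma Rintegral_derivative_eq0 (F f : R -> R) (m : R) :
  (forall x, is_derive x (1:R) F (f x)) -> continuous f ->
  leb.-integrable setT (EFin \o f) ->
  F (m + n%:R) @[n --> \oo] --> (0 : R) ->
  F (m - n%:R) @[n --> \oo] --> (0 : R) ->
  \int[leb]_x f x = 0.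
Proof.
move=> dF cf fi Fy FNy.
have cF : continuous F.
  by move=> x; apply/differentiable_continuous/derivable1_diffP; apply: ex_derive.
pose I n : set R := `[m - n.+1%:R, m + n.+1%:R]%classic.
have E n : \int[leb]_(x in I n) f x = F (m + n.+1%:R) - F (m - n.+1%:R).
  rewrite /Rintegral (@continuous_FTC2 _ f F)//.
  - by rewrite ltrD2l gtrN.
  - exact: continuous_subspaceT.
  - split=> [x _||]; first exact: ex_derive.
    + exact: cvg_at_right_filter (cF _).
    + exact: cvg_at_left_filter (cF _).
  - by move=> x _; rewrite derive1E; apply: derive_val.
have mf : measurable_fun setT (EFin \o f) by exact: measurable_int fi.
have c1 : \int[leb]_(x in I n) f x @[n --> \oo] --> \int[leb]_x f x.
  apply: fine_cvg; rewrite fineK; last exact: integrable_fin_num.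
  under eq_fun do rewrite integral_mkcond.
  apply: (@dominated_cvg _ _ _ leb _ measurableT _ _ (fun x => `|(f x)%:E|%E)) => //=.
  - move=> n; apply/(measurable_restrictT _ _).1; first exact: measurable_itv.
    exact: measurable_funTS.
  - move=> x _; apply: cvg_near_cst.
    exists (Num.truncn `|m - x|) => // n /= xn; rewrite patchE ifT// inE /I /= in_itv /=.
    rewrite -ler_distlC (le_trans (ltW (truncnS_gt _)))// ler_nat ltnS//.
  - exact: (integrable_abse fi).
  - move=> n x _; rewrite patchE; case: ifP => // _.
    by rewrite (_ : point = 0%E)// abse0.
have c2 : \int[leb]_(x in I n) f x @[n --> \oo] --> (0 : R).
  under eq_fun do rewrite E.
  rewrite -(subrr (0 : R)); apply: cvgB.
    by have := Fy; rewrite -(cvg_shiftS (fun n => F (m + n%:R))).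
  by have := FNy; rewrite -(cvg_shiftS (fun n => F (m - n%:R))).
exact: cvg_unique c1 c2.
Qed.

End integral_derivative.

Section normal_moments.
Variables (R : realType) (m s : R).
Hypothesis s0 : 0 < s.
Notation leb := (@lebesgue_measure R).
Local Notation p := (normal_pdf m s).
Local Notation N := (normal_prob m s).

Let s_neq0 : s != 0. Proof. by rewrite gt_eqF. Qed.

(** The density [p] is [normal_peak s] times the square of [q]. One factor absorbs quadratic growth
    through [expR y >= 1 + y], whence the [1 + 4 * s ^+ 2] in [c]; the other stays integrable, being
    proportional to the normal density of deviation [s * Num.sqrt 2]. *)
Let q (x : R) := expR (- ((x - m) ^+ 2 / (4 * s ^+ 2))).

Let c := normal_peak s * (1 + 4 * s ^+ 2).

Let c0 : 0 <= c.
Proof. by rewrite mulr_ge0 ?normal_peak_ge0// addr_ge0// mulr_ge0// sqr_ge0. Qed.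

Let pE x : p x = normal_peak s * (q x * q x).
Proof.
rewrite normal_pdfE// /q -expRD /normal_fun; congr (_ * expR _).
by rewrite -mulr_natl; field.
Qed.

Let ler_q x a : `|a| <= 1 + (x - m) ^+ 2 -> `|a * p x| <= c * q x.
Proof.
move=> ax; rewrite normrM (ger0_norm (normal_pdf_ge0 _ _ _)) pE.
have q0 : 0 < q x by exact: expR_gt0.
rewrite /c [leLHS]mulrCA -[leRHS]mulrA ler_wpM2l ?normal_peak_ge0// mulrA (ler_wpM2r (ltW q0))//.
rewrite (le_trans (ler_wpM2r (ltW q0) ax))//.
have h := expR_ge1Dx ((x - m) ^+ 2 / (4 * s ^+ 2)).
have -> : q x = (expR ((x - m) ^+ 2 / (4 * s ^+ 2)))^-1 by rewrite /q expRN.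
rewrite ler_pdivrMr ?expR_gt0//.
have s2 : 0 < 4 * s ^+ 2 by rewrite mulr_gt0// exprn_gt0.
have y0 : 0 <= (x - m) ^+ 2 / (4 * s ^+ 2) by rewrite divr_ge0 ?sqr_ge0// ltW.
apply: le_trans (ler_wpM2l _ h); last by rewrite addr_ge0// ltW.
set y := _ / _ in y0 h *.
have -> : (x - m) ^+ 2 = 4 * s ^+ 2 * y by rewrite /y mulrC divfK// gt_eqF.
by move: s2; set v := 4 * s ^+ 2 => s2; nra.
Qed.

Let integrable_q : leb.-integrable setT (EFin \o (fun x => c * q x)).
Proof.
pose s' := s * Num.sqrt 2.
have s'0 : s' != 0 by rewrite mulf_neq0// gt_eqF// sqrtr_gt0.
have qE x : q x = (normal_peak s')^-1 * normal_pdf m s' x.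
  rewrite normal_pdfE// mulrA mulVf ?mul1r; last by rewrite gt_eqF// normal_peak_gt0.
  rewrite /normal_fun /q; congr expR.
  by rewrite exprMn sqr_sqrtr// -mulNr; congr (_ / _); ring.
have -> : EFin \o (fun x => c * q x) =
    fun x => ((c * (normal_peak s')^-1)%:E * (normal_pdf m s' x)%:E)%E.
  by apply/funext => x /=; rewrite qE mulrA EFinM.
apply: integrableZl => //; exact: integrable_normal_pdf.
Qed.

Let cvg_q (f : nat -> R) : (forall n, n%:R <= `|f n|) ->
  c * q (m + f n) @[n --> \oo] --> (0 : R).
Proof.
move=> fn; rewrite -(mulr0 c); apply: cvgMl_tmp.
have s2 : 0 < 4 * s ^+ 2 by rewrite mulr_gt0// exprn_gt0.
apply: (@squeeze_cvgr _ _ _ _ (cst 0) (fun n => (4 * s ^+ 2 + 2) * n.+1%:R^-1)).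
- apply: nearW => n /=; rewrite ltW ?expR_gt0//= /q addrC addKr expRN.
  set v := 4 * s ^+ 2 in s2 *.
  have h := expR_ge1Dx (f n ^+ 2 / v).
  have f2 : n%:R <= 1 + f n ^+ 2.
    by rewrite -real_normK ?num_real//; have := fn n; have := normr_ge0 (f n); nra.
  have e0 : 0 < 1 + f n ^+ 2 / v by rewrite ltr_pwDl// divr_ge0 ?sqr_ge0// ltW.
  rewrite (le_trans (_ : _ <= (1 + f n ^+ 2 / v)^-1))//.
    by rewrite lef_pV2 ?posrE ?expR_gt0.
  rewrite ler_pdivlMr ?ltr0n// mulrC ler_pdivrMr// -natr1.
  have fv : f n ^+ 2 = v * (f n ^+ 2 / v) by rewrite mulrC divfK// gt_eqF.
  move: f2; rewrite [in X in X -> _]fv; set y := f n ^+ 2 / v in e0 *.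
  have y0 : 0 <= y by rewrite divr_ge0 ?sqr_ge0// ltW.
  by move=> f2; nra.
- exact: cvg_cst.
- by rewrite -(mulr0 (4 * s ^+ 2 + 2)); apply: cvgMl_tmp; exact: cvg_harmonic.
Qed.

Let is_derive_p x : is_derive x (1:R) p (- (x - m) / s ^+ 2 * p x).
Proof.
rewrite normal_pdfE//.
pose h (x : R) := - (x - m) ^+ 2 / (s ^+ 2 *+ 2).
have dh : is_derive x (1:R) h (- (x - m) / s ^+ 2).
  rewrite /h; apply: trigger_derive.
  rewrite /GRing.scale /=.
  by rewrite -mulr_natr; field.
apply: trigger_derive.
by rewrite /GRing.scale /= /normal_fun -/(h x); ring.
Qed.

Let continuous_p : continuous p.
Proof. exact: continuous_normal_pdf. Qed.

Let integrable_mul_p (f : R -> R) K : measurable_fun setT f -> 0 <= K ->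
  (forall x, `|f x| <= K * (1 + (x - m) ^+ 2)) ->
  leb.-integrable setT (EFin \o (fun x => f x * p x)).
Proof.
move=> mf K0 fK.
apply: (@le_integrable _ _ _ leb _ measurableT _ (fun x => (K%:E * (c * q x)%:E)%E)).
- apply/measurable_EFinP; apply: measurable_funM => //.
  exact: measurable_normal_pdf.
- move=> x _; rewrite -EFinM lee_fin [leRHS]normrM (ger0_norm K0).
  apply: (@le_trans _ _ (K * `|(1 + (x - m) ^+ 2) * p x|)).
    rewrite !normrM mulrA ler_wpM2r// (le_trans (fK x))//.
    by rewrite ler_wpM2l// ler_norm.
  rewrite ler_wpM2l// (le_trans _ (ler_norm _))//.
  by apply: ler_q; rewrite ger0_norm// addr_ge0// sqr_ge0.
- exact: (integrableZl measurableT _ integrable_q).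
Qed.

(** The Radon-Nikodym derivative of [N] and the density [p] have the same integral over every
    measurable set, hence agree almost everywhere. *)
Lemma ge0_integral_normal_prob (f : R -> \bar R) : measurable_fun setT f ->
  (forall x, 0 <= f x)%E -> (\int[N]_x f x = \int[leb]_x (f x * (p x)%:E))%E.
Proof.
move=> mf f0.
have dom := normal_prob_dominates m s.
pose g := Radon_Nikodym_SigmaFinite.f N leb.
have gi : leb.-integrable setT g by exact: Radon_Nikodym_SigmaFinite.f_integrable.
rewrite -(Radon_Nikodym_SigmaFinite.change_of_variables dom)//.
have mg : measurable_fun setT g by exact: measurable_int gi.
have mp : measurable_fun setT (fun x => (p x)%:E).
  by apply/measurable_EFinP; exact: measurable_normal_pdf.
apply: ae_eq_integral => //.
- exact: emeasurable_funM.
- exact: emeasurable_funM.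
- apply: ae_eqe_mul2l; apply: integral_ae_eq => //.
  by move=> E _ mE; rewrite -(Radon_Nikodym_SigmaFinite.f_integral dom).
Qed.

Lemma integrable_normal_prob (f : R -> R) K : measurable_fun setT f -> 0 <= K ->
  (forall x, `|f x| <= K * (1 + (x - m) ^+ 2)) -> N.-integrable setT (EFin \o f).
Proof.
move=> mf K0 fK; apply/integrableP; split; first exact/measurable_EFinP.
rewrite ge0_integral_normal_prob//; last first.
  by apply: measurableT_comp => //; exact/measurable_EFinP.
have /integrableP[_] := integrable_mul_p mf K0 fK.
apply: le_lt_trans; rewrite le_eqVlt; apply/orP; left; apply/eqP.
apply: eq_integral => x _ /=.
by rewrite normrM EFinM (ger0_norm (normal_pdf_ge0 m s x)).
Qed.

Lemma Rintegral_normal_prob (f : R -> R) K : measurable_fun setT f -> 0 <= K ->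
  (forall x, `|f x| <= K * (1 + (x - m) ^+ 2)) ->
  \int[N]_x f x = \int[leb]_x (f x * p x).
Proof.
move=> mf K0 fK.
have fNi := integrable_normal_prob mf K0 fK.
have fpi := integrable_mul_p mf K0 fK.
rewrite /Rintegral integralE ge0_integral_normal_prob; last 2 first.
- by apply: measurable_funepos; exact/measurable_EFinP.
- by [].
rewrite ge0_integral_normal_prob; last 2 first.
- by apply: measurable_funeneg; exact/measurable_EFinP.
- by [].
rewrite [in RHS]integralE; congr (fine (_ - _))%E; apply: eq_integral => x _.
- rewrite !funeposE -EFin_max -EFinM -EFin_max; congr EFin.
  by rewrite maxr_pMl ?normal_pdf_ge0// mul0r.
- rewrite !funenegE -!EFinN -!EFin_max -EFinM; congr EFin.
  by rewrite maxr_pMl ?normal_pdf_ge0// mul0r mulNr.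
Qed.

Let cvg_mul_p (f : nat -> R) (a : nat -> R) : (forall n, n%:R <= `|f n|) ->
  (forall n, `|a n| <= 1 + f n ^+ 2) ->
  a n * p (m + f n) @[n --> \oo] --> (0 : R).
Proof.
move=> fn af; apply/norm_cvg0P.
apply: (@squeeze_cvgr _ _ _ _ (cst 0) (fun n => c * q (m + f n))).
- apply: nearW => n; rewrite normr_ge0 /=; apply: ler_q.
  by rewrite (_ : m + f n - m = f n)//; ring.
- exact: cvg_cst.
- exact: cvg_q.
Qed.

Let le_1Dsqr (x : R) : `|x| <= 1 + x ^+ 2.
Proof. by rewrite -(real_normK (num_real x)); have := normr_ge0 x; nra. Qed.

(* Stein's identity: [a * p] has derivative [(b - a * (x - m) / s^2) * p],
   whose integral vanishes. *)
Lemma normal_prob_stein (a b : R -> R) K :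
  (forall x, is_derive x (1 : R) a (b x)) -> continuous b ->
  (forall x, `|a x| <= K * (1 + `|x - m|)) -> (forall x, `|b x| <= K) ->
  \int[N]_x (a x * (x - m)) = s ^+ 2 * \int[N]_x b x.
Proof.
move=> da cb aK bK.
have K0 : 0 <= K by exact: le_trans (bK 0).
have ca : continuous a.
  by move=> x; apply/differentiable_continuous/derivable1_diffP; apply: ex_derive.
pose f x := b x - a x * (x - m) / s ^+ 2.
have cf : continuous f.
  move=> x; apply: cvgB; first exact: cb.
  apply: cvgMr_tmp; apply: cvgM; first exact: ca.
  by apply: cvgB; [exact: cvg_id|exact: cvg_cst].
have mf : measurable_fun setT f by exact: continuous_measurable_fun.
have s2 : 0 < s ^- 2 by rewrite invr_gt0 exprn_gt0.
have awK x : `|a x * (x - m)| <= 2 * K * (1 + (x - m) ^+ 2).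
  rewrite normrM (le_trans (ler_wpM2r (normr_ge0 _) (aK x)))//.
  rewrite -(real_normK (num_real (x - m))).
  rewrite -subr_ge0; set y := `|x - m|.
  rewrite [leRHS](_ : _ = K * (2 - y + y ^+ 2)); last by ring.
  by rewrite mulr_ge0//; nra.
pose K1 := K + 2 * K * s ^- 2.
have K10 : 0 <= K1 by rewrite addr_ge0// mulr_ge0 ?mulr_ge0// ltW.
have fK x : `|f x| <= K1 * (1 + (x - m) ^+ 2).
  rewrite /f (le_trans (ler_normB _ _))// /K1 mulrDl lerD//.
    rewrite (le_trans (bK x))// ler_peMr// lerDl sqr_ge0//.
  by rewrite normrM (gtr0_norm s2) mulrAC ler_wpM2r// ltW.
have maw : measurable_fun setT (fun x : R => a x * (x - m)).
  apply: measurable_funM; first exact: continuous_measurable_fun.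
  exact: measurable_funB.
have mb : measurable_fun setT b by exact: continuous_measurable_fun.
have awi : N.-integrable setT (EFin \o (fun x => a x * (x - m))).
  by apply: (integrable_normal_prob maw _ awK); rewrite mulr_ge0.
have bi : N.-integrable setT (EFin \o b).
  apply: (integrable_normal_prob mb K0) => x.
  by rewrite (le_trans (bK x))// ler_peMr// lerDl sqr_ge0.
suff : \int[N]_x f x = 0.
  rewrite /f RintegralB// ?RintegralZr//; last first.
    have := integrableZl measurableT (s ^- 2) awi; congr (_.-integrable _ _).
    by apply/funext => x /=; rewrite -EFinM mulrC.
  by move/eqP; rewrite subr_eq0 => /eqP ->; field.
rewrite (Rintegral_normal_prob mf K10 fK).
apply: (@Rintegral_derivative_eq0 _ (fun x => a x * p x) _ m).
- move=> x; have dp := is_derive_p x; apply: trigger_derive.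
  by rewrite /GRing.scale /= /f; field.
- by move=> x; apply: cvgM; [exact: cf|exact: continuous_p].
- exact: integrable_mul_p mf K10 fK.
- pose K' := 2 * (K + 1).
  have K'0 : 0 < K' by rewrite mulr_gt0// ltr_wpDl.
  have -> : (0 : R) = K' * 0 by rewrite mulr0.
  have -> : (fun n => a (m + n%:R) * p (m + n%:R)) =
      (fun n => K' * (K'^-1 * a (m + n%:R) * p (m + n%:R))).
    by apply/funext => n; rewrite -mulrA mulVKf// gt_eqF.
  apply: cvgMl_tmp; apply: (@cvg_mul_p (fun n => n%:R)) => n.
    by rewrite ger0_norm.
  rewrite normrM gtr0_norm ?invr_gt0// mulrC ler_pdivrMr// (le_trans (aK _))//.
  rewrite (_ : m + n%:R - m = n%:R); last by ring.
  by have := le_1Dsqr n%:R; rewrite /K'; set y : R := `|_|; nra.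
- pose K' := 2 * (K + 1).
  have K'0 : 0 < K' by rewrite mulr_gt0// ltr_wpDl.
  have -> : (0 : R) = K' * 0 by rewrite mulr0.
  have -> : (fun n => a (m - n%:R) * p (m - n%:R)) =
      (fun n => K' * (K'^-1 * a (m - n%:R) * p (m - n%:R))).
    by apply/funext => n; rewrite -mulrA mulVKf// gt_eqF.
  apply: cvgMl_tmp; apply: (@cvg_mul_p (fun n => - n%:R)) => n.
    by rewrite normrN ger0_norm.
  rewrite normrM gtr0_norm ?invr_gt0// mulrC ler_pdivrMr// (le_trans (aK _))//.
  rewrite (_ : m - n%:R - m = - n%:R); last by ring.
  by have := le_1Dsqr (- n%:R); rewrite /K'; set y : R := `|_|; nra.
Qed.

Let integrable_cst_prob (k : R) : N.-integrable setT (EFin \o cst k).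
Proof.
apply: (@integrable_normal_prob _ `|k|) => // x.
by rewrite ler_peMr// lerDl sqr_ge0.
Qed.

Let Rintegral_cst_prob (k : R) : \int[N]_x k = k.
Proof. exact: (Rintegral_prob_cst N). Qed.

Lemma integrable_normal_prob_id : N.-integrable setT (EFin \o (@id R)).
Proof.
apply: (@integrable_normal_prob _ (1 + `|m|)) => // x.
rewrite -{1}(subrK m x) (le_trans (ler_normD _ _))//.
by have := le_1Dsqr (x - m); have := normr_ge0 m; have := sqr_ge0 (x - m); nra.
Qed.

Lemma integrable_normal_prob_sqr :
  N.-integrable setT (EFin \o (fun x : R => x ^+ 2)).
Proof.
apply: (@integrable_normal_prob _ (2 + 2 * m ^+ 2)).
- exact: exprn_measurable.
- by rewrite addr_ge0// mulr_ge0// sqr_ge0.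
- move=> x; rewrite ger0_norm ?sqr_ge0//.
  have h : 0 <= m ^+ 2 * (x - m) ^+ 2 by rewrite mulr_ge0 ?sqr_ge0.
  by have := sqr_ge0 (x - 2 * m); nra.
Qed.

Lemma normal_prob_mean : \int[N]_x x = m.
Proof.
have := @normal_prob_stein (cst 1) (cst 0) 1 _ _ _ _.
rewrite Rintegral_cst_prob mulr0 => H.
have : \int[N]_x (1 * (x - m)) = 0.
  apply: H.
  - exact: cst_continuous.
  - by move=> x; rewrite mul1r normr1 lerDl.
  - by move=> x; rewrite normr0.
under eq_Rintegral do rewrite mul1r.
rewrite RintegralB//; [|exact: integrable_normal_prob_id|exact: integrable_cst_prob].
by rewrite Rintegral_cst_prob => /subr0_eq.
Qed.

Lemma normal_prob_sqr : \int[N]_x (x ^+ 2) = m ^+ 2 + s ^+ 2.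
Proof.
have := @normal_prob_stein (fun x => x + m) (cst 1) (1 + `|m|*+2) _ _ _ _.
rewrite Rintegral_cst_prob mulr1 => H.
have : \int[N]_x ((x + m) * (x - m)) = s ^+ 2.
  apply: H.
  - by move=> x; apply: trigger_derive; rewrite addr0.
  - exact: cst_continuous.
  - move=> x; rewrite (_ : x + m = (x - m) + m *+ 2); last by rewrite mulr2n; ring.
    rewrite (le_trans (ler_normD _ _))// normrMn.
    by have := normr_ge0 m; have := normr_ge0 (x - m); nra.
  - by move=> x; rewrite normr1 lerDl mulrn_wge0.
under eq_Rintegral do rewrite mulrC -subr_sqr.
rewrite RintegralB//; [|exact: integrable_normal_prob_sqr|exact: integrable_cst_prob].
by rewrite Rintegral_cst_prob; lra.
Qed.

(** By Stein's identity, [C] solves [C' t = - s^2 t C t]. Hence [C t * expR (s^2 t^2 / 2)] is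
    constant, and its values at 1 and 0 are compared. *)
Lemma normal_prob_cos (u : R) :
  \int[N]_x cos (x + u) = cos (m + u) * expR (- (s ^+ 2 / 2)).
Proof.
pose f t x := cos (t * (x - m) + (m + u)).
pose C t := \int[N]_x f t x.
have df t x : is_derive t (1 : R) (f ^~ x) (- sin (t * (x - m) + (m + u)) * (x - m)).
  rewrite /f; apply: trigger_derive.
  by rewrite /GRing.scale /=; ring.
have lin_cont t : continuous (fun x : R => t * (x - m) + (m + u)).
  move=> x; apply: cvgD; last exact: cvg_cst.
  by apply: cvgMl_tmp; apply: cvgB; [exact: cvg_id|exact: cvg_cst].
have cft t : continuous (f t).
  move=> x; apply: (@continuous_comp _ _ _ (fun x => t * (x - m) + (m + u)) cos).
    exact: lin_cont.
  exact: continuous_cos.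
have dC t : is_derive t (1 : R) C (- s ^+ 2 * t * C t).
  have ft1 t' x : partial1of2 f t' x = - sin (t' * (x - m) + (m + u)) * (x - m).
    by rewrite partial1of2E; apply: derive_val.
  have It : `]t - 1, t + 1[%classic t by rewrite /= in_itv /=; apply/andP; split; lra.
  have fi t' : N.-integrable setT (EFin \o f t').
    apply: (@integrable_normal_prob _ 1) => // [|x].
      exact: continuous_measurable_fun.
    by rewrite mul1r (le_trans (cos_max _))// lerDl sqr_ge0.
  have dft t' x : derivable (f ^~ x) t' 1 by apply: ex_derive.
  have Gi : N.-integrable setT (EFin \o (fun x : R => `|x - m|)).
    apply: (@integrable_normal_prob _ 1) => // [|x].
      by apply: measurableT_comp => //; exact: measurable_funB.
    by rewrite normr_id mul1r le_1Dsqr.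
  have Gub t' x : `|partial1of2 f t' x| <= `|x - m|.
    rewrite ft1 normrM normrN -[leRHS]mul1r ler_wpM2r//.
    by rewrite ler_norml sin_geN1 sin_le1.
  have E := @differentiation_under_integral R _ _ N f setT measurableT t _ _ It
    (fun t' _ => fi t') (fun t' x _ _ => dft t' x) _ (fun=> normr_ge0 _) Gi
    (fun t' x _ _ => Gub t' x).
  have D := @derivable_under_integral R _ _ N f setT measurableT t _ _ It
    (fun t' _ => fi t') (fun t' x _ _ => dft t' x) _ (fun=> normr_ge0 _) Gi
    (fun t' x _ _ => Gub t' x).
  apply: DeriveDef => //; rewrite -derive1E E.
  under eq_Rintegral do rewrite ft1.
  have -> : - s ^+ 2 * t * C t =
      s ^+ 2 * \int[N]_x (- (t * cos (t * (x - m) + (m + u)))).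
    under [in RHS]eq_Rintegral do rewrite -mulNr.
    by rewrite RintegralZl// /C /f; [ring|exact: fi].
  apply: (@normal_prob_stein (fun x => - sin (t * (x - m) + (m + u)))
    (fun x => - (t * cos (t * (x - m) + (m + u)))) (1 + `|t|)).
  - move=> x; apply: trigger_derive.
    by rewrite /GRing.scale /=; ring.
  - by move=> x; apply: cvgN; apply: cvgMl_tmp; exact: cft.
  - move=> x; rewrite normrN; apply: (@le_trans _ _ 1).
      by rewrite ler_norml sin_geN1 sin_le1.
    by have := normr_ge0 t; have := normr_ge0 (x - m); nra.
  - move=> x; rewrite normrN normrM (le_trans (ler_wpM2l (normr_ge0 _) (cos_max _)))//.
    by rewrite mulr1 lerDr.
have : C 1 * expR (s ^+ 2 / 2 * 1 ^+ 2) = C 0 * expR (s ^+ 2 / 2 * 0 ^+ 2).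
  apply: (@is_derive_0_is_cst _ (fun t => C t * expR (s ^+ 2 / 2 * t ^+ 2))) => t.
  have := dC t => dCt; apply: trigger_derive.
  by rewrite /GRing.scale /=; field.
rewrite expr1n mulr1 expr0n /= mulr0 expR0 mulr1.
have -> : C 0 = cos (m + u).
  rewrite /C /f; under eq_Rintegral do rewrite mul0r add0r.
  exact: Rintegral_cst_prob.
have -> : C 1 = \int[N]_x cos (x + u).
  by apply: eq_Rintegral => x _; rewrite /f mul1r; congr cos; ring.
by move=> <-; rewrite -mulrA -expRD subrr expR0 mulr1.
Qed.

End normal_moments.

(** * Gaussian laws *)

Section law_transfer.
Context d (T : measurableType d) (R : realType) (mu : {measure set T -> \bar R}).
Variables (phi : T -> measurableTypeR R).
Variable nu : {measure set (measurableTypeR R) -> \bar R}.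
Hypothesis mphi : measurable_fun setT phi.
Hypothesis law_phi :
  forall B : set (measurableTypeR R), measurable B -> mu (phi @^-1` B) = nu B.

Lemma ge0_integral_law (h : measurableTypeR R -> \bar R) : measurable_fun setT h ->
  (forall x, 0 <= h x)%E -> (\int[mu]_z h (phi z) = \int[nu]_x h x)%E.
Proof.
move=> mh h0.
rewrite -(@ge0_integral_pushforward _ _ _ _ _ _ mphi mu setT h)//.
by apply: (@eq_measure_integral _ _ _ _ nu) => A mA _; exact: law_phi.
Qed.

Lemma integrable_law (h : measurableTypeR R -> R) : measurable_fun setT h ->
  nu.-integrable setT (EFin \o h) ->
  mu.-integrable setT (EFin \o (fun z => h (phi z))).
Proof.
move=> mh /integrableP[_ hfin]; apply/integrableP; split.
  by apply/measurable_EFinP; exact: measurableT_comp.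
rewrite (@ge0_integral_law (fun x => `|(h x)%:E|%E))//.
by apply: measurableT_comp => //; exact/measurable_EFinP.
Qed.

Lemma Rintegral_law (h : measurableTypeR R -> R) : measurable_fun setT h ->
  \int[mu]_z h (phi z) = \int[nu]_x h x.
Proof.
move=> mh; have mEh : measurable_fun setT (EFin \o h) by exact/measurable_EFinP.
rewrite /Rintegral [in LHS]integralE [in RHS]integralE; congr (fine (_ - _))%E.
- rewrite -(@ge0_integral_law (EFin \o h)^\+%E)//; last exact: measurable_funepos.
  by apply: eq_integral => z _; rewrite !funeposE.
- rewrite -(@ge0_integral_law (EFin \o h)^\-%E)//; last exact: measurable_funeneg.
  by apply: eq_integral => z _; rewrite !funenegE.
Qed.

End law_transfer.

Section gaussian.
Variables (R : realType) (D : normedModType R) (mu : probability (borel D) R).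
Hypothesis gmu : gaussian_law mu.
Implicit Types l : {linear D -> R^o}.

Definition form_mean (f : D -> R) := \int[mu]_z f z.
Definition form_cov (f g : D -> R) :=
  \int[mu]_z (f z * g z) - form_mean f * form_mean g.

Lemma continuous_linear_measurable l : continuous l ->
  measurable_fun [set: borel D] (l : borel D -> R).
Proof. exact: continuous_borel_realfun. Qed.

(** Mean and variance are written as integrals of [l] rather than as parameters of its law, so that
    they are linear and quadratic in [l]. A point mass has variance 0 and obeys the same formula. *)
Lemma gaussian_law_facts l : continuous l ->
  [/\ mu.-integrable setT (EFin \o l),
      mu.-integrable setT (EFin \o (fun z => l z ^+ 2)) &
      forall u, \int[mu]_z cos (l z + u) =
        cos (form_mean l + u) * expR (- (form_cov l l / 2))].
Proof.
move=> cl; have ml := continuous_linear_measurable cl.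
have mcos u : measurable_fun setT (fun x : R => cos (x + u)).
  apply: measurableT_comp; last exact: measurable_funD.
  by apply: continuous_measurable_fun; exact: continuous_cos.
have msqr : measurable_fun setT (fun x : R => x ^+ 2) by exact: exprn_measurable.
rewrite /form_cov; under eq_Rintegral do rewrite -expr2.
have [m [[s s0 H]|H]] := gmu cl.
- pose N : {measure set (measurableTypeR R) -> \bar R} := normal_prob m s.
  have E (h : R -> R) (mh : measurable_fun setT h) :=
    @Rintegral_law _ _ _ mu l N ml H h mh.
  split.
  + exact: (@integrable_law _ _ _ mu l N ml H (@id R) (@measurable_id _ _ _)
      (integrable_normal_prob_id m s0)).
  + exact: (@integrable_law _ _ _ mu l N ml H _ msqr
      (integrable_normal_prob_sqr m s0)).
  + move=> u; rewrite /form_mean (E _ (mcos u)) (E _ msqr) (E id)//.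
    rewrite normal_prob_mean// normal_prob_sqr// normal_prob_cos//.
    by congr (_ * expR (- (_ / 2))); ring.
- pose N : {measure set (measurableTypeR R) -> \bar R} := dirac (m : measurableTypeR R).
  have E (h : R -> R) (mh : measurable_fun setT h) : \int[mu]_z h (l z) = h m.
    rewrite (@Rintegral_law _ _ _ mu l N ml H h mh) /Rintegral.
    rewrite integral_dirac//; last exact/measurable_EFinP.
    by rewrite diracT mul1e.
  have I (h : R -> R) (mh : measurable_fun setT h) : mu.-integrable setT (EFin \o (fun z => h (l z))).
    apply: (@integrable_law _ _ _ mu l N ml H h mh).
    apply/integrableP; split; first exact/measurable_EFinP.
    rewrite integral_dirac//; last by apply: measurableT_comp => //; exact/measurable_EFinP.
    by rewrite diracT mul1e ltry.
  split; [exact: (I id)|exact: (I _ msqr)|].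
  move=> u; rewrite /form_mean (E _ (mcos u)) (E _ msqr) (E id)//.
  by rewrite -expr2 subrr mul0r oppr0 expR0 mulr1.
Qed.

Lemma gaussian_integrable l : continuous l -> mu.-integrable setT (EFin \o l).
Proof. by move=> /gaussian_law_facts[]. Qed.

Lemma gaussian_integrableM l1 l2 : continuous l1 -> continuous l2 ->
  mu.-integrable setT (EFin \o (fun z => l1 z * l2 z)).
Proof.
move=> c1 c2; have [_ i1 _] := gaussian_law_facts c1.
have [_ i2 _] := gaussian_law_facts c2.
apply: (@le_integrable _ _ _ mu _ measurableT _
  (fun z => ((l1 z ^+ 2)%:E + (l2 z ^+ 2)%:E)%E)).
- apply/measurable_EFinP; apply: measurable_funM; exact: continuous_linear_measurable.
- move=> z _ /=; rewrite lee_fin [leRHS]ger0_norm ?addr_ge0 ?sqr_ge0//.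
  rewrite normrM -(real_normK (num_real (l1 z))) -(real_normK (num_real (l2 z))).
  have := sqr_ge0 (`|l1 z| - `|l2 z|); have := sqr_ge0 (`|l1 z|).
  by have := sqr_ge0 (`|l2 z|); set a := `|l1 z|; set b := `|l2 z|; nra.
- exact: (integrableD measurableT i1 i2).
Qed.

Lemma form_meanD l1 l2 a b : continuous l1 -> continuous l2 ->
  form_mean (fun z => a * l1 z + b * l2 z) = a * form_mean l1 + b * form_mean l2.
Proof.
move=> c1 c2; have i1 := gaussian_integrable c1; have i2 := gaussian_integrable c2.
rewrite /form_mean RintegralD//; last 2 first.
- exact: (integrableZl measurableT a i1).
- exact: (integrableZl measurableT b i2).
by rewrite !RintegralZl.
Qed.

Lemma form_covD l1 l2 a b : continuous l1 -> continuous l2 ->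
  form_cov (fun z => a * l1 z + b * l2 z) (fun z => a * l1 z + b * l2 z) =
  a ^+ 2 * form_cov l1 l1 + 2 * a * b * form_cov l1 l2 + b ^+ 2 * form_cov l2 l2.
Proof.
move=> c1 c2; rewrite /form_cov form_meanD//.
have i11 := gaussian_integrableM c1 c1.
have i12 := gaussian_integrableM c1 c2.
have i22 := gaussian_integrableM c2 c2.
have -> : \int[mu]_z ((a * l1 z + b * l2 z) * (a * l1 z + b * l2 z)) =
   a ^+ 2 * \int[mu]_z (l1 z * l1 z) + 2 * a * b * \int[mu]_z (l1 z * l2 z) +
   b ^+ 2 * \int[mu]_z (l2 z * l2 z).
  rewrite -!RintegralZl//.
  rewrite -RintegralD//; last 2 first.
  - exact: (integrableZl measurableT (a ^+ 2) i11).
  - exact: (integrableZl measurableT (2 * a * b) i12).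
  rewrite -RintegralD//; last 2 first.
  - apply: (integrableD measurableT (integrableZl measurableT (a ^+ 2) i11)
      (integrableZl measurableT (2 * a * b) i12)).
  - exact: (integrableZl measurableT (b ^+ 2) i22).
  by apply: eq_Rintegral => z _; ring.
by ring.
Qed.

End gaussian.

(** * Linear combinations of independent Gaussian copies *)

Section gaussian_pairs.
Variables (R : realType) (D : normedModType R) (mu : probability (borel D) R).
Hypotheses (tmu : tight_law mu) (gmu : gaussian_law mu).

Section pair_form.
Variable l : {linear (D * D)%type -> R^o}.
Hypothesis cl : continuous l.

(** The contribution of a copy [x] entering the two coordinates with weights [a] and [b]: at a
    combination of copies, [l] is the sum of these. *)
Definition pair_form (a b : R) (x : D) : R^o := l (a *: x, b *: x).

Lemma pair_form_linear a b : linear (pair_form a b).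
Proof.
move=> k x y; rewrite /pair_form -linearP; congr (l _); congr pair => /=.
- by rewrite scalerDr !scalerA mulrC.
- by rewrite scalerDr !scalerA mulrC.
Qed.

Lemma pair_form_continuous a b : continuous (pair_form a b).
Proof.
move=> x; apply: (@continuous_comp _ _ _ (fun x => (a *: x, b *: x)) l); last exact: cl.
by apply: cvg_pair; apply: cvgZl_tmp; exact: cvg_id.
Qed.

HB.instance Definition _ a b :=
  GRing.isLinear.Build R D R^o *:%R (pair_form a b) (pair_form_linear a b).

Lemma pair_formD a b x y : pair_form a b (x + y) = pair_form a b x + pair_form a b y.
Proof. exact: linearD. Qed.

Lemma pair_formE a b x : pair_form a b x = a * pair_form 1 0 x + b * pair_form 0 1 x.
Proof.
rewrite /pair_form !scale0r !scale1r.
have -> : a * l (x, 0) = l (a *: (x, 0)) by rewrite linearZ.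
have -> : b * l (0, x) = l (b *: (0, x)) by rewrite linearZ.
rewrite -linearD; congr (l _); congr pair => /=.
- by rewrite scaler0 addr0.
- by rewrite scaler0 add0r.
Qed.

Let m1 := form_mean mu (pair_form 1 0).
Let m2 := form_mean mu (pair_form 0 1).
Let v11 := form_cov mu (pair_form 1 0) (pair_form 1 0).
Let v12 := form_cov mu (pair_form 1 0) (pair_form 0 1).
Let v22 := form_cov mu (pair_form 0 1) (pair_form 0 1).

Lemma Rintegral_cos_pair_form a b u :
  \int[mu]_z cos (pair_form a b z + u) = cos (a * m1 + b * m2 + u) *
    expR (- ((a ^+ 2 * v11 + 2 * a * b * v12 + b ^+ 2 * v22) / 2)).
Proof.
have [_ _ ->] := gaussian_law_facts gmu (@pair_form_continuous a b).
have E : pair_form a b = fun x => a * pair_form 1 0 x + b * pair_form 0 1 x.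
  by apply/funext => x; exact: pair_formE.
have -> : form_mean mu (pair_form a b) = a * m1 + b * m2.
  by rewrite E form_meanD//; exact: pair_form_continuous.
congr (_ * expR (- (_ / 2))).
transitivity (form_cov mu (pair_form a b) (pair_form a b)) => //.
by rewrite E form_covD//; exact: pair_form_continuous.
Qed.

End pair_form.

(* With [x = z1 + z2 + 4 z3] and [y = z1 + z2], the Gaussian pair [(x, y)] has
   the same mean and covariance as [(x, x/9 + (4/3) z4)], with [z4] an
   independent copy. *)
Lemma gaussian_pair_eq (f : D * D -> R) : bounded_continuous f ->
  \int[mu]_z1 \int[mu]_z2 \int[mu]_z3 f (z1 + z2 + 4 *: z3, z1 + z2) =
  \int[mu]_z1 \int[mu]_z2 \int[mu]_z3 \int[mu]_z4
    f (z1 + z2 + 4 *: z3, 9^-1 *: (z1 + z2 + 4 *: z3) + (4 / 3) *: z4).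
Proof.
have T0 := tight_functional_Rintegral tmu.
have cadd (k : R) : continuous (fun vz : D * D => vz.1 + k *: vz.2).
  move=> vz; apply: cvgD; first exact: cvg_fst.
  by apply: cvgZl_tmp; exact: cvg_snd.
have cadd1 : continuous (fun vz : D * D => vz.1 + vz.2).
  by move=> vz; apply: cvgD; [exact: cvg_fst|exact: cvg_snd].
have T1 := tight_functional_partial cadd1 tmu T0.
have c1 : continuous (fun vz : D * D => (vz.1 + 4 *: vz.2, vz.1) : D * D).
  by move=> vz; apply: cvg_pair; [exact: cadd|exact: cvg_fst].
have T2 := tight_functional_partial c1 tmu T1.
have T3 := tight_functional_partial (cadd 4) tmu T1.
have c2 : continuous
    (fun vz : D * D => (vz.1, 9^-1 *: vz.1 + (4 / 3) *: vz.2) : D * D).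
  move=> vz; apply: cvg_pair; first exact: cvg_fst.
  by apply: cvgD; apply: cvgZl_tmp; [exact: cvg_fst|exact: cvg_snd].
have T4 := tight_functional_partial c2 tmu T3.
move=> bf; apply: (tight_functional_eq T2 T4 _ bf) => l u cl /=.
have cosE a b := Rintegral_cos_pair_form cl a b.
pose M a b := a * form_mean mu (pair_form l 1 0) + b * form_mean mu (pair_form l 0 1).
pose Q a b := expR (- ((a ^+ 2 * form_cov mu (pair_form l 1 0) (pair_form l 1 0) +
  2 * a * b * form_cov mu (pair_form l 1 0) (pair_form l 0 1) +
  b ^+ 2 * form_cov mu (pair_form l 0 1) (pair_form l 0 1)) / 2)).
(* Integrating out a copy with weights [a] and [b] shifts the phase by [M a b] and damps by
   [Q a b]. *)
have step (g : D -> R) a b (w k : R) :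
    (forall z, g z = cos (pair_form l a b z + w) * k) ->
    \int[mu]_z g z = cos (w + M a b) * (Q a b * k).
  move=> gE; under eq_Rintegral do rewrite gE.
  rewrite RintegralZr//; last first.
    apply: bounded_continuous_integrable; split.
      move=> z; apply: (@continuous_comp _ _ _ (fun z => pair_form l a b z + w) cos).
        by apply: cvgD; [exact: pair_form_continuous|exact: cvg_cst].
      exact: continuous_cos.
    by exists 1 => z; exact: cos_max.
  by rewrite cosE (addrC w) [RHS]mulrA.
have lE a b a' b' x y : l (a *: x + a' *: y, b *: x + b' *: y) =
    pair_form l a b x + pair_form l a' b' y :> R.
  by rewrite /pair_form -linearD.
have L3 z1 z2 : \int[mu]_z3 cos (l (z1 + z2 + 4 *: z3, z1 + z2) + u) =
    cos (pair_form l 1 1 z2 + (pair_form l 1 1 z1 + u + M 4 0)) * (Q 4 0 * 1).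
  rewrite (step _ 4 0 (pair_form l 1 1 z2 + (pair_form l 1 1 z1 + u)) 1).
    by rewrite !addrA.
  move=> z3; rewrite mulr1; congr cos; rewrite addrA [RHS]addrC addrA.
  rewrite -[z1 + z2]scale1r -[X in (_, X)]addr0 -(scale0r z3) lE.
  by rewrite pair_formD; ring.
have L2 z1 : \int[mu]_z2 \int[mu]_z3 cos (l (z1 + z2 + 4 *: z3, z1 + z2) + u) =
    cos (pair_form l 1 1 z1 + (u + M 4 0 + M 1 1)) * (Q 1 1 * (Q 4 0 * 1)).
  rewrite (step _ _ _ _ _ (L3 z1)); congr (cos _ * _); ring.
rewrite (step _ _ _ _ _ L2).
have R4 z1 z2 z3 : \int[mu]_z4 cos (l (z1 + z2 + 4 *: z3,
      9^-1 *: (z1 + z2 + 4 *: z3) + (4 / 3) *: z4) + u) =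
    cos (pair_form l 4 (4 / 9) z3 + (pair_form l 1 9^-1 z2 +
      (pair_form l 1 9^-1 z1 + u + M 0 (4 / 3)))) * (Q 0 (4 / 3) * 1).
  rewrite (step _ 0 (4 / 3) (pair_form l 4 (4 / 9) z3 + (pair_form l 1 9^-1 z2 +
      (pair_form l 1 9^-1 z1 + u))) 1).
    by rewrite !addrA.
  move=> z4; rewrite mulr1; congr cos.
  rewrite -[X in (X, _)]scale1r -[X in (X, _)]addr0 -(scale0r z4) lE.
  have -> : pair_form l 1 9^-1 (z1 + z2 + 4 *: z3) = pair_form l 1 9^-1 z1 +
      pair_form l 1 9^-1 z2 + pair_form l 4 (4 / 9) z3 :> R.
    rewrite !pair_formD; congr (_ + _); rewrite /pair_form !scalerA mul1r.
    by congr (l (_, _ *: _)); field.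
  by ring.
have R3 z1 z2 : \int[mu]_z3 \int[mu]_z4 cos (l (z1 + z2 + 4 *: z3,
      9^-1 *: (z1 + z2 + 4 *: z3) + (4 / 3) *: z4) + u) =
    cos (pair_form l 1 9^-1 z2 + (pair_form l 1 9^-1 z1 + u + M 0 (4 / 3) +
      M 4 (4 / 9))) * (Q 4 (4 / 9) * (Q 0 (4 / 3) * 1)).
  rewrite (step _ _ _ _ _ (R4 z1 z2)); congr (cos _ * _); ring.
have R2 z1 : \int[mu]_z2 \int[mu]_z3 \int[mu]_z4 cos (l (z1 + z2 + 4 *: z3,
      9^-1 *: (z1 + z2 + 4 *: z3) + (4 / 3) *: z4) + u) =
    cos (pair_form l 1 9^-1 z1 + (u + M 0 (4 / 3) + M 4 (4 / 9) + M 1 9^-1)) *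
    (Q 1 9^-1 * (Q 4 (4 / 9) * (Q 0 (4 / 3) * 1))).
  rewrite (step _ _ _ _ _ (R3 z1)); congr (cos _ * _); ring.
(* On both sides the weights of the two coordinates have sums 6 and 2, sums of squares 18 and 2, and
   sum of products 2. *)
rewrite (step _ _ _ _ _ R2); congr (cos _ * _).
  by rewrite /M; field.
rewrite !mulr1 /Q -!expRD; congr expR.
by field.
Qed.

End gaussian_pairs.

(** * Supports of tight laws and Fubini for continuous functions *)

Lemma nbhs_open (T : topologicalType) (A : set T) :
  (forall x, A x -> nbhs x A) -> open A.
Proof. by move=> nA; rewrite openE. Qed.

Section support.
Variables (R : realType) (D : normedModType R) (mu : probability (borel D) R).
Hypothesis tmu : tight_law mu.
Local Notation S := (law_support mu).

Lemma closed_law_support : closed S.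
Proof.
rewrite -[S]setCK; apply: open_closedC.
apply: nbhs_open => x nSx; have [U [oU Ux U0]] : exists U, [/\ open U, U x & mu U = 0%E].
  apply: contrapT => nU; apply: nSx => U oU Ux.
  rewrite lt_def measure_ge0 andbT; apply/eqP => U0.
  by apply: nU; exists U.
apply: (@filterS _ _ _ U) => [y Uy Sy|]; last exact: open_nbhs_nbhs.
by have := Sy _ oU Uy; rewrite U0 ltxx.
Qed.

Lemma measurable_law_support : measurable (S : set (borel D)).
Proof. exact: closed_borel closed_law_support. Qed.

Lemma compact_off_support (K : set D) : compact K -> K `<=` ~` S -> mu K = 0%E.
Proof.
move=> cK KS; have mK := compact_borel cK.
suff [N [mN N0 KN]] : mu.-negligible (K : set (borel D)).
  by apply/eqP; rewrite -measure_le0 -N0 le_measure ?inE.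
apply: (@compact_induction _ K (fun A => mu.-negligible (A : set (borel D)))) => //.
- exact: negligible_set0.
- by move=> A B AB; exact: negligibleS.
- by move=> A B; exact: negligibleU.
- move=> x Kx; have nSx := KS _ Kx.
  have [U [oU Ux U0]] : exists U, [/\ open U, U x & mu U = 0%E].
    apply: contrapT => nU; apply: nSx => U oU Ux.
    rewrite lt_def measure_ge0 andbT; apply/eqP => U0.
    by apply: nU; exists U.
  exists U; first exact: open_nbhs_nbhs.
  by exists U; split => //; exact: open_borel.
Qed.

(** A compact set off the support is null. The complement of the support is the union of the closed
    sets [F n] of points at distance at least [1 / (n + 1)] from it, and tightness supplies a
    compact [K] to intersect them with, in place of separability. *)
Lemma law_support_full : mu (~` S) = 0%E.
Proof.
have mSC : measurable (~` S : set (borel D)) by exact: measurableC measurable_law_support.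
pose F n := [set x : D | forall y, S y -> n.+1%:R^-1 <= `|x - y|].
have cF n : closed (F n).
  rewrite (_ : F n = \bigcap_(y in S) [set x | n.+1%:R^-1 <= `|x - y|]); last by [].
  apply: closed_bigI => y _.
  apply: (@closed_comp _ _ (fun x => `|x - y|) [set t : R | n.+1%:R^-1 <= t]).
    move=> x _; apply: cvg_norm; apply: cvgB; [exact: cvg_id|exact: cvg_cst].
  exact: closed_ge.
have SF : ~` S `<=` \bigcup_n F n.
  move=> x nSx; have := open_nbhs_nbhs (conj (closed_openC closed_law_support) nSx).
  move=> /nbhs_ballP[e /= e0 eS].
  have [n _ /(_ n (leqnn n)) ne] := near_infty_natSinv_lt (PosNum e0).
  exists n => // y Sy; rewrite leNgt; apply/negP => xy.
  by apply: (eS y) Sy; rewrite -ball_normE /=; exact: lt_trans ne.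
apply/eqP; rewrite -measure_le0; apply/lee_addgt0Pr => e e0; rewrite add0e.
have [K cK Ke] := tight_law_compl tmu e0.
have mK := compact_borel cK.
have KF0 : mu.-negligible (\bigcup_n (K `&` F n) : set (borel D)).
  apply: negligible_bigcup => n; exists (K `&` F n); split => //.
    by apply: measurableI => //; exact: closed_borel.
  apply: compact_off_support; first exact: compact_closedI.
  move=> x [_ Fx] Sx; have := Fx _ Sx.
  by rewrite subrr normr0 leNgt invr_gt0 ltr0n.
have [N [mN N0 KN]] := KF0.
apply: (@le_trans _ _ (mu (~` K `|` N))).
  apply: le_measure; rewrite ?inE//; first by apply: measurableU => //; exact: measurableC.
  move=> x nSx; have [Kx|] := pselect (K x); last by left.
  by right; apply: KN; have [n _ Fx] := SF _ nSx; exists n.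
apply: (le_trans (measureU2 _ (measurableC mK) mN)).
by rewrite [X in (_ + X)%E]N0 adde0.
Qed.

Lemma law_support_ae (P : D -> Prop) : (forall z, S z -> P z) ->
  {ae mu, forall z, P z}.
Proof.
move=> SP; exists (~` S); split => //.
- exact: measurableC measurable_law_support.
- exact: law_support_full.
- by move=> z nPz Sz; exact: nPz (SP _ Sz).
Qed.

Lemma eq_integral_support (f h : D -> \bar R) :
  measurable_fun [set: borel D] (f : borel D -> \bar R) ->
  measurable_fun [set: borel D] (h : borel D -> \bar R) ->
  (forall z, S z -> f z = h z) -> (\int[mu]_z f z = \int[mu]_z h z)%E.
Proof.
move=> mf mh fh; apply: ae_eq_integral => //.
by apply: law_support_ae => z Sz _; exact: fh.
Qed.

Lemma eq_Rintegral_support (f h : D -> R) :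
  continuous f -> continuous h -> (forall z, S z -> f z = h z) ->
  \int[mu]_z f z = \int[mu]_z h z.
Proof.
move=> cf ch fh; congr fine; apply: eq_integral_support.
- by apply/measurable_EFinP; exact: continuous_borel_realfun.
- by apply/measurable_EFinP; exact: continuous_borel_realfun.
- by move=> z Sz; rewrite fh.
Qed.

End support.

(** Carries identities from bounded continuous integrands to nonnegative continuous ones. The levels
    [c] are left free: [n] for exchanging integrals, [n^2] for squares. *)
Lemma ge0_integral_min (R : realType) (D : normedModType R) (mu : probability (borel D) R)
    (c : nat -> R) (k : D -> R) :
  nondecreasing_seq c -> c @ \oo --> +oo -> (forall n, 0 <= c n) ->
  continuous k -> (forall z, 0 <= k z) ->
  (\int[mu]_z (k z)%:E = limn (fun n => (\int[mu]_z Num.min (k z) (c n))%:E))%E.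
Proof.
move=> ndc cy c0 ck k0.
have bk n : bounded_continuous (fun z => Num.min (k z) (c n)).
  split=> [z|].
    by apply: (@continuous_min _ _ k (cst (c n)) z); [exact: ck|exact: cvg_cst].
  exists (c n) => z; rewrite ger0_norm ?le_min ?k0 ?c0//.
  by rewrite ge_min lexx orbT.
transitivity (limn (fun n => (\int[mu]_z (Num.min (k z) (c n))%:E)%E)); last first.
  congr (limn _); apply/funext => n; rewrite /Rintegral fineK//.
  exact: integrable_fin_num (bounded_continuous_integrable mu (bk n)).
rewrite -monotone_convergence//.
- apply: eq_integral => z _; apply/esym/cvg_lim => //.
  apply: cvg_EFin; first exact: nearW.
  apply: cvg_near_cst; move/cvgryPge : cy => /(_ (k z)).
  by apply: filterS => n kc; apply/min_idPl.
- move=> n; apply/measurable_EFinP; apply: continuous_borel_realfun.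
  by have [] := bk n.
- by move=> n z _; rewrite lee_fin le_min k0 c0.
- by move=> z _ n m nm; rewrite lee_fin le_min2// ndc.
Qed.

Section continuous_fubini.
Variables (R : realType) (D : normedModType R) (mu : probability (borel D) R).
Hypothesis tmu : tight_law mu.

Let bounded_continuous_slice (f : D * D -> R) x :
  bounded_continuous f -> bounded_continuous (fun y => f (x, y)).
Proof.
move=> [cf [M fM]]; split; last by exists M.
move=> y; apply: (@continuous_comp _ _ _ (fun y => (x, y)) f); last exact: cf.
by apply: cvg_pair; [exact: cvg_cst|exact: cvg_id].
Qed.

(** Both orders are tight functionals on [D * D]. On [cos (l (x, y) + u)] the addition formula
    splits the integrand into products of functions of one variable, for which the order is
    immaterial. *)
Lemma Rintegral_swap (f : D * D -> R) : bounded_continuous f ->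
  \int[mu]_x \int[mu]_y f (x, y) = \int[mu]_x \int[mu]_y f (y, x).
Proof.
have T0 := tight_functional_Rintegral tmu.
have T1 := @tight_functional_partial _ _ _ _ mu (@id (D * D)) _ (fun x => cvg_id) tmu T0.
have csw : continuous (fun xy : D * D => (xy.2, xy.1)).
  by move=> xy; apply: cvg_pair; [exact: cvg_snd|exact: cvg_fst].
have T2 := tight_functional_partial csw tmu T0.
apply: (tight_functional_eq T1 T2) => l u cl /=.
pose l1 x : R := l (x, 0); pose l2 x : R := l (0, x).
have lE x y : l (x, y) = l1 x + l2 y :> R.
  by rewrite /l1 /l2 -linearD; congr (l _); congr pair; rewrite /= ?addr0 ?add0r.
have c1 : continuous l1.
  move=> x; apply: (@continuous_comp _ _ _ (fun x => (x, 0)) l); last exact: cl.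
  by apply: cvg_pair; [exact: cvg_id|exact: cvg_cst].
have c2 : continuous l2.
  move=> x; apply: (@continuous_comp _ _ _ (fun x => (0, x)) l); last exact: cl.
  by apply: cvg_pair; [exact: cvg_cst|exact: cvg_id].
have ic (m : D -> R) k : continuous m ->
    mu.-integrable setT (EFin \o (fun z => cos (m z + k))).
  move=> cm; apply: bounded_continuous_integrable; split.
    move=> z; apply: (@continuous_comp _ _ _ (fun z => m z + k) cos).
      by apply: cvgD; [exact: cm|exact: cvg_cst].
    exact: continuous_cos.
  by exists 1 => z; exact: cos_max.
have is_ (m : D -> R) k : continuous m ->
    mu.-integrable setT (EFin \o (fun z => sin (m z + k))).
  move=> cm; apply: bounded_continuous_integrable; split.
    move=> z; apply: (@continuous_comp _ _ _ (fun z => m z + k) sin).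
      by apply: cvgD; [exact: cm|exact: cvg_cst].
    exact: continuous_sin.
  by exists 1 => z; rewrite ler_norml sin_geN1 sin_le1.
have split_cos (m m' : D -> R) (k k' : R) : continuous m -> continuous m' ->
    \int[mu]_x \int[mu]_y cos ((m x + k) + (m' y + k')) =
    (\int[mu]_x cos (m x + k)) * (\int[mu]_y cos (m' y + k')) -
    (\int[mu]_x sin (m x + k)) * (\int[mu]_y sin (m' y + k')).
  move=> cm cm'.
  transitivity (\int[mu]_x (cos (m x + k) * (\int[mu]_y cos (m' y + k')) -
      sin (m x + k) * (\int[mu]_y sin (m' y + k')))).
    apply: eq_Rintegral => x _; rewrite -!RintegralZl//; [|exact: is_|exact: ic].
    rewrite -RintegralB//; last 2 first.
    - exact: (integrableZl measurableT (cos (m x + k)) (ic _ k' cm')).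
    - exact: (integrableZl measurableT (sin (m x + k)) (is_ _ k' cm')).
    by apply: eq_Rintegral => y _; rewrite cosD.
  rewrite RintegralB//; last 2 first.
  - exact: (integrableZr measurableT _ (ic _ k cm)).
  - exact: (integrableZr measurableT _ (is_ _ k cm)).
  by rewrite !RintegralZr//; [exact: is_|exact: ic].
transitivity (\int[mu]_x \int[mu]_y cos ((l1 x + u) + (l2 y + 0))).
  apply: eq_Rintegral => x _; apply: eq_Rintegral => y _; congr cos.
  by rewrite lE; ring.
transitivity (\int[mu]_x \int[mu]_y cos ((l2 x + 0) + (l1 y + u))); last first.
  apply: eq_Rintegral => x _; apply: eq_Rintegral => y _; congr cos.
  by rewrite lE; ring.
by rewrite !split_cos// (mulrC (\int[mu]_x cos _)) (mulrC (\int[mu]_x sin _)).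
Qed.

Let ge0_integral_trunc (h : D * D -> R) (H : nat -> D * D -> R) :
  continuous h -> (forall x, 0 <= h x) ->
  (forall n x, H n x = Num.min (h x) n%:R) -> (forall n, bounded_continuous (H n)) ->
  (\int[mu]_x \int[mu]_y (h (x, y))%:E =
   limn (fun n => (\int[mu]_x \int[mu]_y H n (x, y))%:E))%E.
Proof.
move=> ch h0 HE bH.
have H0 n x : 0 <= H n x by rewrite HE le_min h0 ler0n.
have Hmono x : {homo (fun n => H n x) : n k / (n <= k)%N >-> n <= k}.
  by move=> n k nk; rewrite !HE le_min2 ?ler_nat.
have mH n x : measurable_fun [set: borel D] (fun y : borel D => (H n (x, y))%:E).
  apply/measurable_EFinP; apply: continuous_borel_realfun.
  by have [] := bounded_continuous_slice x (bH n).
have HiE n x : (\int[mu]_y (H n (x, y))%:E = (\int[mu]_y H n (x, y))%:E)%E.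
  rewrite /Rintegral fineK//; apply: integrable_fin_num => //.
  exact: bounded_continuous_integrable (bounded_continuous_slice x (bH n)).
have inner x : (\int[mu]_y (h (x, y))%:E =
    limn (fun n => (\int[mu]_y H n (x, y))%:E))%E.
  rewrite (@ge0_integral_min _ _ mu (fun n => n%:R) (fun y => h (x, y)))//.
  - by congr (limn _); apply/funext => n; congr EFin; apply: eq_Rintegral => y _.
  - by move=> n m nm; rewrite ler_nat.
  - exact: cvgr_idn.
  - move=> y; apply: (@continuous_comp _ _ _ (fun y => (x, y)) h); last exact: ch.
    by apply: cvg_pair; [exact: cvg_cst|exact: cvg_id].
under eq_integral do rewrite inner.
rewrite monotone_convergence//.
- congr (limn _); apply/funext => n; rewrite /Rintegral fineK//.
  apply: integrable_fin_num => //; apply: bounded_continuous_integrable.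
  exact: (bounded_continuous_partial mu (fun x => cvg_id) (bH n)).
- move=> n; apply/measurable_EFinP; apply: continuous_borel_realfun.
  by have [] := bounded_continuous_partial mu (fun x => cvg_id) (bH n).
- by move=> n x _; rewrite lee_fin; apply: Rintegral_ge0.
- move=> x _ n k nk; rewrite -!HiE; apply: ge0_le_integral => //.
  + by move=> y _; rewrite lee_fin.
  + by move=> y _; rewrite lee_fin Hmono.
Qed.

Lemma measurable_partial_integral (f : D * D -> R) :
  continuous f -> (forall x, 0 <= f x) ->
  measurable_fun [set: borel D] (fun x : borel D => \int[mu]_y (f (x, y))%:E)%E.
Proof.
move=> cf f0.
pose F n x := Num.min (f x) n%:R.
have bF n : bounded_continuous (F n).
  split=> [x|]; last first.
    exists n%:R => x; rewrite ger0_norm ?le_min ?f0 ?ler0n//.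
    by rewrite ge_min lexx orbT.
  by apply: (@continuous_min _ _ f (cst n%:R) x); [exact: cf|exact: cvg_cst].
apply: (emeasurable_fun_cvg (fun n (x : borel D) => (\int[mu]_y F n (x, y))%:E)).
- move=> n; apply/measurable_EFinP; apply: continuous_borel_realfun.
  by have [] := bounded_continuous_partial mu (fun x => cvg_id) (bF n).
- move=> x _; rewrite (@ge0_integral_min _ _ mu (fun n => n%:R) (fun y => f (x, y)))//.
  + apply: ereal_nondecreasing_is_cvgn => n m nm; rewrite lee_fin.
    apply: le_Rintegral => //.
    * exact: bounded_continuous_integrable (bounded_continuous_slice x (bF n)).
    * exact: bounded_continuous_integrable (bounded_continuous_slice x (bF m)).
    * by move=> y _; rewrite le_min2// ler_nat.
  + by move=> n m nm; rewrite ler_nat.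
  + exact: cvgr_idn.
  + move=> y; apply: (@continuous_comp _ _ _ (fun y => (x, y)) f); last exact: cf.
    by apply: cvg_pair; [exact: cvg_cst|exact: cvg_id].
Qed.

Lemma ge0_integral_swap (f : D * D -> R) : continuous f -> (forall x, 0 <= f x) ->
  (\int[mu]_x \int[mu]_y (f (x, y))%:E = \int[mu]_x \int[mu]_y (f (y, x))%:E)%E.
Proof.
move=> cf f0.
pose F n x := Num.min (f x) n%:R.
have bF n : bounded_continuous (F n).
  split=> [x|]; last first.
    exists n%:R => x; rewrite ger0_norm ?le_min ?f0 ?ler0n//.
    by rewrite ge_min lexx orbT.
  by apply: (@continuous_min _ _ f (cst n%:R) x); [exact: cf|exact: cvg_cst].
have csw : continuous (fun xy : D * D => (xy.2, xy.1)).
  by move=> xy; apply: cvg_pair; [exact: cvg_snd|exact: cvg_fst].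
have bF' n : bounded_continuous (fun xy => F n (xy.2, xy.1)).
  have [cFn [M FM]] := bF n; split; last by exists M => xy; exact: FM.
  move=> xy; apply: (@continuous_comp _ _ _ (fun xy : D * D => (xy.2, xy.1)) (F n)).
    exact: csw.
  exact: cFn.
have cf' : continuous (fun xy => f (xy.2, xy.1)).
  move=> xy; apply: (@continuous_comp _ _ _ (fun xy : D * D => (xy.2, xy.1)) f).
    exact: csw.
  exact: cf.
have E1 := @ge0_integral_trunc f F cf f0 (fun n x => erefl) bF.
have E2 := @ge0_integral_trunc (fun xy => f (xy.2, xy.1)) (fun n xy => F n (xy.2, xy.1))
  cf' (fun xy => f0 (xy.2, xy.1)) (fun n x => erefl) bF'.
rewrite [LHS]E1 [RHS]E2; congr (limn _); apply/funext => n.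
by rewrite (Rintegral_swap (bF n)).
Qed.

End continuous_fubini.

(** * Maps with increments of constant law *)

Lemma cos_lipschitz (R : realType) (x y : R) : `|cos x - cos y| <= `|x - y|.
Proof.
wlog xy : x y / x <= y.
  by move=> H; have [/H//|/ltW/H] := leP x y; rewrite distrC (distrC x).
have [->|nxy] := eqVneq x y; first by rewrite !subrr.
have lxy : x < y by rewrite lt_neqAle nxy.
have [c _ ] := @MVT R (@cos R) (fun x => - sin x) x y lxy
  (fun z _ => is_derive_cos z) (continuous_subspaceT (@continuous_cos R)).
move=> cE; rewrite distrC cE normrM normrN (distrC x) ler_piMl//.
by rewrite ler_norml sin_geN1 sin_le1.
Qed.

(** The half-angle formula reduces this to the derivative of [sin] at 0; [w = 0] is treated apart
    because the increments [h n] must not vanish. *)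
Lemma cvg_cos_quotient (R : realType) (t : nat -> R) (w : R) : (forall n, 0 < t n) -> t @ \oo --> (0 : R) ->
  (1 - cos (t n * w)) / t n ^+ 2 @[n --> \oo] --> w ^+ 2 / 2.
Proof.
move=> t_gt0 t0; have [->|w0] := eqVneq w 0.
  under eq_fun do rewrite mulr0 cos0 subrr mul0r.
  by rewrite expr0n mul0r; exact: cvg_cst.
pose h n := t n * (w / 2).
have h0 n : h n != 0.
  by apply: mulf_neq0; [rewrite gt_eqF|rewrite mulf_neq0// invr_eq0 pnatr_eq0].
have ch : h @ \oo --> (0 : R).
  by rewrite -(mul0r (w / 2)); exact: cvgMr_tmp.
have E n : (1 - cos (t n * w)) / t n ^+ 2 = w ^+ 2 / 2 * (sin (h n) / h n) ^+ 2.
  have -> : t n * w = h n + h n by rewrite /h; field.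
  rewrite cosD -!expr2.
  have -> : 1 - (cos (h n) ^+ 2 - sin (h n) ^+ 2) = 2 * sin (h n) ^+ 2.
    by have := cos2Dsin2 (h n); lra.
  have -> : t n ^+ 2 = h n ^+ 2 * 4 / w ^+ 2 by rewrite /h; field.
  by field; rewrite h0 w0.
under eq_fun do rewrite E.
suff sin1 : sin (h n) / h n @[n --> \oo] --> (1 : R).
  have -> : w ^+ 2 / 2 = w ^+ 2 / 2 * (1 * 1) by rewrite !mulr1.
  under eq_fun do rewrite !mulr1 expr2.
  by apply: cvgMl_tmp; exact: cvgM.
have [ds sE] := @is_derive_sin R 0.
have := ds; rewrite /derivable => /cvg_ex[l sl].
have lE : l = 1.
  by rewrite -(@cos0 R) -sE; apply/esym/cvg_lim.
move: sl; rewrite lE => /cvgr_dnbhsP/(_ _ (conj h0 ch)).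
apply: cvg_trans; apply: near_eq_cvg; apply: nearW => n /=.
by rewrite sin0 subr0 addr0 scaler1 /GRing.scale /= mulrC.
Qed.

Section increments.
Variables (R : realType) (D : normedModType R) (mu : probability (borel D) R).
Hypotheses (tmu : tight_law mu) (gmu : gaussian_law mu).
Local Notation S := (law_support mu).
Hypothesis Ssub : vector_subspace S.
Variable g : D -> R.
Hypothesis cg : continuous g.
Hypothesis g_homog : forall t x, 0 < t -> S x -> g (t *: x) = t * g x.
Hypothesis g_incr : forall (a : D) (h : R -> R) (M : R), S a ->
  (forall x, `|h x| <= M) -> (forall x y, `|h x - h y| <= M * `|x - y|) ->
  \int[mu]_z h (g (a + z) - g a) = \int[mu]_z h (g z).

Let S0 : S 0. Proof. by have [/set_mem] := Ssub. Qed.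

Let SP a x y : S x -> S y -> S (a *: x + y).
Proof. by have [_ lS] := Ssub => Sx Sy; apply/set_mem/lS; exact/mem_set. Qed.

Let SD x y : S x -> S y -> S (x + y).
Proof. by move=> Sx Sy; rewrite -(scale1r x); exact: SP. Qed.

Let SZ a x : S x -> S (a *: x).
Proof. by move=> Sx; rewrite -[_ *: _]addr0; exact: SP. Qed.

Let g0 : g 0 = 0.
Proof.
have := @g_homog 2 0 (ltr0n _ 2) S0; rewrite scaler0.
by lra.
Qed.

(** [C] and [I] are the real and imaginary parts of the characteristic function of [g] under
    [mu]. *)
Let C t := \int[mu]_z cos (t * g z).
Let I t := \int[mu]_z sin (t * g z).

Let cgt (t u : R) : continuous (fun z => t * g z + u).
Proof. by move=> z; apply: cvgD; [apply: cvgMl_tmp; exact: cg|exact: cvg_cst]. Qed.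

Let bcos (f : D -> R) : continuous f -> bounded_continuous (fun z => cos (f z)).
Proof.
move=> cf; split; last by exists 1 => z; exact: cos_max.
by move=> z; apply: (@continuous_comp _ _ _ f cos); [exact: cf|exact: continuous_cos].
Qed.

Let bsin (f : D -> R) : continuous f -> bounded_continuous (fun z => sin (f z)).
Proof.
move=> cf; split; last by exists 1 => z; rewrite ler_norml sin_geN1 sin_le1.
by move=> z; apply: (@continuous_comp _ _ _ f sin); [exact: cf|exact: continuous_sin].
Qed.

Let ctg (t : R) : continuous (fun z => t * g z).
Proof. by move=> z; apply: cvgMl_tmp; exact: cg. Qed.

Let intC t : mu.-integrable setT (EFin \o (fun z => cos (t * g z))).
Proof. exact: bounded_continuous_integrable (bcos (@ctg t)). Qed.

Let intI t : mu.-integrable setT (EFin \o (fun z => sin (t * g z))).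
Proof. exact: bounded_continuous_integrable (bsin (@ctg t)). Qed.

Let Rintegral_cos t u : \int[mu]_z cos (t * g z + u) = cos u * C t - sin u * I t.
Proof.
rewrite -!RintegralZl// -RintegralB//.
- by apply: eq_Rintegral => z _; rewrite cosD; ring.
- exact: (integrableZl measurableT (cos u) (intC t)).
- exact: (integrableZl measurableT (sin u) (intI t)).
Qed.

(** By homogeneity, [g (a + c z) - g a] is [c] times an increment of [g] at [a / c], again a point
    of the support. *)
Let cos_incr a c t u : S a -> 0 < c ->
  \int[mu]_z cos (t * (g (a + c *: z) - g a) + u) = cos u * C (t * c) - sin u * I (t * c).
Proof.
move=> Sa c0; rewrite -Rintegral_cos.
have c_neq0 : c != 0 by rewrite gt_eqF.
have Sa' : S (c^-1 *: a) by exact: SZ.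
rewrite -(@g_incr _ (fun x => cos (t * c * x + u)) (1 + `|t * c|) Sa').
- apply: (eq_Rintegral_support tmu) => [||z Sz].
  + apply: (bcos _).1 => z; apply: cvgD; last exact: cvg_cst.
    apply: cvgMl_tmp; apply: cvgB; last exact: cvg_cst.
    apply: (@continuous_comp _ _ _ (fun z => a + c *: z) g); last exact: cg.
    by apply: cvgD; [exact: cvg_cst|apply: cvgZl_tmp; exact: cvg_id].
  + apply: (bcos _).1 => z; apply: cvgD; last exact: cvg_cst.
    apply: cvgMl_tmp; apply: cvgB; last exact: cvg_cst.
    apply: (@continuous_comp _ _ _ (fun z => c^-1 *: a + z) g); last exact: cg.
    by apply: cvgD; [exact: cvg_cst|exact: cvg_id].
  + congr (cos (_ + _)); rewrite -[in RHS]mulrA [in RHS](mulrBr c); congr (_ * (_ - _)).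
      rewrite -g_homog//; last exact: SD.
      by rewrite scalerDr scalerA mulfV// scale1r.
    by rewrite -g_homog// scalerA mulfV// scale1r.
- by move=> x; rewrite (le_trans (cos_max _))// lerDl.
- move=> x y; rewrite (le_trans (cos_lipschitz _ _))// opprD addrACA subrr addr0 -mulrBr normrM.
  by rewrite ler_wpM2r// lerDr.
Qed.

Let sin_incr a c t u : S a -> 0 < c ->
  \int[mu]_z sin (t * (g (a + c *: z) - g a) + u) = sin u * C (t * c) + cos u * I (t * c).
Proof.
move=> Sa c0; have := @cos_incr a c t (u - pi / 2) Sa c0.
rewrite cosBpihalf sinBpihalf mulNr opprK => <-.
by apply: eq_Rintegral => z _; rewrite addrA cosBpihalf.
Qed.

Let Rintegral_sin t u : \int[mu]_z sin (t * g z + u) = sin u * C t + cos u * I t.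
Proof.
have := Rintegral_cos t (u - pi / 2).
rewrite cosBpihalf sinBpihalf mulNr opprK => <-.
by apply: eq_Rintegral => z _; rewrite addrA cosBpihalf.
Qed.

Let Rintegral_trig (m : D -> R) (p q : R) : continuous m ->
  \int[mu]_z (p * cos (m z) + q * sin (m z)) =
  p * \int[mu]_z cos (m z) + q * \int[mu]_z sin (m z).
Proof.
move=> cm.
have ic := bounded_continuous_integrable mu (bcos cm).
have is_ := bounded_continuous_integrable mu (bsin cm).
rewrite RintegralD//; first by rewrite !RintegralZl.
- exact: (integrableZl measurableT p ic).
- exact: (integrableZl measurableT q is_).
Qed.

Let Rintegral_support_cst (f : D -> R) k : continuous f ->
  (forall z, S z -> f z = k) -> \int[mu]_z f z = k.
Proof.
move=> cf fk; rewrite -[RHS](Rintegral_prob_cst mu).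
by apply: (eq_Rintegral_support tmu) => //; exact: cst_continuous.
Qed.

Let continuous_add_scale k : continuous (fun vz : D * D => vz.1 + k *: vz.2).
Proof.
move=> vz; apply: cvgD; first exact: cvg_fst.
by apply: cvgZl_tmp; exact: cvg_snd.
Qed.

Let continuous_add : continuous (fun vz : D * D => vz.1 + vz.2).
Proof. by move=> vz; apply: cvgD; [exact: cvg_fst|exact: cvg_snd]. Qed.

(* In law, [3 g(z) = 2 g(z1) + 2 g(z2) - g(z3)] for independent [z1, z2, z3];
   only the moduli of the characteristic functions are kept. *)
Lemma charfun_triple (t : R) :
  C (3 * t) ^+ 2 + I (3 * t) ^+ 2 =
  (C (2 * t) ^+ 2 + I (2 * t) ^+ 2) ^+ 2 * (C t ^+ 2 + I t ^+ 2).
Proof.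
(* The two conditionings produce the coefficients 12 and 8, 8, -4; [tau] scales them to 3 and 2, 2,
   -1. *)
pose tau := t / 4.
have E u : cos u * C (3 * t) - sin u * I (3 * t) =
    C t * ((C (2 * t) ^+ 2 - I (2 * t) ^+ 2) * cos u -
             2 * C (2 * t) * I (2 * t) * sin u) +
    I t * ((C (2 * t) ^+ 2 - I (2 * t) ^+ 2) * sin u +
             2 * C (2 * t) * I (2 * t) * cos u).
  pose f (xy : D * D) := cos (tau * (9 * g xy.2 - g xy.1) + u).
  have cf : continuous f.
    move=> xy; apply: (@continuous_comp _ _ _
      (fun xy => tau * (9 * g xy.2 - g xy.1) + u) cos); last exact: continuous_cos.
    apply: cvgD; last exact: cvg_cst.
    apply: cvgMl_tmp; apply: cvgB.
      apply: cvgMl_tmp.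
      by apply: (@continuous_comp _ _ _ snd g); [exact: cvg_snd|exact: cg].
    by apply: (@continuous_comp _ _ _ fst g); [exact: cvg_fst|exact: cg].
  have bf : bounded_continuous f by split=> //; exists 1 => xy; exact: cos_max.
  pose F3 w := \int[mu]_z f (w + 4 *: z, w).
  have bF3 : bounded_continuous F3.
    apply: (@bounded_continuous_partial _ _ _ _ mu
      (fun vz : D * D => (vz.1 + 4 *: vz.2, vz.1))) bf.
    by move=> vz; apply: cvg_pair; [exact: continuous_add_scale|exact: cvg_fst].
  pose F2 v := \int[mu]_z F3 (v + z).
  have bF2 : bounded_continuous F2.
    exact: (bounded_continuous_partial mu continuous_add bF3).
  pose H4 x := \int[mu]_z f (x, 9^-1 *: x + (4 / 3) *: z).
  have bH4 : bounded_continuous H4.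
    apply: (@bounded_continuous_partial _ _ _ _ mu
      (fun vz : D * D => (vz.1, 9^-1 *: vz.1 + (4 / 3) *: vz.2))) bf.
    move=> vz; apply: cvg_pair; first exact: cvg_fst.
    by apply: cvgD; apply: cvgZl_tmp; [exact: cvg_fst|exact: cvg_snd].
  pose H3 w := \int[mu]_z H4 (w + 4 *: z).
  have bH3 : bounded_continuous H3.
    exact: (bounded_continuous_partial mu (@continuous_add_scale 4) bH4).
  pose H2 v := \int[mu]_z H3 (v + z).
  have bH2 : bounded_continuous H2.
    exact: (bounded_continuous_partial mu continuous_add bH3).
  have comp_add (v : D) (k : R) (h : D -> R) : continuous h ->
      continuous (fun z => h (v + k *: z)).
    move=> ch z; apply: (@continuous_comp _ _ _ (fun z => v + k *: z) h); last exact: ch.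
    by apply: cvgD; [exact: cvg_cst|apply: cvgZl_tmp; exact: cvg_id].
  have comp_add1 (v : D) (h : D -> R) : continuous h -> continuous (fun z => h (v + z)).
    move=> ch z; apply: (@continuous_comp _ _ _ (fun z => v + z) h); last exact: ch.
    by apply: cvgD; [exact: cvg_cst|exact: cvg_id].
  (* Given [x], the quantity [9 g(x/9 + (4/3) z) - g(x)] is 9 times an increment at [x/9], and
     [9 * (4/3) * tau = 3 t]. *)
  have H4E x : S x -> H4 x = cos u * C (3 * t) - sin u * I (3 * t).
    move=> Sx; have Sx9 : S (9^-1 *: x) by exact: SZ.
    have -> : 3 * t = 9 * tau * (4 / 3) by rewrite /tau; field.
    rewrite -(cos_incr _ _ Sx9)//; apply: eq_Rintegral => z _.
    rewrite /f /=; congr (cos (_ + _)).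
    have -> : g x = 9 * g (9^-1 *: x).
      by rewrite -g_homog// scalerA mulfV ?scale1r// pnatr_eq0.
    by ring.
  have H3E w : S w -> H3 w = cos u * C (3 * t) - sin u * I (3 * t).
    move=> Sw; apply: Rintegral_support_cst => [|z Sz].
      exact: (comp_add _ _ _ bH4.1).
    by apply: H4E; apply: SD => //; exact: SZ.
  have H2E v : S v -> H2 v = cos u * C (3 * t) - sin u * I (3 * t).
    move=> Sv; apply: Rintegral_support_cst => [|z Sz].
      exact: (comp_add1 _ _ bH3.1).
    by apply: H3E; exact: SD.
  have <- : \int[mu]_z H2 z = cos u * C (3 * t) - sin u * I (3 * t).
    by apply: Rintegral_support_cst => //; exact: bH2.1.
  have := gaussian_pair_eq tmu gmu bf.
  rewrite -/(\int[mu]_z H2 z) => <-.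
  rewrite -[LHS]/(\int[mu]_z F2 z).
  (* Given [b], the quantity [9 g(b) - g(b + 4 z)] is [8 g(b)] minus an increment at [b], with
     [8 tau = 2 t] and [4 tau = t]. *)
  have F3E b : S b -> F3 b = C t * cos (2 * t * g b + u) + I t * sin (2 * t * g b + u).
    move=> Sb.
    have -> : t = tau * 4 by rewrite /tau; field.
    transitivity (cos (- (2 * (tau * 4) * g b + u)) * C (tau * 4) -
                  sin (- (2 * (tau * 4) * g b + u)) * I (tau * 4)); last first.
      by rewrite cosN sinN; ring.
    rewrite -(cos_incr _ _ Sb)//; apply: eq_Rintegral => z _.
    by rewrite /f /= -cosN; congr cos; ring.
  have F2E v : S v -> F2 v =
      (C t * C (2 * t) + I t * I (2 * t)) * cos (2 * t * g v + u) +
      (I t * C (2 * t) - C t * I (2 * t)) * sin (2 * t * g v + u).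
    move=> Sv.
    transitivity (\int[mu]_z (C t * cos (2 * t * (g (v + 1 *: z) - g v) + (2 * t * g v + u)) +
        I t * sin (2 * t * (g (v + 1 *: z) - g v) + (2 * t * g v + u)))).
      apply: (eq_Rintegral_support tmu) => [||z Sz].
      - exact: (comp_add1 _ _ bF3.1).
      - have cc : continuous (fun z => 2 * t * (g (v + 1 *: z) - g v) + (2 * t * g v + u)).
          move=> z; apply: cvgD; last exact: cvg_cst.
          by apply: cvgMl_tmp; apply: cvgB; [exact: comp_add|exact: cvg_cst].
        by move=> z; apply: cvgD; apply: cvgMl_tmp;
          [exact: (bcos cc).1|exact: (bsin cc).1].
      - rewrite F3E; last exact: SD.
        by rewrite scale1r; congr (_ * cos _ + _ * sin _); ring.
    rewrite Rintegral_trig; last first.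
      move=> z; apply: cvgD; last exact: cvg_cst.
      by apply: cvgMl_tmp; apply: cvgB; [exact: comp_add|exact: cvg_cst].
    rewrite cos_incr// sin_incr// mulr1; ring.
  transitivity (\int[mu]_z
      ((C t * C (2 * t) + I t * I (2 * t)) * cos (2 * t * g z + u) +
      (I t * C (2 * t) - C t * I (2 * t)) * sin (2 * t * g z + u))).
    apply: (eq_Rintegral_support tmu) => [||z Sz]; [exact: bF2.1| |exact: F2E].
    by move=> z; apply: cvgD; apply: cvgMl_tmp;
      [exact: (bcos (@cgt _ _)).1|exact: (bsin (@cgt _ _)).1].
  by rewrite Rintegral_trig// Rintegral_cos Rintegral_sin; ring.
(* The phases 0 and [- pi / 2] isolate the real and the imaginary part. *)
have c3 := E 0; have s3 := E (- (pi / 2)).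
rewrite cosN sinN cos_pihalf sin_pihalf in s3.
rewrite cos0 sin0 in c3.
have {}c3 : C (3 * t) = C t * (C (2 * t) ^+ 2 - I (2 * t) ^+ 2) +
  I t * (2 * C (2 * t) * I (2 * t)) by lra.
have {}s3 : I (3 * t) = C t * (2 * C (2 * t) * I (2 * t)) -
  I t * (C (2 * t) ^+ 2 - I (2 * t) ^+ 2) by lra.
by rewrite c3 s3; ring.
Qed.

Let cvgC (t : nat -> R) : t @ \oo --> (0 : R) -> C (t n) @[n --> \oo] --> (1 : R).
Proof.
move=> t0; have -> : (1 : R) = \int[mu]_z 1 by rewrite (Rintegral_prob_cst mu).
apply: (@Rintegral_bounded_cvg _ _ _ mu _ _ 1) => //.
- by move=> n; apply: continuous_borel_realfun; exact: (bcos (@ctg _)).1.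
- by move=> n z; exact: cos_max.
- move=> z; rewrite -(@cos0 R) -(mul0r (g z)).
  by apply: continuous_cvg; [exact: continuous_cos|exact: cvgMr_tmp].
Qed.

Let cvgI (t : nat -> R) : t @ \oo --> (0 : R) -> I (t n) @[n --> \oo] --> (0 : R).
Proof.
move=> t0; have -> : (0 : R) = \int[mu]_z 0 by rewrite (Rintegral_prob_cst mu).
apply: (@Rintegral_bounded_cvg _ _ _ mu _ _ 1) => //.
- by move=> n; apply: continuous_borel_realfun; exact: (bsin (@ctg _)).1.
- by move=> n z; rewrite ler_norml sin_geN1 sin_le1.
- move=> z; rewrite -(@sin0 R) -(mul0r (g z)).
  by apply: continuous_cvg; [exact: continuous_sin|exact: cvgMr_tmp].
Qed.

(** Also the characteristic function of [g(X) - g(Y)] for independent copies [X], [Y]. *)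
Let rho t := C t ^+ 2 + I t ^+ 2.

Let rho_ge0 t : 0 <= rho t. Proof. by rewrite addr_ge0// sqr_ge0. Qed.

(* The function [- ln (rho t) / t^2] is bounded along a sequence decreasing to
   0: by [charfun_triple], its value at [3 s] is an average of its values at
   [2 s] and [s]. *)
Lemma charfun_lower_bound : exists B (t : nat -> R),
  [/\ forall n, 0 < t n, t @ \oo --> (0 : R) & forall n, 1 - rho (t n) <= B * t n ^+ 2].
Proof.
have [t0 t0_gt0 rt0] : exists2 t, 0 < t & 0 < rho t.
  have : rho n.+1%:R^-1 @[n --> \oo] --> (1 : R).
    rewrite [X in _ --> X](_ : (1 : R) = 1 * 1 + 0 * 0); last by ring.
    by apply: cvgD; apply: cvgM; (apply: cvgC || apply: cvgI); exact: cvg_harmonic.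
  move=> /cvgrPdist_lt/(_ 1 ltr01)[N _ /(_ N (leqnn N))] /=.
  rewrite ltr_norml => /andP[_ h]; exists N.+1%:R^-1; first by rewrite invr_gt0.
  by lra.
pose B := - ln (rho t0) / t0 ^+ 2.
have rE : expR (- (B * t0 ^+ 2)) = rho t0.
  by rewrite /B divfK ?opprK ?lnK// gt_eqF// exprn_gt0.
have ex n : exists t, [/\ 0 < t, t <= (2 / 3) ^+ n * t0 & expR (- (B * t ^+ 2)) <= rho t].
  elim: n => [|n [t [t_gt0 tn rt]]].
    by exists t0; rewrite expr0 mul1r lexx rE lexx.
  pose s := t / 3.
  have s_gt0 : 0 < s by rewrite divr_gt0.
  have ts : t = 3 * s by rewrite /s mulrC divfK.
  have [h2|h2] := leP (expR (- (B * (2 * s) ^+ 2))) (rho (2 * s)).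
    exists (2 * s); split => //; first by rewrite mulr_gt0.
    by rewrite exprS -mulrA (_ : 2 * s = 2 / 3 * t) ?ler_pM2l// ts; field.
  exists s; split => //.
    apply: (@le_trans _ _ (2 / 3 * t)); first by rewrite ts; lra.
    by rewrite exprS -[leRHS]mulrA ler_pM2l.
  (* Failure at both [2 s] and [s] would contradict the bound at [3 s], since
     [2 * 2^2 + 1^2 = 3^2]. *)
  rewrite leNgt; apply/negP => h1.
  have := charfun_triple s; rewrite -/(rho _) -/(rho _) -/(rho _) => E3.
  move: rt; rewrite ts E3.
  have -> : expR (- (B * (3 * s) ^+ 2)) =
      expR (- (B * (2 * s) ^+ 2)) ^+ 2 * expR (- (B * s ^+ 2)).
    by rewrite (expr2 (expR _)) -!expRD; congr expR; ring.
  apply/negP; rewrite -ltNge.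
  have e2 : 0 < expR (- (B * (2 * s) ^+ 2)) ^+ 2 by rewrite exprn_gt0// expR_gt0.
  apply: (@le_lt_trans _ _ (expR (- (B * (2 * s) ^+ 2)) ^+ 2 * rho s)).
    by rewrite ler_wpM2r// lerXn2r ?nnegrE ?expR_ge0// ltW.
  by rewrite ltr_pM2l.
have [t tP] := choice ex; exists B, t; split.
- by move=> n; have [] := tP n.
- apply: (@squeeze_cvgr _ _ _ _ (cst 0) (fun n => (2 / 3) ^+ n * t0)).
  + by apply: nearW => n; have [/ltW -> -> _] := tP n.
  + exact: cvg_cst.
  + rewrite -(mul0r t0); apply: cvgMr_tmp; apply: cvg_expr.
    by rewrite ger0_norm; lra.
- move=> n; have [_ _ h] := tP n.
  have := expR_ge1Dx (- (B * t n ^+ 2)); lra.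
Qed.

(** The double integral of [k n] is [(1 - rho (t n)) / t n ^+ 2 <= B], and [k n x y] tends to
    [(g x - g y) ^+ 2 / 2]. Fatou's lemma is used twice: in [y], to find one [y] where the lower
    limit of [a n y] is finite, then in [x] for this [y]. *)
Lemma square_integrable : mu.-integrable setT (EFin \o (fun z => g z ^+ 2)).
Proof.
have [B [t [t_gt0 t0 tB]]] := charfun_lower_bound.
have t2 n : 0 < t n ^+ 2 by rewrite exprn_gt0.
pose k n x y := (1 - cos (t n * (g x - g y))) / t n ^+ 2.
pose a n y := (1 - (cos (t n * g y) * C (t n) + sin (t n * g y) * I (t n))) / t n ^+ 2.
have i1 : mu.-integrable setT (EFin \o (fun=> 1 : R)).
  apply: (@bounded_continuous_integrable _ _ mu (fun=> 1)); split.
    exact: cst_continuous.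
  by exists 1 => _; rewrite normr1.
have k0 n x y : 0 <= k n x y.
  by rewrite divr_ge0 ?(ltW (t2 _))// subr_ge0 cos_le1.
have cky n y : continuous (k n ^~ y).
  move=> x; apply: cvgMr_tmp; apply: cvgB; first exact: cvg_cst.
  apply: (bcos _).1 => {}x; apply: cvgMl_tmp.
  by apply: cvgB; [exact: cg|exact: cvg_cst].
have bky n y : bounded_continuous (k n ^~ y).
  split=> //; exists (2 / t n ^+ 2) => x; rewrite ger0_norm// ler_wpM2r//.
    by rewrite invr_ge0 ltW.
  by have := cos_geN1 (t n * (g x - g y)); lra.
have aE n y : \int[mu]_x k n x y = a n y.
  rewrite /k RintegralZr//; last first.
    apply: bounded_continuous_integrable; split=> [x|].
      apply: cvgB; first exact: cvg_cst.
      apply: (bcos _).1 => {}x; apply: cvgMl_tmp.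
      by apply: cvgB; [exact: cg|exact: cvg_cst].
    exists 2 => x; have := cos_geN1 (t n * (g x - g y)).
    by have := cos_le1 (t n * (g x - g y)); rewrite ler_norml; lra.
  have ik : mu.-integrable setT (EFin \o (fun x => cos (t n * (g x - g y)))).
    apply: bounded_continuous_integrable; apply: bcos => x; apply: cvgMl_tmp.
    by apply: cvgB; [exact: cg|exact: cvg_cst].
  congr (_ / _); rewrite RintegralB//.
  rewrite Rintegral_prob_cst; congr (_ - _).
  transitivity (\int[mu]_x cos (t n * g x + - (t n * g y))).
    by apply: eq_Rintegral => x _; congr cos; ring.
  by rewrite Rintegral_cos cosN sinN; ring.
have ca n : continuous (a n).
  move=> y; apply: cvgMr_tmp; apply: cvgB; first exact: cvg_cst.
  by apply: cvgD; apply: cvgMr_tmp; [exact: (bcos (@ctg _)).1|exact: (bsin (@ctg _)).1].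
have a0 n y : 0 <= a n y by rewrite -aE; apply: Rintegral_ge0.
have ba n : bounded_continuous (a n).
  split=> //; exists (2 / t n ^+ 2) => y; rewrite -aE.
  apply: Rintegral_norm_le; first exact: continuous_borel_realfun.
  move=> x; rewrite ger0_norm// ler_wpM2r ?invr_ge0 ?(ltW (t2 _))//.
  by have := cos_geN1 (t n * (g x - g y)); lra.
have aB n : (\int[mu]_y (a n y)%:E <= B%:E)%E.
  rewrite -[leLHS]fineK; last first.
    exact: integrable_fin_num (bounded_continuous_integrable mu (ba n)).
  rewrite lee_fin -/(Rintegral mu setT (a n)).
  have ic : mu.-integrable setT (EFin \o (fun y =>
     C (t n) * cos (t n * g y) + I (t n) * sin (t n * g y))).
    have := integrableD measurableT (integrableZl measurableT (C (t n)) (intC (t n)))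
      (integrableZl measurableT (I (t n)) (intI (t n))).
    by congr (_.-integrable _ _).
  have -> : \int[mu]_y a n y = (1 - rho (t n)) / t n ^+ 2.
    rewrite /a; under eq_Rintegral do rewrite (mulrC (cos _)) (mulrC (sin _)).
    rewrite RintegralZr//; last exact: (integrableB measurableT i1 ic).
    congr (_ / _); rewrite RintegralB//.
    by rewrite Rintegral_prob_cst Rintegral_trig// /rho !expr2.
  by rewrite ler_pdivrMr.
have [y ay] : exists y, (limn_einf (fun n => (a n y)%:E) < +oo)%E.
  apply: contrapT => nay.
  have ayoo y : limn_einf (fun n => (a n y)%:E) = +oo%E.
    by apply/eqP; rewrite -leye_eq leNgt; apply/negP => h; apply: nay; exists y.
  have F : (\int[mu]_y limn_einf (fun n => (a n y)%:E) <=
      limn_einf (fun n => \int[mu]_y (a n y)%:E))%E.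
    apply: fatou => // [n|n y _]; last by rewrite lee_fin.
    by apply/measurable_EFinP; exact: continuous_borel_realfun.
  have F2 : (limn_einf (fun n => \int[mu]_y (a n y)%:E) <= B%:E)%E.
    rewrite limn_einf_lim; apply: lime_le; first exact: is_cvg_einfs.
    apply: nearW => n; apply: le_trans (aB n).
    by apply: ereal_inf_lbound; exists n => /=.
  have := le_trans F F2; under eq_integral do rewrite ayoo.
  rewrite integral_cst// [X in (_ * X)%E](_ : _ = 1%E) ?mule1//.
  exact: probability_setT.
have lek : (\int[mu]_x ((g x - g y) ^+ 2 / 2)%:E < +oo)%E.
  apply: le_lt_trans ay.
  have F : (\int[mu]_x limn_einf (fun n => (k n x y)%:E) <=
      limn_einf (fun n => \int[mu]_x (k n x y)%:E))%E.
    apply: fatou => // [n|n x _]; last by rewrite lee_fin.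
    by apply/measurable_EFinP; exact: continuous_borel_realfun.
  have E2 : (fun n => \int[mu]_x (k n x y)%:E)%E = (fun n => (a n y)%:E).
    apply/funext => n; rewrite -aE /Rintegral fineK//.
    exact: integrable_fin_num (bounded_continuous_integrable mu (bky n y)).
  rewrite -E2; apply: le_trans F; rewrite le_eqVlt; apply/orP; left; apply/eqP.
  apply: eq_integral => x _; apply/esym.
  have cvgk : (k n x y)%:E @[n --> \oo] --> ((g x - g y) ^+ 2 / 2)%:E.
    by apply: cvg_EFin; [exact: nearW|exact: cvg_cos_quotient].
  by rewrite is_cvg_limn_einfE; [exact/cvg_lim|apply/cvg_ex; eexists; exact: cvgk].
have cgx2 : continuous (fun x => (g x - g y) ^+ 2 / 2).
  move=> x; apply: cvgMr_tmp; under eq_fun do rewrite expr2; rewrite expr2.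
  by apply: cvgM; apply: cvgB; [exact: cg|exact: cvg_cst|exact: cg|exact: cvg_cst].
have id2 : mu.-integrable setT (EFin \o (fun x => (g x - g y) ^+ 2 / 2)).
  apply/integrableP; split; first by apply/measurable_EFinP; exact: continuous_borel_realfun.
  under eq_integral => x _ do rewrite /= ger0_norm ?divr_ge0 ?sqr_ge0//.
  exact: lek.
have ic : mu.-integrable setT (EFin \o (fun=> 2 * g y ^+ 2 : R)).
  apply: (@bounded_continuous_integrable _ _ mu (fun=> 2 * g y ^+ 2)); split.
    exact: cst_continuous.
  by exists `|2 * g y ^+ 2| => _.
apply: (@le_integrable _ _ _ mu _ measurableT _
  (fun x => (4%:E * ((g x - g y) ^+ 2 / 2)%:E + (2 * g y ^+ 2)%:E)%E)).
- apply/measurable_EFinP; apply: continuous_borel_realfun => x.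
  rewrite /continuous_at expr2; under eq_fun do rewrite expr2.
  by apply: cvgM; exact: cg.
- move=> x _ /=; rewrite lee_fin ger0_norm ?sqr_ge0// (le_trans _ (ler_norm _))//.
  by have := sqr_ge0 (g x - 2 * g y); nra.
- exact: (integrableD measurableT (integrableZl measurableT 4 id2) ic).
Qed.

(** [g_incr] takes a single constant for bound and slope: [n^2 + 2 n] covers the bound [n^2] and the
    slope [2 n]. *)
Let min_sqr_lipschitz (e x y : R) (n : nat) :
  `|Num.min ((x + e) ^+ 2) (n%:R ^+ 2) - Num.min ((y + e) ^+ 2) (n%:R ^+ 2)| <=
  (n%:R ^+ 2 + 2 * n%:R) * `|x - y|.
Proof.
have minE z : Num.min (z ^+ 2) (n%:R ^+ 2) = Num.min `|z| n%:R ^+ 2 :> R.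
  rewrite -(real_normK (num_real z)); case: (leP `|z| n%:R) => h.
    by apply/min_idPl; rewrite lerXn2r ?nnegrE.
  by apply/min_idPr; rewrite lerXn2r ?nnegrE// ltW.
rewrite !minE subr_sqr normrM mulrC.
set a := Num.min `|x + e| _; set b := Num.min `|y + e| _.
have a0 : 0 <= a by rewrite le_min normr_ge0 ler0n.
have b0 : 0 <= b by rewrite le_min normr_ge0 ler0n.
have an : a <= n%:R by rewrite ge_min lexx orbT.
have bn : b <= n%:R by rewrite ge_min lexx orbT.
apply: ler_pM => //.
  by rewrite ger0_norm ?addr_ge0//; have := sqr_ge0 (n%:R : R); lra.
have xy : `| `|x + e| - `|y + e| | <= `|x - y|.
  by rewrite (le_trans (ler_dist_dist _ _))// opprD addrACA subrr addr0.
apply: le_trans xy; rewrite /a /b.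
set p := `|x + e|; set q := `|y + e|; set k : R := n%:R.
by case: (leP p k) => ?; case: (leP q k) => ?; rewrite ler_norml;
  have := ler_norm (p - q); have := ler_norm (q - p); rewrite (distrC q); lra.
Qed.

Let continuous_shift a : continuous (fun z => g (a + z) - g a).
Proof.
move=> z; apply: cvgB; last exact: cvg_cst.
apply: (@continuous_comp _ _ _ (fun z => a + z) g); last exact: cg.
by apply: cvgD; [exact: cvg_cst|exact: cvg_id].
Qed.

Let continuous_sqrD (f : D -> R) (e : R) : continuous f ->
  continuous (fun z => (f z + e) ^+ 2).
Proof.
move=> cf z; rewrite /continuous_at expr2; under eq_fun do rewrite expr2.
by apply: cvgM; apply: cvgD; [exact: cf|exact: cvg_cst|exact: cf|exact: cvg_cst].
Qed.

Let continuous_sqr (f : D -> R) : continuous f -> continuous (fun z => f z ^+ 2).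
Proof.
move=> cf z; rewrite /continuous_at expr2; under eq_fun do rewrite expr2.
by apply: cvgM; exact: cf.
Qed.

(** The shift [e] gives access to the mean: [e = 0] and [e = 1] together determine it, without
    truncating a signed function. *)
Let integral_sqr_incr a (e : R) : S a ->
  (\int[mu]_z ((g (a + z) - g a + e) ^+ 2)%:E = \int[mu]_z ((g z + e) ^+ 2)%:E)%E.
Proof.
move=> Sa.
have ndc : nondecreasing_seq (fun n => n%:R ^+ 2 : R).
  by move=> n m nm; rewrite lerXn2r ?nnegrE// ler_nat.
have cy : (fun n => n%:R ^+ 2 : R) @ \oo --> +oo.
  apply: (@ger_cvgy _ _ _ _ (fun n => n%:R : R)); last exact: cvgr_idn.
  by apply: nearW => n; rewrite -natrX ler_nat; case: n => // n; rewrite expnS expn1 leq_pmulr.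
have c0 n : 0 <= n%:R ^+ 2 :> R by exact: sqr_ge0.
rewrite !(@ge0_integral_min _ _ mu (fun n => n%:R ^+ 2)) ?sqr_ge0//.
- congr (limn _); apply/funext => n; congr EFin.
  apply: (@g_incr _ (fun x => Num.min ((x + e) ^+ 2) (n%:R ^+ 2)) (n%:R ^+ 2 + 2 * n%:R) Sa).
  + move=> x; rewrite ger0_norm ?le_min ?sqr_ge0//.
    apply: (@le_trans _ _ (n%:R ^+ 2)); first by rewrite ge_min lexx orbT.
    by rewrite lerDl mulr_ge0.
  + by move=> x y; exact: min_sqr_lipschitz.
- exact: continuous_sqrD.
- by move=> z; exact: sqr_ge0.
- by apply: continuous_sqrD; exact: continuous_shift.
- by move=> z; exact: sqr_ge0.
Qed.

Let integrable_sqr_continuous (f : D -> R) : continuous f ->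
  (\int[mu]_z (f z ^+ 2)%:E < +oo)%E ->
  mu.-integrable setT (EFin \o (fun z => f z ^+ 2)) /\
  mu.-integrable setT (EFin \o f).
Proof.
move=> cf fin.
have cf2 : continuous (fun z => f z ^+ 2).
  exact: continuous_sqr.
have i2 : mu.-integrable setT (EFin \o (fun z => f z ^+ 2)).
  apply/integrableP; split; first by apply/measurable_EFinP; exact: continuous_borel_realfun.
  by under eq_integral => z _ do rewrite /= ger0_norm ?sqr_ge0//.
split => //; apply: (@le_integrable _ _ _ mu _ measurableT _
  (fun x => (1%:E + (f x ^+ 2)%:E)%E)).
- by apply/measurable_EFinP; exact: continuous_borel_realfun.
- move=> z _ /=; rewrite lee_fin (ger0_norm (addr_ge0 _ _)) ?sqr_ge0//.
  by rewrite -(real_normK (num_real (f z))); have := normr_ge0 (f z); nra.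
- apply: (integrableD measurableT _ i2).
  apply: (@bounded_continuous_integrable _ _ mu (fun=> 1)); split.
    exact: cst_continuous.
  by exists 1 => _; rewrite normr1.
Qed.

Let int2 : (\int[mu]_z (g z ^+ 2)%:E < +oo)%E.
Proof.
have /integrableP[_] := square_integrable.
by under eq_integral => z _ do rewrite /= ger0_norm ?sqr_ge0//.
Qed.

Let integral_sqr_incr0 a : S a ->
  (\int[mu]_z ((g (a + z) - g a) ^+ 2)%:E = \int[mu]_z (g z ^+ 2)%:E)%E.
Proof.
move=> Sa; transitivity (\int[mu]_z ((g (a + z) - g a + 0) ^+ 2)%:E)%E.
  by apply: eq_integral => z _; rewrite addr0.
by rewrite integral_sqr_incr//; apply: eq_integral => z _; rewrite addr0.
Qed.

Let Rintegral_incr a : S a -> \int[mu]_z (g (a + z) - g a) = \int[mu]_z g z.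
Proof.
move=> Sa; have [g2i gi] := integrable_sqr_continuous cg int2.
have incr2 : (\int[mu]_z ((g (a + z) - g a) ^+ 2)%:E < +oo)%E.
  by rewrite integral_sqr_incr0.
have [w2i wi] := integrable_sqr_continuous (@continuous_shift a) incr2.
have i1 : mu.-integrable setT (EFin \o (fun=> 1 : R)).
  apply: (@bounded_continuous_integrable _ _ mu (fun=> 1)); split.
    exact: cst_continuous.
  by exists 1 => _; rewrite normr1.
have expand (f : D -> R) : mu.-integrable setT (EFin \o (fun z => f z ^+ 2)) ->
    mu.-integrable setT (EFin \o f) ->
    \int[mu]_z ((f z + 1) ^+ 2) = \int[mu]_z (f z ^+ 2) + 2 * \int[mu]_z f z + 1.
  move=> f2i fi; rewrite -[X in _ + X](Rintegral_prob_cst mu) -RintegralZl//.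
  rewrite -RintegralD//; last exact: (integrableZl measurableT 2 fi).
  rewrite -RintegralD//; last exact: (integrableD measurableT f2i (integrableZl measurableT 2 fi)).
  by apply: eq_Rintegral => z _; ring.
have h1 : \int[mu]_z ((g (a + z) - g a + 1) ^+ 2) = \int[mu]_z ((g z + 1) ^+ 2).
  by congr fine; exact: integral_sqr_incr.
have h0 : \int[mu]_z ((g (a + z) - g a) ^+ 2) = \int[mu]_z (g z ^+ 2).
  by congr fine; exact: integral_sqr_incr0.
by move: h1; rewrite !expand// h0; lra.
Qed.

Let T2 (xy : D * D) := (g (xy.1 + xy.2) - g xy.1 - g xy.2) ^+ 2.

Let cT2 : continuous T2.
Proof.
have c1 : continuous (fun xy : D * D => g xy.1).
  by move=> xy; apply: (@continuous_comp _ _ _ fst g); [exact: cvg_fst|exact: cg].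
have c2 : continuous (fun xy : D * D => g xy.2).
  by move=> xy; apply: (@continuous_comp _ _ _ snd g); [exact: cvg_snd|exact: cg].
have c12 : continuous (fun xy : D * D => g (xy.1 + xy.2)).
  move=> xy; apply: (@continuous_comp _ _ _ (fun xy : D * D => xy.1 + xy.2) g).
    exact: continuous_add.
  exact: cg.
have cd : continuous (fun xy : D * D => g (xy.1 + xy.2) - g xy.1 - g xy.2).
  by move=> xy; apply: cvgB; [apply: cvgB; [exact: c12|exact: c1]|exact: c2].
move=> xy; rewrite /continuous_at /T2 expr2; under eq_fun do rewrite expr2.
by apply: cvgM; exact: cd.
Qed.

(* Given [x], the increment [g (x + y) - g x] has the mean of [g y], so the
   cross term of [(T + g x)^2] integrates to zero. *)
Let integral_T2_sqr x : S x ->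
  (\int[mu]_y ((g (y + x) - g y) ^+ 2)%:E =
   \int[mu]_y (T2 (x, y))%:E + (g x ^+ 2)%:E)%E.
Proof.
move=> Sx; have [g2i gi] := integrable_sqr_continuous cg int2.
have incr2 : (\int[mu]_z ((g (x + z) - g x) ^+ 2)%:E < +oo)%E.
  by rewrite integral_sqr_incr0.
have [w2i wi] := integrable_sqr_continuous (@continuous_shift x) incr2.
pose T y := g (x + y) - g x - g y.
have cT : continuous T.
  by move=> y; apply: cvgB; [exact: continuous_shift|exact: cg].
have T2fin : (\int[mu]_y (T y ^+ 2)%:E < +oo)%E.
  have /integrableP[_] := integrableD measurableT (integrableZl measurableT 2 w2i)
    (integrableZl measurableT 2 g2i).
  apply: le_lt_trans; apply: ge0_le_integral => //.
  - by move=> y _; rewrite lee_fin sqr_ge0.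
  - apply/measurable_EFinP; apply: continuous_borel_realfun.
    exact: continuous_sqr.
  - apply: measurableT_comp => //; apply: emeasurable_funD.
    + by apply: measurable_funeM; exact: measurable_int w2i.
    + by apply: measurable_funeM; exact: measurable_int g2i.
  - move=> y _ /=; rewrite lee_fin (le_trans _ (ler_norm _))//.
    by rewrite /T; set u := _ - g x; have := sqr_ge0 (u + g y); nra.
have [T2i Ti] := integrable_sqr_continuous cT T2fin.
have T0 : \int[mu]_y T y = 0.
  by rewrite RintegralB// Rintegral_incr// subrr.
have ic : mu.-integrable setT (EFin \o (fun=> g x ^+ 2)).
  apply: (@bounded_continuous_integrable _ _ mu (fun=> g x ^+ 2)); split.
    exact: cst_continuous.
  by exists `|g x ^+ 2| => _.
have i2T : mu.-integrable setT (EFin \o (fun y => 2 * g x * T y)).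
  exact: (integrableZl measurableT (2 * g x) Ti).
have -> : (\int[mu]_y (T2 (x, y))%:E = (\int[mu]_y (T y ^+ 2))%:E)%E.
  by rewrite /Rintegral fineK//; exact: integrable_fin_num.
have E y : (g (y + x) - g y) ^+ 2 = T y ^+ 2 + 2 * g x * T y + g x ^+ 2.
  by rewrite (addrC y) /T; ring.
under eq_integral do rewrite E.
rewrite -EFinD -[X in (_ + X)%:E](Rintegral_prob_cst mu).
have -> : \int[mu]_y (T y ^+ 2) = \int[mu]_y (T y ^+ 2) + 2 * g x * \int[mu]_y T y.
  by rewrite T0 mulr0 addr0.
rewrite -RintegralZl// -RintegralD//.
have i3 := integrableD measurableT T2i i2T.
rewrite -RintegralD//.
rewrite /Rintegral fineK//.
apply: integrable_fin_num => //.
exact: (integrableD measurableT i3 ic).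
Qed.

Let integral_T2_eq0 : (\int[mu]_x \int[mu]_y (T2 (x, y))%:E = 0)%E.
Proof.
pose F (xy : D * D) := (g (xy.2 + xy.1) - g xy.2) ^+ 2.
have cF : continuous F.
  have cd : continuous (fun xy : D * D => g (xy.2 + xy.1) - g xy.2).
    move=> xy; apply: cvgB.
      apply: (@continuous_comp _ _ _ (fun xy : D * D => xy.2 + xy.1) g); last exact: cg.
      by apply: cvgD; [exact: cvg_snd|exact: cvg_fst].
    by apply: (@continuous_comp _ _ _ snd g); [exact: cvg_snd|exact: cg].
  move=> xy; rewrite /continuous_at /F expr2; under eq_fun do rewrite expr2.
  by apply: cvgM; exact: cd.
have F0 xy : 0 <= F xy by exact: sqr_ge0.
have T20 xy : 0 <= T2 xy by exact: sqr_ge0.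
have sw := ge0_integral_swap tmu cF F0.
have mT2 := measurable_partial_integral mu cT2 T20.
have mg2 : measurable_fun [set: borel D] (fun z : borel D => (g z ^+ 2)%:E).
  by have := square_integrable; exact: measurable_int.
have T2ge0 x : (0 <= \int[mu]_y (T2 (x, y))%:E)%E.
  by apply: integral_ge0 => y _; rewrite lee_fin.
have E1 : (\int[mu]_x \int[mu]_y (F (x, y))%:E =
    \int[mu]_x \int[mu]_y (T2 (x, y))%:E + \int[mu]_x (g x ^+ 2)%:E)%E.
  rewrite -ge0_integralD//; last by move=> x _; rewrite lee_fin sqr_ge0.
  apply: (eq_integral_support tmu).
  - exact: measurable_partial_integral.
  - exact: emeasurable_funD.
  - by move=> x Sx; exact: integral_T2_sqr.
have E2 : (\int[mu]_x \int[mu]_y (F (y, x))%:E = \int[mu]_x (g x ^+ 2)%:E)%E.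
  transitivity (\int[mu]_x (cst (\int[mu]_z (g z ^+ 2)%:E) x))%E.
    apply: (eq_integral_support tmu) => //.
    apply: (measurable_partial_integral mu (f := fun xy => F (xy.2, xy.1))) => //.
    move=> xy; apply: (@continuous_comp _ _ _ (fun xy : D * D => (xy.2, xy.1)) F).
      by apply: cvg_pair; [exact: cvg_snd|exact: cvg_fst].
    exact: cF.
  rewrite integral_cst// [X in (_ * X)%E](_ : _ = 1%E) ?mule1//.
  exact: probability_setT.
have gfin : (\int[mu]_x (g x ^+ 2)%:E)%E \is a fin_num.
  rewrite ge0_fin_numE ?int2//.
  by apply: integral_ge0 => z _; rewrite lee_fin sqr_ge0.
move: sw; rewrite E1 E2 => sw.
by rewrite -[LHS](addeK _ gfin) sw subee.
Qed.

(** Were the continuous function [T2] positive at [(a, b)], it would exceed some [e > 0] on a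
    product of neighbourhoods. Both have positive mass, as [a] and [b] lie in the support, so the
    iterated integral of [T2] could not vanish. *)
Lemma additive_on_support a b : S a -> S b -> g (a + b) = g a + g b.
Proof.
move=> Sa Sb; apply: contrapT => nadd.
have Tab : 0 < T2 (a, b).
  rewrite /T2 lt_def sqr_ge0 andbT sqrf_eq0 /=; apply/eqP => h.
  by apply: nadd; lra.
pose e := T2 (a, b) / 2; have e0 : 0 < e by rewrite divr_gt0.
have T20 xy : 0 <= T2 xy by exact: sqr_ge0.
have : \forall xy \near (a, b), e < T2 xy.
  have /cvgrPdist_lt/(_ _ e0) := @cT2 (a, b).
  by apply: filterS => xy; rewrite ltr_norml => /andP[_]; rewrite /e; lra.
move=> [[A B] /= [nA nB] AB].
have [U [oU Ua UA]] : exists U, [/\ open U, U a & U `<=` A].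
  by exists A^°; split; [exact: open_interior|exact: nA|exact: interior_subset].
have [V [oV Vb VB]] : exists V, [/\ open V, V b & V `<=` B].
  by exists B^°; split; [exact: open_interior|exact: nB|exact: interior_subset].
have mU0 := Sa _ oU Ua; have mV0 := Sb _ oV Vb.
have mU : measurable (U : set (borel D)) by exact: open_borel.
have mV : measurable (V : set (borel D)) by exact: open_borel.
have : (0 < e%:E * mu V * mu U)%E by rewrite !mule_gt0.
apply/negP; rewrite -leNgt -integral_T2_eq0.
rewrite -(integral_cst mu mU) integral_mkcond.
apply: ge0_le_integral => //.
- by move=> x _; rewrite patchE; case: ifP => // _; rewrite mule_ge0// lee_fin ltW.
- exact: (iffLR (measurable_restrictT (cst (e%:E * mu V)%E) mU) (measurable_cst _)).
- exact: measurable_partial_integral.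
- move=> x _; rewrite patchE; case: ifPn => [/set_mem Ux|_]; last first.
    by apply: integral_ge0 => y _; rewrite lee_fin.
  rewrite -(integral_cst mu mV) integral_mkcond.
  apply: ge0_le_integral => //.
  + by move=> y _; rewrite patchE; case: ifP => // _; rewrite lee_fin ltW.
  + exact: (iffLR (measurable_restrictT (cst e%:E) mV) (measurable_cst _)).
  + apply/measurable_EFinP; apply: continuous_borel_realfun => y.
    apply: (@continuous_comp _ _ _ (fun y => (x, y)) T2); last exact: cT2.
    by apply: cvg_pair; [exact: cvg_cst|exact: cvg_id].
  + move=> y _; rewrite patchE; case: ifPn => [/set_mem Vy|_]; rewrite lee_fin//.
    by apply: ltW; apply: (AB (x, y)); split; [exact: UA|exact: VB].
Qed.

Lemma law_support_linear a x y : S x -> S y -> g (a *: x + y) = a * g x + g y.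
Proof.
have gN x' : S x' -> g (- x') = - g x'.
  move=> Sx; have SNx : S (- x') by rewrite -scaleN1r; exact: SZ.
  by have := additive_on_support Sx SNx; rewrite subrr g0; lra.
have gZ x' : S x' -> g (a *: x') = a * g x'.
  move=> Sx; have [a0|a0|->] := ltgtP a 0; last by rewrite scale0r mul0r.
    rewrite -[in LHS](opprK a) scaleNr gN; last exact: SZ.
    by rewrite g_homog ?oppr_gt0// mulNr opprK.
  exact: g_homog.
by move=> Sx Sy; rewrite additive_on_support ?gZ//; exact: SZ.
Qed.

Lemma normal_law_of_increments : normal_law (fun B : set R => mu (g @^-1` B)).
Proof.
have [d d0 gd] : exists2 d, 0 < d & forall x, `|x| < d -> `|g x| <= 1.
  have /cvgrPdist_le/(_ 1 ltr01) := @cg 0.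
  move=> /nbhs_ballP[d /= d0 H]; exists d => // x xd.
  have := H x; rewrite -ball_normE /= sub0r normrN g0 sub0r normrN.
  by apply.
have gbound x : S x -> `|g x| <= 2 / d * `|x|.
  move=> Sx; have [->|x0] := eqVneq x 0; first by rewrite g0 !normr0 mulr0.
  have nx0 : 0 < `|x| by rewrite normr_gt0.
  (* This scaling gives [t *: x] the norm [d / 2], inside the ball where [g] is bounded by 1. *)
  pose t := d / (2 * `|x|).
  have t0 : 0 < t by rewrite divr_gt0// mulr_gt0.
  have : `|g (t *: x)| <= 1.
    apply: gd; rewrite normrZ gtr0_norm// /t invfM mulrA divfK ?gt_eqF//.
    by rewrite ltr_pdivrMr//; lra.
  rewrite g_homog// normrM gtr0_norm// => tg.
  rewrite -(ler_pM2l t0) (le_trans tg)// /t.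
  by rewrite le_eqVlt; apply/orP; left; apply/eqP; field; rewrite !gt_eqF.
have [l [cl lg]] := hahn_banach_norm S0 SP law_support_linear gbound.
have mg := continuous_borel_realfun cg.
have ml := continuous_linear_measurable cl.
(* [g] and [l] are known to agree on the support only, but its complement is null. *)
have E (B : set R) : measurable B -> mu (g @^-1` B) = mu (l @^-1` B).
  move=> mB.
  have mgB : measurable (g @^-1` B : set (borel D)) by rewrite -[_ @^-1` _]setTI; exact: mg.
  have mlB : measurable (l @^-1` B : set (borel D)) by rewrite -[_ @^-1` _]setTI; exact: ml.
  have mS := measurable_law_support mu.
  have full (A : set D) : measurable (A : set (borel D)) -> mu A = mu (A `&` S).
    move=> mA; rewrite -{1}(setIT A) -(setUv S) setIUr measureU//.
    - rewrite [X in (_ + X)%E](_ : _ = 0%E) ?adde0//.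
      apply/eqP; rewrite -measure_le0 -(law_support_full tmu).
      rewrite le_measure ?inE//; last exact: measurableC.
      by apply: measurableI => //; exact: measurableC.
    - exact: measurableI.
    - by apply: measurableI => //; exact: measurableC.
    - by rewrite setIACA setICr setI0.
  rewrite (full _ mgB) (full _ mlB); congr (mu _).
  by apply/seteqP; split => z [Bz Sz]; split => //; move: Bz; rewrite /preimage /= lg.
have [m [[s s0 H]|H]] := gmu cl; exists m.
- by left; exists s => // B mB; rewrite E// H.
- by right => B mB; rewrite E// H.
Qed.

End increments.

(** * Limits along good data *)

Section outer.
Context d (T : measurableType d) (R : realType) (P : probability T R).

Lemma outer_expectation_le (g h : T -> \bar R) : (forall x, g x <= h x)%E ->
  (outer_expectation P g <= outer_expectation P h)%E.
Proof.
move=> gh; apply: ereal_inf_le_tmp => _ [U [mU fU hU] <-].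
by exists U => //; split => // x; exact: le_trans (hU x).
Qed.

(** The indicator of a measurable cover of [A] is an admissible majorant: its negative part
    vanishes, so its expectation exists. *)
Lemma outer_expectation_le_probability (f : T -> R) (A : set T) :
  (forall x, f x <= 1) -> (forall x, ~ A x -> f x <= 0) ->
  (outer_expectation P (fun x => (f x)%:E) <= outer_probability P A)%E.
Proof.
move=> f1 f0; apply: le_ereal_inf_tmp => _ [B [mB AB] <-].
apply: ereal_inf_lbound; exists (fun x => (\1_B x)%:E); last by rewrite integral_indic// setIT.
split.
- by apply/measurable_EFinP; exact: measurable_indic.
- right; rewrite (_ : (fun x => _)^\-%E = cst 0%E) ?integral0//.
  apply/funext => x; rewrite funenegE; apply/max_idPr.
  by rewrite leeNl oppe0 lee_fin indicE.
- move=> x; rewrite lee_fin indicE; have [Bx|nBx] := pselect (B x).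
    by rewrite mem_set.
  by rewrite memNset//; apply: f0 => Ax; apply: nBx; exact: AB.
Qed.

(** Otherwise measurable covers of [B] and [C], of total mass below [c], would cover [A]. *)
Lemma outer_probability_avoid (A B C : set T) (c : R) :
  (c%:E <= outer_probability P A)%E -> (outer_probability P B < (c / 2)%:E)%E ->
  (outer_probability P C < (c / 2)%:E)%E -> exists x, [/\ A x, ~ B x & ~ C x].
Proof.
move=> cA /ereal_inf_lt[_ [B' [mB BB'] <-] PB] /ereal_inf_lt[_ [C' [mC CC'] <-] PC].
apply: contrapT => nx.
have : (outer_probability P A < c%:E)%E; last by rewrite ltNge cA.
have mBC : measurable (B' `|` C') by exact: measurableU.
apply: (@le_lt_trans _ _ (P (B' `|` C'))).
  apply: ereal_inf_lbound; exists (B' `|` C') => //; split => // x Ax.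
  apply: contrapT => /not_orP[nB nC]; apply: nx; exists x.
  by split => //; [move/BB'|move/CC'].
apply: (le_lt_trans (measureU2 _ mB mC)).
by rewrite [c]splitr EFinD lteD.
Qed.

End outer.

(** * Lipschitz minorants *)

Section inf_convolution.
Variables (R : realType) (V : normedModType R).
Implicit Types (h : V -> R) (j : nat).

(** The Pasch-Hausdorff envelope: for [h] bounded below, its largest [j]-Lipschitz minorant. *)
Definition inf_conv h j y := inf [set h z + j%:R * `|y - z| | z in [set: V]].

Variable h : V -> R.
Hypothesis h_ge : forall z, -1 <= h z.

Let has_inf_conv j y : has_inf [set h z + j%:R * `|y - z| | z in [set: V]].
Proof.
split; first by exists (h y + j%:R * `|y - y|), y.
exists (-1) => _ [z _ <-].
by rewrite (le_trans (h_ge z))// lerDl mulr_ge0.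
Qed.

Lemma inf_conv_le j y z : inf_conv h j y <= h z + j%:R * `|y - z|.
Proof. by apply: (ge_inf (has_inf_conv j y).2); exists z. Qed.

Lemma inf_conv_le_self j y : inf_conv h j y <= h y.
Proof. by have := inf_conv_le j y y; rewrite subrr normr0 mulr0 addr0. Qed.

Lemma inf_conv_geP j y c : (forall z, c <= h z + j%:R * `|y - z|) -> c <= inf_conv h j y.
Proof.
move=> H; apply: lb_le_inf; first exact: (has_inf_conv j y).1.
by move=> _ [z _ <-].
Qed.

Lemma inf_conv_lipschitz j x y :
  `|inf_conv h j x - inf_conv h j y| <= j%:R * `|x - y|.
Proof.
suff H x' y' : inf_conv h j x' - inf_conv h j y' <= j%:R * `|x' - y'|.
  rewrite ler_norml H andbT lerNl opprB (le_trans (H y x))//.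
  by rewrite distrC.
rewrite lerBlDr -lerBlDl; apply: inf_conv_geP => z.
rewrite lerBlDl (le_trans (inf_conv_le j x' z))// addrCA lerD2l -mulrDr ler_wpM2l//.
by rewrite -{1}(subrK y' x') -addrA ler_normD.
Qed.

Lemma inf_conv_cvg y : (forall z, h z <= 1) -> {for y, continuous h} ->
  inf_conv h j y @[j --> \oo] --> h y.
Proof.
move=> h1 ch; apply/cvgrPdist_le => e e0.
have /cvgrPdist_le/(_ _ e0)/nbhs_ballP[d /= d0 hd] := ch.
(* For such [j], the penalty at distance [d] or more is at least 2, the largest possible oscillation
   of [h]. *)
exists (Num.truncn (2 / d)).+1 => // j /= jd.
have {}jd : 2 / d <= j%:R.
  by rewrite (le_trans (ltW (truncnS_gt _)))// ler_nat.
rewrite ger0_norm ?subr_ge0 ?inf_conv_le_self// lerBlDl -lerBlDr.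
apply: inf_conv_geP => z; have [yz|yz] := ltP `|y - z| d.
  have := hd z; rewrite -ball_normE /= => /(_ yz); rewrite ler_norml => /andP[_ hz].
  have : 0 <= j%:R * `|y - z| by rewrite mulr_ge0.
  by lra.
have : 2 <= j%:R * `|y - z|.
  have := ler_pM _ _ jd yz; rewrite divfK ?gt_eqF//; apply; last exact: ltW.
  by rewrite divr_ge0// ltW.
by have := h_ge z; have := h1 y; lra.
Qed.

End inf_convolution.

(** * Hadamard difference quotients *)

Section hadamard.
Variables (R : realType) (D E : normedModType R) (Dphi : set D) (phi : D -> E).
Variables (theta : D) (D0 : set D) (dphi : D -> E).
Hypothesis hd : hadamard_directional_derivative Dphi phi theta D0 dphi.

(** With [s = r n], it sends [r n *: (v - theta)] to [r n *: (phi v - phi theta)]. *)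
Definition quotient (s : R) (y : D) := s *: (phi (theta + s^-1 *: y) - phi theta).

(** Counterexamples [(k, y)] at every scale would assemble into a sequence contradicting the
    sequential definition of the derivative. *)
Lemma hadamard_locally_uniform (s : nat -> R) (b : D) (e : R) :
  (forall k, 0 < s k) -> nondecreasing_seq s -> s @ \oo --> +oo -> D0 b -> 0 < e ->
  exists2 dl, 0 < dl & exists N : nat, forall k y, (N <= k)%N -> `|y - b| < dl ->
    Dphi (theta + (s k)^-1 *: y) -> `|quotient (s k) y - dphi b| < e.
Proof.
move=> s0 nds soo D0b e0; apply: contrapT => bad.
have ex (jN : nat * nat) : exists ky : nat * D,
    [/\ (jN.2 <= ky.1)%N, `|ky.2 - b| < jN.1.+1%:R^-1,
        Dphi (theta + (s ky.1)^-1 *: ky.2) & e <= `|quotient (s ky.1) ky.2 - dphi b|].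
  apply: contrapT => nex; apply: bad; exists jN.1.+1%:R^-1; first by rewrite invr_gt0.
  exists jN.2 => k y Nk yb Dy; rewrite ltNge; apply/negP => ey.
  by apply: nex; exists (k, y).
have [F FP] := choice ex.
(* The definition of the derivative asks for nonincreasing steps, so each new index is forced above
   the previous one. *)
pose u := fix u j : nat * D :=
  if j is j'.+1 then F (j, maxn j (u j').1) else F (0%N, 0%N).
have uP j : [/\ (j <= (u j).1)%N, `|(u j).2 - b| < j.+1%:R^-1,
    Dphi (theta + (s (u j).1)^-1 *: (u j).2) &
    e <= `|quotient (s (u j).1) (u j).2 - dphi b|].
  case: j => [|j]; first exact: (FP (0%N, 0%N)).
  have [h1 h2 h3 h4] := FP (j.+1, maxn j.+1 (u j).1); split => //.
  by rewrite (leq_trans _ h1)// leq_maxl.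
have umono : {homo (fun j => (u j).1) : i j / (i <= j)%N}.
  apply: homo_leq => [//|i j k|j]; first exact: leq_trans.
  have [h1 _ _ _] := FP (j.+1, maxn j.+1 (u j).1).
  by rewrite (leq_trans _ h1)//= leq_maxr.
have [_ H] := hd.
have ut : (fun j => (s (u j).1)^-1) @ \oo --> (0 : R).
  apply/gtr0_cvgV0; first by apply: nearW.
  apply: (@ger_cvgy _ _ _ _ s) => //; apply: nearW => j; apply: nds.
  by have [] := uP j.
have uh : (fun j => (u j).2) @ \oo --> b.
  apply/cvgrPdist_lt => r r0.
  have := near_infty_natSinv_lt (PosNum r0).
  by apply: filterS => j; apply: lt_trans; rewrite distrC; have [] := uP j.
have := H (fun j => (s (u j).1)^-1) (fun j => (u j).2) b _ _ ut uh D0b _.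
have up j : 0 < (s (u j).1)^-1 by rewrite invr_gt0.
have und : nonincreasing_seq (fun j => (s (u j).1)^-1).
  by move=> i j ij; rewrite lef_pV2 ?posrE//; apply: nds; exact: umono.
have uD j : Dphi (theta + (s (u j).1)^-1 *: (u j).2) by have [] := uP j.
move=> /(_ up und uD)/cvgrPdist_lt/(_ _ e0)[N _ /(_ N (leqnn N))] /=.
rewrite invrK sub0r normrN normr_id => lt_e.
have [_ _ _] := uP N.
by rewrite leNgt lt_e.
Qed.

End hadamard.

Section hadamard_limits.
Variables (R : realType) (D E : normedModType R) (Dphi : set D) (phi : D -> E).
Variables (theta : D) (D0 : set D) (dphi : D -> E).
Hypothesis hd : hadamard_directional_derivative Dphi phi theta D0 dphi.
Hypothesis cdphi : continuous dphi.
Variables (s : nat -> R) (a_ : nat -> D) (a : D).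
Hypotheses (s0 : forall k, 0 < s k) (nds : nondecreasing_seq s) (soo : s @ \oo --> +oo).
Hypotheses (a_a : a_ @ \oo --> a) (D0a : D0 a).
Hypothesis Da : forall k, Dphi (theta + (s k)^-1 *: a_ k).

Lemma quotient_cvg : quotient phi theta (s k) (a_ k) @[k --> \oo] --> dphi a.
Proof.
apply/cvgrPdist_lt => e e0.
have [dl dl0 [N HN]] := hadamard_locally_uniform hd s0 nds soo D0a e0.
have /cvgrPdist_lt/(_ _ dl0)[N' _ HN'] := a_a; exists (maxn N N') => // k /=.
rewrite geq_max => /andP[Nk N'k]; rewrite distrC; apply: HN => //.
by rewrite distrC; exact: HN'.
Qed.

(** [dphi] is determined only in directions reachable from within [Dphi]. The same points of [Dphi],
    read at the scales [s] and [c * s], give quotients that differ by the factor [c] and converge to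
    the two sides. *)
Lemma hadamard_homogeneous c : 0 < c -> D0 (c *: a) -> dphi (c *: a) = c *: dphi a.
Proof.
move=> c0 D0ca.
have c_neq0 : c != 0 by rewrite gt_eqF.
have qE k : quotient phi theta (c * s k) (c *: a_ k) = c *: quotient phi theta (s k) (a_ k).
  rewrite /quotient scalerA invfM scalerA mulrAC mulVf// mul1r.
  by [].
have s0' k : 0 < c * s k by rewrite mulr_gt0.
have nds' : nondecreasing_seq (fun k => c * s k).
  by move=> i j ij; rewrite ler_pM2l// nds.
have soo' : (fun k => c * s k) @ \oo --> +oo.
  apply/cvgryPge => A; have /cvgryPge/(_ (A / c)) := soo; apply: filterS => k.
  by rewrite ler_pdivrMr// mulrC.
have lim1 : c *: quotient phi theta (s k) (a_ k) @[k --> \oo] --> c *: dphi a.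
  by apply: cvgZl_tmp; exact: quotient_cvg.
have lim2 : c *: quotient phi theta (s k) (a_ k) @[k --> \oo] --> dphi (c *: a).
  under eq_fun do rewrite -qE.
  apply/cvgrPdist_lt => e e0.
  have [dl dl0 [N HN]] := hadamard_locally_uniform hd s0' nds' soo' D0ca e0.
  have dc0 : 0 < dl / c by rewrite divr_gt0.
  have /cvgrPdist_lt/(_ _ dc0)[N' _ HN'] := a_a; exists (maxn N N') => // k /=.
  rewrite geq_max => /andP[Nk N'k]; rewrite distrC; apply: HN => //.
    by rewrite -scalerBr normrZ gtr0_norm// mulrC -ltr_pdivlMr// distrC; exact: HN'.
  by rewrite invfM scalerA mulrAC mulVf// mul1r.
exact: cvg_unique lim2 lim1.
Qed.

Variable (S : set D).
Hypothesis D0aS : forall x, S x -> D0 (a + x).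

Lemma quotient_uniform (K : set D) (e : R) : compact K -> K `<=` S -> 0 < e ->
  exists2 dl, 0 < dl & exists N : nat, forall k x y, (N <= k)%N -> K x -> `|y - x| < dl ->
    Dphi (theta + (s k)^-1 *: (a_ k + y)) ->
    `|quotient phi theta (s k) (a_ k + y) - dphi (a + y)| < e.
Proof.
move=> cK KS e0.
pose P (A : set D) := (A `<=` S) -> exists2 dl, 0 < dl & exists N : nat,
  forall k x y, (N <= k)%N -> A x -> `|y - x| < dl ->
    Dphi (theta + (s k)^-1 *: (a_ k + y)) ->
    `|quotient phi theta (s k) (a_ k + y) - dphi (a + y)| < e.
pose Q (A : set D) := exists2 dl, 0 < dl & exists N : nat,
  forall k x y, (N <= k)%N -> A x -> `|y - x| < dl ->
    Dphi (theta + (s k)^-1 *: (a_ k + y)) ->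
    `|quotient phi theta (s k) (a_ k + y) - dphi (a + y)| < e.
suff : Q K by [].
apply: (compact_induction cK).
- by exists 1 => //; exists 0%N.
- move=> A B AB [dl dl0 [N HN]]; exists dl => //; exists N => k x y Nk Ax.
  by apply: HN => //; exact: AB.
- move=> A B [d1 d10 [N1 H1]] [d2 d20 [N2 H2]].
  exists (Num.min d1 d2); first by rewrite lt_min d10 d20.
  exists (maxn N1 N2) => k x y; rewrite geq_max => /andP[Nk1 Nk2] [Ax|Bx];
    rewrite lt_min => /andP[y1 y2].
    by move=> Dy; exact: (H1 k x y).
  by move=> Dy; exact: (H2 k x y).
- move=> x /KS Sx; have e20 : 0 < e / 2 by rewrite divr_gt0.
  have [dl dl0 [N HN]] := hadamard_locally_uniform hd s0 nds soo (D0aS Sx) e20.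
  have /cvgrPdist_lt/(_ _ e20)/nbhs_ballP[d' /= d'0 Hd'] := @cdphi (a + x).
  (* The distance [dl] is shared between [a_ k - a], which takes [dl / 3], and [y - x], which takes
     [2 * r]; continuity of [dphi] uses [2 * r <= d']. *)
  pose r := Num.min (dl / 3) (d' / 2).
  have r0 : 0 < r by rewrite lt_min !divr_gt0.
  have dl30 : 0 < dl / 3 by rewrite divr_gt0.
  have /cvgrPdist_lt/(_ _ dl30)[N' _ HN'] := a_a.
  exists (ball x r); first exact: nbhsx_ballx.
  exists r => //; exists (maxn N N') => k x' y; rewrite geq_max => /andP[Nk Nk'] xx' yx' Dy.
  have {}xx' : `|x - x'| < r by move: xx'; rewrite -ball_normE.
  have xy : `|y - x| < r + r.
    rewrite -(subrK x' y) -addrA (le_lt_trans (ler_normD _ _))// ltrD//.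
    by rewrite distrC.
  have rdl : r <= dl / 3 by rewrite ge_min lexx.
  have rd' : r <= d' / 2 by rewrite ge_min lexx orbT.
  have ak := HN' _ Nk'.
  have h1 : `|quotient phi theta (s k) (a_ k + y) - dphi (a + x)| < e / 2.
    apply: HN => //; rewrite opprD addrACA (le_lt_trans (ler_normD _ _))//.
    by rewrite distrC in ak; lra.
  have h2 : `|dphi (a + x) - dphi (a + y)| < e / 2.
    apply: Hd'; rewrite -ball_normE /= opprD addrACA subrr add0r distrC.
    by lra.
  rewrite -(subrK (dphi (a + x)) (quotient _ _ _ _)) -addrA.
  by rewrite (le_lt_trans (ler_normD _ _))// [e]splitr ltrD.
Qed.

End hadamard_limits.

Lemma lipschitz_continuous (R : realType) (V W : normedModType R) (f : V -> W) (M : R) :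
  (forall x y, `|f x - f y| <= M * `|x - y|) -> continuous f.
Proof.
move=> fl x; apply/cvgrPdist_lt => e e0.
have M1 : 0 < `|M| + 1 by rewrite ltr_wpDl.
have e'0 : 0 < e / (`|M| + 1) by rewrite divr_gt0.
have /cvgrPdist_lt/(_ _ e'0) := @cvg_id _ (nbhs x).
apply: filterS => y xy; rewrite (le_lt_trans (fl _ _))//.
apply: (@le_lt_trans _ _ ((`|M| + 1) * `|x - y|)).
  by rewrite ler_wpM2r// (le_trans (ler_norm M))// lerDl.
by rewrite mulrC -ltr_pdivlMr.
Qed.

(** * The limit of the bootstrap laws along fixed data *)

Section bootstrap_limit.
Variables (R : realType) (D E : normedModType R) (Dphi : set D) (phi : D -> E).
Variables (theta : D) (D0 : set D) (dphi : D -> E).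
Hypothesis hd : hadamard_directional_derivative Dphi phi theta D0 dphi.
Hypothesis cdphi : continuous dphi.
Variable mu : probability (borel D) R.
Hypothesis tmu : tight_law mu.
Local Notation S := (law_support mu).
Variables (s : nat -> R) (a_ : nat -> D) (a : D).
Hypotheses (s0 : forall k, 0 < s k) (nds : nondecreasing_seq s) (soo : s @ \oo --> +oo).
Hypotheses (a_a : a_ @ \oo --> a) (D0a : D0 a).
Hypothesis D0aS : forall x, S x -> D0 (a + x).
Variables (d : nat -> measure_display) (T : forall k, measurableType (d k)).
Variables (Q : forall k, probability (T k) R) (Z : forall k, T k -> D).
Arguments Z : clear implicits.
Hypothesis Da : forall k, Dphi (theta + (s k)^-1 *: a_ k).
Hypothesis DaZ : forall k w, Dphi (theta + (s k)^-1 *: (a_ k + Z k w)).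
Local Notation q k := (quotient phi theta (s k)).
Hypothesis Zlim : forall f, BL1 f -> forall k,
  (\int[mu]_z (f z)%:E - k.+1%:R^-1%:E <= outer_expectation (Q k) (fun w => (f (Z k w))%:E))%E.
Hypothesis Ylim : forall f, BL1 f -> forall k,
  (outer_expectation (Q k) (fun w => (f (q k (a_ k + Z k w) - q k (a_ k)))%:E) <=
   \int[mu]_z (f (dphi z))%:E + k.+1%:R^-1%:E)%E.

(** The argument is one-sided: away from [K] nothing is known of the quotients, and only [f >= -1]
    can be used there. The reverse inequality comes from applying this to [- f]. *)
Lemma bootstrap_limit_le f : BL1 f ->
  \int[mu]_z f (dphi (a + z) - dphi a) <= \int[mu]_z f (dphi z).
Proof.
move=> [f1 flip].
pose F z := f (dphi (a + z) - dphi a).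
have cf : continuous f.
  by apply: (@lipschitz_continuous _ _ _ _ 1) => x y; rewrite mul1r.
have cF : continuous F.
  move=> z; apply: (@continuous_comp _ _ _ (fun z => dphi (a + z) - dphi a) f); last exact: cf.
  apply: cvgB; last exact: cvg_cst.
  apply: (@continuous_comp _ _ _ (fun z => a + z) dphi); last exact: cdphi.
  by apply: cvgD; [exact: cvg_cst|exact: cvg_id].
have cfd : continuous (fun z => f (dphi z)).
  by move=> z; apply: (@continuous_comp _ _ _ dphi f); [exact: cdphi|exact: cf].
have F1 z : `|F z| <= 1 by exact: f1.
have bF : bounded_continuous F by split=> //; exists 1.
have bfd : bounded_continuous (fun z => f (dphi z)) by split=> //; exists 1.
apply/ler_addgt0Pr => e e0.
(* Two quotients cost [2 * r], and each of two truncations to [K] another [r]: in all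
   [4 * r <= e]. *)
pose r := Num.min 1 (e / 4).
have r0 : 0 < r by rewrite lt_min ltr01 divr_gt0.
have r1 : r <= 1 by rewrite ge_min lexx.
have re : r <= e / 4 by rewrite ge_min lexx orbT.
have [K0 cK0 muK0] := tight_law_compl tmu r0.
pose K := K0 `&` S.
have cK : compact K by apply: compact_closedI => //; exact: closed_law_support.
have mK : measurable (K : set (borel D)) by exact: compact_borel.
have mKC : measurable (~` K : set (borel D)) by exact: measurableC.
have muK : (mu (~` K) <= r%:E)%E.
  rewrite /K setCI; apply: (le_trans (measureU2 _ _ _)).
  - by apply: measurableC; exact: compact_borel.
  - by apply: measurableC; exact: measurable_law_support.
  - by rewrite [X in (_ + X)%E](law_support_full tmu) adde0.
have KS : K `<=` S by move=> z [].
have [dl dl0 [N1 HN1]] :=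
  quotient_uniform hd cdphi s0 nds soo a_a D0aS cK KS r0.
have /cvgrPdist_lt/(_ _ r0)[N2 _ HN2] := quotient_cvg hd s0 nds soo a_a D0a Da.
(* [F] where the quotients are controlled, and elsewhere the trivial lower bound of [f]. As [h] may
   be discontinuous, its Lipschitz minorants [H j] serve as test functions. *)
pose h z := if `[< exists2 x, K x & `|z - x| < dl >] then F z else -1.
have h_ge z : -1 <= h z.
  by rewrite /h; case: ifP => // _; have := F1 z; rewrite ler_norml => /andP[].
have h_le z : h z <= 1.
  rewrite /h; case: ifP => _; first by have := F1 z; rewrite ler_norml => /andP[].
  by rewrite (le_trans (lerN10 R)).
pose H j := inf_conv h j.
have Hlip j x y : `|H j x - H j y| <= j%:R * `|x - y| by exact: inf_conv_lipschitz.
have H1 j z : `|H j z| <= 1.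
  rewrite ler_norml (le_trans (inf_conv_le_self h_ge j z))// andbT.
  by apply: inf_conv_geP => // x; rewrite (le_trans (h_ge x))// lerDl mulr_ge0.
have bH j : bounded_continuous (H j).
  by split; [exact: lipschitz_continuous (Hlip j)|exists 1].
have pointwise j k w : (maxn N1 N2 <= k)%N ->
    H j (Z k w) - 2 * r <= f (q k (a_ k + Z k w) - q k (a_ k)).
  rewrite geq_max => /andP[Nk1 Nk2].
  apply: (@le_trans _ _ (h (Z k w) - 2 * r)).
    by rewrite lerD2r; exact: inf_conv_le_self.
  rewrite /h; case: ifPn => [/asboolP[x Kx xZ]|_]; last first.
    have := f1 (q k (a_ k + Z k w) - q k (a_ k)); rewrite ler_norml => /andP[+ _].
    by lra.
  have h1 := HN1 k x (Z k w) Nk1 Kx xZ (DaZ w).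
  have h2 := HN2 k Nk2.
  have := flip (q k (a_ k + Z k w) - q k (a_ k)) (dphi (a + Z k w) - dphi a).
  rewrite opprB (addrC (dphi a)) addrACA => h3.
  have {h3} := le_trans h3 (ler_normD _ _).
  rewrite (addrC (- q k (a_ k))) ler_norml => /andP[+ _].
  by rewrite -/(F (Z k w)) => h3; lra.
have step j : \int[mu]_z H j z - 2 * r <= \int[mu]_z f (dphi z).
  (* [H j - 2 * r] is bounded by 3 and [j]-Lipschitz, so the factor [1 / (j + 3)] puts it in
     [BL1]. *)
  pose c : R := j.+3%:R^-1.
  have c0 : 0 < c by rewrite invr_gt0.
  have c3 : c * 3 <= 1.
    by rewrite mulrC ler_pdivrMr// mul1r ler_nat.
  have cj : c * j%:R <= 1.
    by rewrite mulrC ler_pdivrMr// mul1r ler_nat -addn3 leq_addr.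
  have bl1 : BL1 (fun z => c * (H j z - 2 * r)).
    split=> [z|x y].
      rewrite normrM gtr0_norm// (le_trans _ c3)// ler_pM2l//.
      rewrite (le_trans (ler_normB _ _))//.
      have := H1 j z; rewrite (ger0_norm (mulr_ge0 _ (ltW r0)))//; lra.
    rewrite -mulrBr opprB addrA subrK normrM gtr0_norm//.
    rewrite (le_trans (ler_wpM2l (ltW c0) (Hlip j x y)))// mulrA.
    by rewrite ler_piMl.
  have bl2 : BL1 (fun z => c * f z).
    split=> [z|x y].
      by rewrite normrM gtr0_norm// (le_trans (ler_wpM2l (ltW c0) (f1 z)))//; lra.
    rewrite -mulrBr normrM gtr0_norm// (le_trans (ler_wpM2l (ltW c0) (flip x y)))//.
    by rewrite ler_piMl//; lra.
  have i1 := bounded_continuous_integrable mu (bH j).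
  have i2 := bounded_continuous_integrable mu bfd.
  have ic : mu.-integrable setT (EFin \o (fun=> 2 * r : R)).
    apply: (@bounded_continuous_integrable _ _ mu (fun=> 2 * r)); split.
      exact: cst_continuous.
    by exists `|2 * r| => _.
  have chain k : (maxn N1 N2 <= k)%N ->
      c * (\int[mu]_z H j z - 2 * r) <= c * \int[mu]_z f (dphi z) + 2 * k.+1%:R^-1.
    move=> Nk.
    have z1 := Zlim bl1 k; have z2 := Ylim bl2 k.
    have z3 : (outer_expectation (Q k) (fun w => (c * (H j (Z k w) - 2 * r))%:E) <=
        outer_expectation (Q k) (fun w => (c * f (q k (a_ k + Z k w) - q k (a_ k)))%:E))%E.
      by apply: outer_expectation_le => w; rewrite lee_fin ler_pM2l// pointwise.
    have := le_trans z1 (le_trans z3 z2).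
    have i3 : mu.-integrable setT (EFin \o (fun z => H j z - 2 * r)).
      exact: (integrableB measurableT i1 ic).
    have -> : (\int[mu]_z (c * (H j z - 2 * r))%:E)%E = (c * (\int[mu]_z H j z - 2 * r))%:E.
      rewrite -[X in _ - X](Rintegral_prob_cst mu) -RintegralB// -RintegralZl//.
      rewrite /Rintegral fineK//; apply: integrable_fin_num => //.
      exact: (integrableZl measurableT c i3).
    have -> : (\int[mu]_z (c * f (dphi z))%:E)%E = (c * \int[mu]_z f (dphi z))%:E.
      rewrite -RintegralZl// /Rintegral fineK//; apply: integrable_fin_num => //.
      exact: (integrableZl measurableT c i2).
    rewrite -EFinB -EFinD lee_fin.
    by move: (c * _) (c * _) (k.+1%:R^-1) => x y t xyt; lra.
  rewrite -(ler_pM2l c0); apply/ler_addgt0Pr => t t0.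
  have t20 : 0 < t / 2 by rewrite divr_gt0.
  have [M _ HM] := near_infty_natSinv_lt (PosNum t20).
  have k1 : (maxn N1 N2 <= maxn M (maxn N1 N2))%N by exact: leq_maxr.
  have k2 : (M <= maxn M (maxn N1 N2))%N by exact: leq_maxl.
  rewrite (le_trans (chain _ k1))// lerD2l.
  by rewrite mulrC -ler_pdivlMr// ltW//; exact: (HM _ k2).
(* On [K] the minorants [H j] tend to [F]; elsewhere this may fail, so the limit in [j] is taken
   under the indicator of [K]. *)
pose I1 : D -> R := \1_K.
pose I2 : D -> R := \1_(~` K).
have mI1 : measurable_fun [set: borel D] (I1 : borel D -> R) by exact: measurable_indic.
have mI2 : measurable_fun [set: borel D] (I2 : borel D -> R) by exact: measurable_indic.
have I12 z : I1 z + I2 z = 1.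
  rewrite /I1 /I2 !indicE in_setC; case: (z \in K); first by rewrite addr0.
  by rewrite add0r.
have I10 z : 0 <= I1 z by rewrite /I1 indicE.
have I20 z : 0 <= I2 z by rewrite /I2 indicE.
have iI2 : mu.-integrable setT (EFin \o I2).
  apply: (@bounded_integrable _ _ _ mu _ 1) => // z.
  by rewrite ger0_norm//; have := I12 z; have := I10 z; lra.
have intI2 : \int[mu]_z I2 z <= r.
  rewrite /Rintegral integral_indic// setIT -lee_fin fineK// fin_num_measure//.
have trunc (g : D -> R) : continuous g -> (forall z, `|g z| <= 1) ->
    [/\ mu.-integrable setT (EFin \o (fun z => g z * I1 z)),
        \int[mu]_z g z <= \int[mu]_z (g z * I1 z) + r &
        \int[mu]_z (g z * I1 z) <= \int[mu]_z g z + r].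
  move=> cg g1; have ig := bounded_continuous_integrable mu
    (conj cg (ex_intro _ 1 g1) : bounded_continuous g).
  have igI : mu.-integrable setT (EFin \o (fun z => g z * I1 z)).
    apply: (@bounded_integrable _ _ _ mu _ 1).
      by apply: measurable_funM => //; exact: continuous_borel_realfun.
    move=> z; rewrite normrM (ger0_norm (I10 z)) mulr_ile1//.
    by have := I12 z; have := I20 z; lra.
  split => //.
  - rewrite (le_trans _ (lerD (lexx _) intI2))// -RintegralD//.
    apply: le_Rintegral => //; first exact: (integrableD measurableT igI iI2).
    move=> z _; have -> : I1 z = 1 - I2 z by rewrite -(I12 z) addrK.
    have := I20 z; have := g1 z; rewrite ler_norml => /andP[_].
    by move: (g z) (I2 z) => u v u1 v0; nra.
  - rewrite (le_trans _ (lerD (lexx _) intI2))// -RintegralD//.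
    apply: le_Rintegral => //; first exact: (integrableD measurableT ig iI2).
    move=> z _; have -> : I1 z = 1 - I2 z by rewrite -(I12 z) addrK.
    have := I20 z; have := g1 z; rewrite ler_norml => /andP[+ _].
    by move: (g z) (I2 z) => u v u1 v0; nra.
have limH : \int[mu]_z (H j z * I1 z) @[j --> \oo] --> \int[mu]_z (F z * I1 z).
  apply: (@Rintegral_bounded_cvg _ _ _ mu _ _ 1).
  - by move=> j; apply: measurable_funM => //; apply: continuous_borel_realfun; have [] := bH j.
  - by apply: measurable_funM => //; exact: continuous_borel_realfun.
  - move=> j z; rewrite normrM (ger0_norm (I10 z)) mulr_ile1//.
    by have := I12 z; have := I20 z; lra.
  - move=> z; rewrite /I1 indicE; have [Kz|nKz] := pselect (K z); last first.
      by rewrite memNset// mulr0; under eq_fun do rewrite mulr0; exact: cvg_cst.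
    rewrite mem_set// mulr1; under eq_fun do rewrite mulr1.
    have nearF : {near z, F =1 h}.
      have : \forall y \near z, `|z - y| < dl.
        by have /cvgrPdist_lt := @cvg_id _ (nbhs z); exact.
      apply: filterS => y zy; rewrite /h ifT//; apply/asboolP; exists z => //.
      by rewrite distrC.
    have hz : h z = F z by rewrite (nbhs_singleton nearF).
    rewrite -hz; apply: inf_conv_cvg => //.
    rewrite /prop_for /continuous_at hz; apply: cvg_trans (cF z).
    exact: near_eq_cvg.
have bound j : \int[mu]_z (H j z * I1 z) <= \int[mu]_z f (dphi z) + 3 * r.
  have [_ _] := trunc (H j) (bH j).1 (H1 j).
  by have := step j; lra.
have : \int[mu]_z (F z * I1 z) <= \int[mu]_z f (dphi z) + 3 * r.
  by apply: (cvgr_to_le limH); exact: nearW.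
have [_ + _] := trunc F cF F1.
by rewrite -/(F _); lra.
Qed.

Lemma bootstrap_limit_eq f : BL1 f ->
  \int[mu]_z f (dphi (a + z) - dphi a) = \int[mu]_z f (dphi z).
Proof.
move=> bf; apply/eqP; rewrite eq_le bootstrap_limit_le//=.
have [f1 flip] := bf.
have bNf : BL1 (fun x => -1 * f x).
  split=> [x|x y]; first by rewrite mulN1r normrN.
  by rewrite !mulN1r opprK addrC distrC.
have cf : continuous f.
  by apply: (@lipschitz_continuous _ _ _ _ 1) => x y; rewrite mul1r.
have int (g : D -> E) : continuous g -> mu.-integrable setT (EFin \o (fun z => f (g z))).
  move=> cg; apply: bounded_continuous_integrable; split; last by exists 1.
  by move=> z; apply: (@continuous_comp _ _ _ g f); [exact: cg|exact: cf].
have := bootstrap_limit_le bNf; rewrite !RintegralZl//.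
- by rewrite !mulN1r lerN2.
- exact: int.
- apply: int => z; apply: cvgB; last exact: cvg_cst.
  apply: (@continuous_comp _ _ _ (fun z => a + z) dphi); last exact: cdphi.
  by apply: cvgD; [exact: cvg_cst|exact: cvg_id].
Qed.

End bootstrap_limit.

(** * Consistency of the bootstrap *)

Section portmanteau.
Variables (R : realType) (V : normedModType R) (mu : probability (borel V) R).
Variables (d : nat -> measure_display) (T : forall n, measurableType (d n)).
Variables (P : forall n, probability (T n) R) (Y : forall n, T n -> V).

(** The tent function [f] of radius [e] at [a] is at least 1/2 on a ball charged by [mu], so its
    integral is positive, while its outer expectation is at most the outer probability in
    question. *)
Lemma cvg_in_law_support a e : cvg_in_law P Y mu -> law_support mu a -> 0 < e ->
  exists2 c, 0 < c &
    \forall n \near \oo, (c%:E <= outer_probability (P n) [set x | (`|@Y n x - a| < e)%R])%E.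
Proof.
move=> Ymu Sa e0.
pose f z := Num.max 0 (1 - e^-1 * `|z - a|).
have f0 z : 0 <= f z by rewrite le_max lexx.
have f1 z : f z <= 1 by rewrite ge_max ler01/= gerBl mulr_ge0// invr_ge0 ltW.
have fout z : e <= `|z - a| -> f z <= 0.
  by move=> ez; rewrite ge_max lexx/= subr_le0 mulrC ler_pdivlMr// mul1r.
have fin z : `|z - a| < e / 2 -> 1 / 2 <= f z.
  move=> ze; rewrite le_max; apply/orP; right.
  have : e^-1 * `|z - a| <= 1 / 2; last by lra.
  by rewrite mulrC ler_pdivrMr// mulrC mulrA mulr1 ltW.
have fl x y : `|f x - f y| <= e^-1 * `|x - y|.
  have mono u v : u - v <= e^-1 * `|x - y| ->
      Num.max 0 u - Num.max 0 v <= e^-1 * `|x - y|.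
    have k0 : 0 <= e^-1 * `|x - y| by rewrite mulr_ge0// invr_ge0 ltW.
    by case: (leP 0 u); case: (leP 0 v) => ? ? ?; lra.
  have tri u v : `|u - a| <= `|u - v| + `|v - a|.
    by rewrite -{1}(subrK v u) -addrA ler_normD.
  have ei0 : 0 <= e^-1 by rewrite invr_ge0 ltW.
  rewrite ler_norml lerNl opprB; apply/andP; split.
    apply: mono; have := ler_wpM2l ei0 (tri x y); rewrite mulrDr; lra.
  apply: mono; have := ler_wpM2l ei0 (tri y x); rewrite (distrC y x) mulrDr; lra.
have bf : bounded_continuous f.
  split; first exact: lipschitz_continuous fl.
  by exists 1 => z; rewrite ger0_norm.
have fi := bounded_continuous_integrable mu bf.
pose B : set (borel V) := ball a (e / 2).
have oB : open (B : set V) by exact: ball_open.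
have mB : measurable B by exact: open_borel.
have B0 : (0 < mu B)%E by apply: Sa => //; apply: ballxx; rewrite divr_gt0.
have intf : (0 < \int[mu]_z (f z)%:E)%E.
  apply: (@lt_le_trans _ _ (\int[mu]_z (1 / 2 * \1_B z)%:E)%E).
    under eq_integral do rewrite EFinM.
    rewrite ge0_integralZl//; last by apply/measurable_EFinP; exact: measurable_indic.
    by rewrite integral_indic// setIT mule_gt0// lte_fin divr_gt0.
  apply: ge0_le_integral => //.
  - by apply/measurable_EFinP; apply: measurable_funM => //; exact: measurable_indic.
  - by have /measurable_int := fi.
  - move=> z _; rewrite lee_fin indicE; have [Bz|nBz] := pselect (B z).
      rewrite mem_set// mulr1; apply: fin.
      by move: Bz; rewrite /B -ball_normE /= distrC.
    by rewrite memNset// mulr0.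
have fI : (\int[mu]_z (f z)%:E)%E \is a fin_num by exact: integrable_fin_num.
move: intf fI (Ymu f bf); case: (\int[mu]_z (f z)%:E)%E => // I I0 _ /= YI.
rewrite lte_fin in I0.
exists (I / 2); first by rewrite divr_gt0.
have I2I : ((I / 2)%:E < I%:E)%E by rewrite lte_fin; lra.
have {}YI : \forall n \near \oo, ((I / 2)%:E < outer_expectation (P n) (fun x => (f (Y x))%:E))%E.
  exact: YI _ (open_ereal_gt' I2I).
apply: filterS YI => n /ltW In.
apply: (le_trans In); apply: outer_expectation_le_probability => // x /negP.
by rewrite -leNgt => /fout.
Qed.

End portmanteau.

Lemma BL_discrepancy_bounds d (T : measurableType d) (R : realType) (D V : normedModType R)
    (Q : probability T R) (Z : T -> V) (mu : probability (borel D) R) (g : D -> V)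
    (e : R) (f : V -> R) :
  continuous g -> (`|BL_discrepancy Q Z mu g| <= e%:E)%E -> BL1 f ->
  (\int[mu]_z (f (g z))%:E - e%:E <= outer_expectation Q (fun w => (f (Z w))%:E) <=
   \int[mu]_z (f (g z))%:E + e%:E)%E.
Proof.
move=> cg de [f1 fl].
have cf : continuous f.
  by apply: (@lipschitz_continuous _ _ _ _ 1) => x y; rewrite mul1r.
have fi : mu.-integrable setT (EFin \o (f \o g)).
  apply: bounded_continuous_integrable; split; last by exists 1 => z; exact: f1.
  by move=> z; apply: continuous_comp; [exact: cg|exact: cf].
have fI : (\int[mu]_z (f (g z))%:E)%E \is a fin_num by exact: (integrable_fin_num _ fi).
have : (`|outer_expectation Q (fun w => (f (Z w))%:E) - \int[mu]_z (f (g z))%:E| <= e%:E)%E.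
  apply: le_trans (le_trans (lee_abs _) de).
  by apply: ereal_sup_ubound; exists f.
move: (outer_expectation _ _) fI => o.
case: (\int[mu]_z (f (g z))%:E)%E => // I _; case: o => [v| |]; rewrite ?leye_eq//=.
by rewrite !lee_fin ler_norml lerBlDr lerBrDr addrC (addrC e).
Qed.

Section bootstrap.
Variables (R : realType) (D E : normedModType R) (D0 Dphi : set D) (theta0 : D).
Variables (phi dphi : D -> E).
Variables (dX : nat -> measure_display) (X : forall n, measurableType (dX n)).
Variables (dW : nat -> measure_display) (W : forall n, measurableType (dW n)).
Variables (P : forall n, probability (X n) R) (Q : forall n, probability (W n) R).
Variables (theta_hat : forall n, X n -> D) (theta_star : forall n, X n -> W n -> D).
Variables (r : nat -> R) (mu : probability (borel D) R).
Hypothesis D_hat : forall n x, Dphi (@theta_hat n x).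
Hypothesis D_star : forall n x w, Dphi (@theta_star n x w).
Hypothesis hd : hadamard_directional_derivative Dphi phi theta0 D0 dphi.
Hypothesis cdphi : continuous dphi.
Hypotheses (ndr : nondecreasing_seq r) (roo : r @ \oo --> +oo).
Hypothesis hat_law : cvg_in_law P (fun n x => r n *: (@theta_hat n x - theta0)) mu.
Hypothesis tmu : tight_law mu.
Hypothesis S_D0 : law_support mu `<=` D0.
Hypothesis subS : vector_subspace (law_support mu).

Let S_comb c x y : law_support mu x -> law_support mu y -> law_support mu (c *: x + y).
Proof. by have [_ lS] := subS => Sx Sy; apply/set_mem/lS; exact/mem_set. Qed.

Let disc n x := BL_discrepancy (Q n)
  (fun w => r n *: (@theta_star n x w - theta_hat x)) mu (fun z => z).
Let disc_phi n x := BL_discrepancy (Q n)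
  (fun w => r n *: (phi (@theta_star n x w) - phi (theta_hat x))) mu dphi.
Hypothesis disc_op1 : is_op1 P disc.
Hypothesis disc_phi_op1 : is_op1 P disc_phi.

(** The data near [a] keep outer probability at least some [c > 0], while those violating either
    discrepancy bound eventually have less than [c / 2]. *)
Let good_data a k : law_support mu a -> exists N, forall n, (N <= n)%N -> exists x : X n,
  [/\ 0 < r n, `|r n *: (theta_hat x - theta0) - a| < k.+1%:R^-1,
      (`|disc x| <= k.+1%:R^-1%:E)%E & (`|disc_phi x| <= k.+1%:R^-1%:E)%E].
Proof.
move=> Sa; have e0 : 0 < k.+1%:R^-1 :> R by rewrite invr_gt0.
have [c c0 [N1 _ H1]] := cvg_in_law_support hat_law Sa e0.
have c20 : (0%E < (c / 2)%:E)%E by rewrite lte_fin divr_gt0.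
have [N2 _ H2] := disc_op1 e0 (open_ereal_lt' c20).
have [N3 _ H3] := disc_phi_op1 e0 (open_ereal_lt' c20).
have [N4 _ H4] := (cvgryPgt _).1 roo 0.
exists (maxn (maxn N1 N2) (maxn N3 N4)) => n.
rewrite !geq_max => /andP[/andP[n1 n2] /andP[n3 n4]].
have [x [x1 x2 x3]] := outer_probability_avoid (H1 n n1) (H2 n n2) (H3 n n3).
by exists x; split; [exact: H4|exact: x1|rewrite leNgt; exact/negP|rewrite leNgt; exact/negP].
Qed.

Let good_sequence a : law_support mu a -> exists (n : nat -> nat) (x : forall k, X (n k)),
  [/\ nondecreasing_seq (r \o n), (r \o n) @ \oo --> +oo,
      r (n k) *: (theta_hat (x k) - theta0) @[k --> \oo] --> a &
      forall k, [/\ 0 < r (n k),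
      (`|disc (x k)| <= k.+1%:R^-1%:E)%E & (`|disc_phi (x k)| <= k.+1%:R^-1%:E)%E]].
Proof.
move=> Sa; have [N HN] := choice (fun k => @good_data a k Sa).
(* A running maximum: [n] is nondecreasing, as the Hadamard derivative requires of the scales
   [r (n k)], and at least [k], so that they diverge. *)
pose n k := (\max_(i < k.+1) maxn i (N i))%N.
have n_ge i k : (i <= k)%N -> (maxn i (N i) <= n k)%N.
  by rewrite -ltnS => ik; exact: (leq_bigmax (Ordinal ik)).
have nmono i k : (i <= k)%N -> (n i <= n k)%N.
  move=> ik; apply/bigmax_leqP => j _; apply: n_ge.
  by rewrite (leq_trans _ ik)// -ltnS.
have kn k : (k <= n k)%N by rewrite (leq_trans (leq_maxl _ _) (n_ge k k _)).
have Nn k : (N k <= n k)%N by rewrite (leq_trans (leq_maxr _ _) (n_ge k k _)).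
pose x k := sval (cid (HN k _ (Nn k))).
have xP k := svalP (cid (HN k _ (Nn k))).
exists n, x; split.
- by move=> i k ik; apply: ndr; exact: nmono.
- by apply: (@ger_cvgy _ _ _ _ r) => //; apply: nearW => k; exact: ndr.
- apply/cvgrPdist_lt => e e0.
  apply: filterS (near_infty_natSinv_lt (PosNum e0)) => k.
  by apply: lt_trans; rewrite distrC; have [] := xP k.
- by move=> k; have [] := xP k.
Qed.

Let hatE n (x : X n) : 0 < r n -> theta0 + (r n)^-1 *: (r n *: (theta_hat x - theta0)) = theta_hat x.
Proof. by move=> rn; rewrite scalerA mulVf ?gt_eqF// scale1r addrC subrK. Qed.

Let starE n (x : X n) w : 0 < r n ->
  theta0 + (r n)^-1 *: (r n *: (theta_hat x - theta0) + r n *: (theta_star x w - theta_hat x)) =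
  theta_star x w.
Proof.
move=> rn; rewrite -scalerDr scalerA mulVf ?gt_eqF// scale1r.
by rewrite (addrC (_ - theta0)) subrKA addrC subrK.
Qed.

Lemma dphi_homogeneous c a : 0 < c -> law_support mu a -> dphi (c *: a) = c *: dphi a.
Proof.
move=> c0 Sa; have [n [x [ndn rn xa xP]]] := good_sequence Sa.
have [S1 _] := subS.
apply: (hadamard_homogeneous hd (s := r \o n)
  (a_ := fun k => r (n k) *: (theta_hat (x k) - theta0))) => //.
- by move=> k; have [] := xP k.
- exact: S_D0.
- by move=> k; rewrite /= hatE//; have [] := xP k.
- apply: S_D0; rewrite -[c *: a]addr0; apply: S_comb => //; exact/set_mem/S1.
Qed.

Lemma dphi_increments a f : law_support mu a -> BL1 f ->
  \int[mu]_z f (dphi (a + z) - dphi a) = \int[mu]_z f (dphi z).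
Proof.
move=> Sa bf; have [n [x [ndn rn xa xP]]] := good_sequence Sa.
have rn0 k : 0 < r (n k) by have [] := xP k.
apply: (@bootstrap_limit_eq R D E Dphi phi theta0 D0 dphi hd cdphi mu tmu
  (r \o n) (fun k => r (n k) *: (theta_hat (x k) - theta0)) a rn0 ndn rn xa _ _
  (fun k => dW (n k)) (fun k => W (n k)) (fun k => Q (n k))
  (fun k w => r (n k) *: (theta_star (x k) w - theta_hat (x k)))) => //.
- exact: S_D0.
- by move=> z Sz; apply: S_D0; rewrite -[a]scale1r; exact: S_comb.
- by move=> k; rewrite /= hatE.
- by move=> k w; rewrite /= starE.
- move=> g bg k; have [_ dk _] := xP k.
  by have /andP[] := BL_discrepancy_bounds (fun z => @cvg_id _ (nbhs z)) dk bg.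
- move=> g bg k; have [_ _ dk] := xP k.
  have /andP[_] := BL_discrepancy_bounds cdphi dk bg.
  apply: le_trans; apply: outer_expectation_le => w.
  by rewrite /quotient /= starE// hatE// -scalerBr opprB addrA subrK.
Qed.

Hypothesis gmu : gaussian_law mu.

Lemma gaussian_bootstrap_limit : gaussian_law (pushforward mu (dphi : borel D -> borel E)).
Proof.
move=> l cl.
have [C C0 lC] : exists2 C, 0 < C & forall x, `|l x| <= C * `|x|.
  have /linear_boundedP/pinfty_ex_gt0[C C0 lC] := @continuous_linear_bounded _ _ _ 0 l (cl 0).
  by exists C.
have -> : (fun B : set R => pushforward mu (dphi : borel D -> borel E) (l @^-1` B)) =
          (fun B => mu ((fun z => l (dphi z)) @^-1` B)) by [].
apply: (normal_law_of_increments tmu gmu subS).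
- by move=> z; apply: (@continuous_comp _ _ _ dphi l); [exact: cdphi|exact: cl].
- by move=> t z t0 Sz; rewrite dphi_homogeneous// linearZ.
- move=> a h M Sa hM hl.
  have M0 : 0 <= M by rewrite (le_trans _ (hM 0)).
  (* The map [h (l y)] is bounded by [M] and has slope [M * C]; the factor [k] brings both below
     1. *)
  pose k : R := ((M + 1) * (C + 1))^-1.
  have MC : 0 < (M + 1) * (C + 1) by rewrite mulr_gt0// ltr_wpDl// ltW.
  have k0 : 0 < k by rewrite invr_gt0.
  have kM : k * M <= 1 by rewrite mulrC ler_pdivrMr// mul1r; nra.
  have kMC : k * (M * C) <= 1 by rewrite mulrC ler_pdivrMr// mul1r; nra.
  have bl : BL1 (fun y : E => k * h (l y)).
    split=> [y|y y'].
      by rewrite normrM gtr0_norm// (le_trans (ler_wpM2l (ltW k0) (hM _))).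
    rewrite -mulrBr normrM gtr0_norm// (le_trans (ler_wpM2l (ltW k0) (hl _ _)))//.
    rewrite -linearB (le_trans (ler_wpM2l (ltW k0) (ler_wpM2l M0 (lC _))))//.
    by rewrite !mulrA -(mulrA k) ler_piMl.
  have ch : continuous h by exact: lipschitz_continuous hl.
  have int (u : D -> E) : continuous u -> mu.-integrable setT (EFin \o (fun z => h (l (u z)))).
    move=> cu; apply: bounded_continuous_integrable; split; last by exists M.
    move=> z; apply: (@continuous_comp _ _ _ (fun z => l (u z)) h); last exact: ch.
    by apply: (@continuous_comp _ _ _ u l); [exact: cu|exact: cl].
  have := dphi_increments Sa bl; rewrite !RintegralZl//; [|exact: int|].
    move=> /mulfI; rewrite gt_eqF// => /(_ isT) <-.
    by apply: eq_Rintegral => z _; rewrite linearB.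
  apply: int => z; apply: cvgB; last exact: cvg_cst.
  apply: (@continuous_comp _ _ _ (fun z => a + z) dphi); last exact: cdphi.
  by apply: cvgD; [exact: cvg_cst|exact: cvg_id].
Qed.

End bootstrap.

Theorem corollary3p1 (R : realType) (D E : completeNormedModType R)
    (D0 Dphi : set D) (theta0 : D) (phi dphi : D -> E)
    (* sample spaces of the X_i and of the W_i *)
    (dX : measure_display) (X : measurableType dX)
    (dW : measure_display) (W : measurableType dW)
    (* laws of the data, of the weights, and their joint law *)
    (P : forall n : nat, probability (n.-tuple X) R)
    (Q : forall n : nat, probability (n.-tuple W) R)
    (J : forall n : nat, probability (n.-tuple X * n.-tuple W)%type R)
    (theta_hat : forall n : nat, n.-tuple X -> D)
    (theta_star : forall n : nat, n.-tuple X -> n.-tuple W -> D)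
    (r : nat -> R) (G0 : probability (borel D) R) :
  Dphi theta0 ->
  (forall n x, Dphi (theta_hat n x)) ->
  (forall n x w, Dphi (theta_star n x w)) ->
  hadamard_directional_derivative Dphi phi theta0 D0 dphi ->
  continuous dphi ->
  nondecreasing_seq r -> r @ \oo --> +oo ->
  cvg_in_law P (fun n x => r n *: (theta_hat n x - theta0)) G0 ->
  tight_law G0 ->
  law_support G0 `<=` D0 ->
  (forall n, independent_coordinates (P n) (Q n) (J n)) ->
  is_op1 P (fun n x =>
    BL_discrepancy (Q n)
      (fun w => r n *: (theta_star n x w - theta_hat n x)) G0 (fun z => z)) ->
  asymptotically_measurable J
    (fun n xw => r n *: (theta_star n xw.1 xw.2 - theta_hat n xw.1)) ->
  (forall f : D -> R, bounded_continuous f -> forall n,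
     {ae P n, forall x, measurable_fun [set: n.-tuple W]
        (fun w => f (r n *: (theta_star n x w - theta_hat n x)))}) ->
  gaussian_law G0 ->
  vector_subspace (law_support G0) ->
  ~ gaussian_law (pushforward G0 (dphi : borel D -> borel E)) ->
  ~ is_op1 P (fun n x =>
      BL_discrepancy (Q n)
        (fun w => r n *: (phi (theta_star n x w) - phi (theta_hat n x)))
        G0 dphi).
Proof.
move=> _ D_hat D_star hd cdphi ndr roo hat_law tmu S_D0 _ disc_op1 _ _ gmu subS not_gaussian.
move=> disc_phi_op1; apply: not_gaussian.
exact: (gaussian_bootstrap_limit D_hat D_star hd cdphi ndr roo hat_law tmu S_D0 subS
  disc_op1 disc_phi_op1 gmu).
Qed.
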